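(* Fix $h\in\mathbb R$ with $\kappa(h)=\frac h3\left(\frac h3-1\right)>0$ (equivalently $h<0$ or $h>3$) and $M\ge 0$. Let $W:\mathrm{GL}_+(3,\mathbb R)\to[0,\infty)$ be a smooth strain energy function which is objective, isotropic and homogeneous of degree $h$, and suppose that $$W(F(\lambda,\omega))=v^{h/3}f(u),\qquad v=\lambda_1\lambda_2^2,\quad u=\lambda_1/\lambda_2,\qquad\text{for all }\lambda\in\mathbb R_+^2,\ \omega\in S^2,$$ with $f\in\mathcal C(M)$. Let $S=\partial W/\partial F$ and $\beta(f)=f''(1)$. Suppose that $\beta(f)$ is sufficiently large (how large depending only on $h$ and $M$). Then there exist a $C^2$ spherically symmetric orientation-preserving deformation $\varphi:\overline{\mathcal B}\to\mathbb R^3$, $\varphi(y)=\phi(r)\omega$ with $r=|y|$, $\omega=y/|y|$, and an eigenvalue $\mu\in\mathbb R$ with $\operatorname{sgn}\mu=-\operatorname{sgn}h$, satisfying $$D_y\cdot S(D_y\varphi)=\mu\varphi\ \text{ in }\mathcal B,\qquad S(D_y\varphi)\,\omega=0\ \text{ on }\partial\mathcal B,$$ and such that, with $\lambda_1(r)=\phi'(r)$, $\lambda_2(r)=\phi(r)/r$: if $h<0$ then $\varphi(\overline{\mathcal B})\supset\overline{\mathcal B}$ and $\lambda_1(r)>\lambda_2(r)>1$ for $r\in(0,1]$; if $h>3$ then $\varphi(\overline{\mathcal B})\subset\overline{\mathcal B}$ and $\lambda_1(r)<\lambda_2(r)<1$ for $r\in(0,1]$. Moreover, for this $\varphi$ and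 $\mu$, and given $(a(0),\dot a(0))\in\mathbb R_+\times\mathbb R$, let $a:[0,\tau)\to\mathbb R_+$ be the positive $C^2$ solution, on its maximal interval of existence, of the initial value problem for $\ddot a(t)=\mu\, a(t)^{h-1}$ with these initial data. Then $x(t,y)=a(t)\varphi(y)$ is a motion in $C^2([0,\tau)\times\overline{\mathcal B})$ satisfying $$D_t^2x-D_y\cdot S(D_yx)=0\ \text{ in }[0,\tau)\times\mathcal B,\qquad S(D_yx(t,y))\,\omega=0\ \text{ on }[0,\tau)\times\partial\mathcal B.$$ Under this motion, the spatial configuration of the elastic body at time $t$ is a sphere $\Omega_t$ of radius $a(t)\phi(1)$. Furthermore: (i) If $h<0$, then the lifespan of the solution satisfies $\tau=+\infty$ and $$0<(2E(0))^{1/2}-a(t)/t\to0,\quad\text{as }t\to\infty,$$ where $E(0)=\frac12\dot a(0)^2-\frac{\mu}{h}a(0)^h$. (ii) If $h>3$, then $\tau<\infty$ and $a(t)\to0$ as $t\to\tau$.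
   Context: Notation: $\mathbb R_+=(0,\infty)$; $\mathcal B=\{y\in\mathbb R^3:|y|<1\}$ is the reference domain (called the unit sphere); $\Omega_t$ is the image of $\mathcal B$ under $x(t,\cdot)$, and ''sphere'' means the solid sphere (ball); $S^2$ is the set of unit vectors in $\mathbb R^3$; $\mathrm{GL}_+(3,\mathbb R)$ is the set of real $3\times3$ matrices with positive determinant. On $\partial\mathcal B$, $\omega=y/|y|$ is the outward unit normal. For a matrix field $A$, $(D_y\cdot A)_i=\sum_jD_jA_{ij}$, and $(D_y\varphi)_{ij}=D_j\varphi_i$. $W$ is objective if $W(UF)=W(F)$, and isotropic if $W(FU)=W(F)$, for all $F\in\mathrm{GL}_+(3,\mathbb R)$ and $U\in\mathrm{SO}(3,\mathbb R)$; it is homogeneous of degree $h$ if $W(\sigma F)=\sigma^hW(F)$ for all $F\in \mathrm{GL}_+(3,\mathbb R)$, $\sigma>0$. $S(F)=\partial W/\partial F(F)$ is the first Piola-Kirchhoff stress (a $3\times 3$ matrix). For $\lambda=(\lambda_1,\lambda_2)\in\mathbb R_+^2$ and $\omega\in S^2$, $F(\lambda,\omega)=\lambda_1P_1(\omega)+\lambda_2P_2(\omega)$ with $P_1(\omega)=\omega\otimes\omega$, $P_2(\omega)=I-\omega\otimes\omega$. For $W$ objective, isotropic and homogeneous of degree $h$ one always has $W(F(\lambda,\omega))=v^{h/3}f(u)$ for some function $f:\mathbb R_+\to[0,\infty)$ with $f'(1)=0$. The class $\mathcal C(M)$: all $f\in C^3$ on $\{|u-1|\le1/8\}$ with $f(1)=1$,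 $f'(1)=0$, $f''(1)>0$ and $\sup_{|u-1|\le 1/8}|f'''(u)|\le Mf''(1)$. For $f$ defined on $\mathbb R_+$, $f\in\mathcal C(M)$ means that its restriction to $\{|u-1|\le1/8\}$ is in $\mathcal C(M)$. An orientation-preserving deformation of $\overline{\mathcal B}$ is an injective map $\varphi:\overline{\mathcal B}\to\mathbb R^3$ with $D_y\varphi:\overline{\mathcal B}\to\mathrm{GL}_+(3,\mathbb R)$. It is spherically symmetric ($C^2$) if $\varphi(y)=\phi(r)\omega$ with $\phi\in C^2([0,1])$, $\phi(0)=\phi''(0)=0$, $\phi'>0$ on $[0,1]$. A motion is a time-dependent family $x(t,\cdot)$ of orientation-preserving deformations of $\overline{\mathcal B}$. The reference density is taken equal to $1$.
   Formalization: In (i) the printed inequality 0<(2E(0))^{1/2}-a(t)/t is false (h=-2 with initial velocity ≥0 gives a(t)/t>(2E(0))^{1/2} for all t>0); it is replaced by 0<(2E(0))^{1/2}-(a(t)-a(0))/t for all t>0, while the limit (2E(0))^{1/2}-a(t)/t→0 is kept as printed. *)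

(* Defs.v *)
From HB Require Import structures.
From mathcomp Require Import all_boot all_order all_algebra.
From mathcomp Require Import all_classical all_reals all_analysis.

Set Implicit Arguments.
Unset Strict Implicit.
Unset Printing Implicit Defensive.

Import Order.TTheory GRing.Theory Num.Theory.
Import numFieldNormedType.Exports.

Local Open Scope classical_set_scope.
Local Open Scope ring_scope.

(* Differential calculus relative to a set [A] that need not be open: the
   library differential ['d f F] is taken along the filter [F] of neighbourhoods
   of [x] in [A].  It is one-sided at boundary points, coincides with ['d f x]
   when [A] is open, and is meant for [A] contained in the closure of its
   interior (balls, intervals, products of these), where it is unique. *)
Section CalculusOnSets.
Context {R : realType} {V W : normedModType R}.

Definition diff_on (A : set V) (f : V -> W) (x : V) : V -> W :=
  'd f (within A (nbhs x)).

Definition within_differentiable (A : set V) (f : V -> W) : Prop :=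
  forall x, A x -> differentiable f (within A (nbhs x)).

Fixpoint Ck_on (k : nat) (A : set V) (f : V -> W) : Prop :=
  if k is k'.+1 then
    within_differentiable A f /\
    forall v : V, Ck_on k' A (fun x => diff_on A f x v)
  else {within A, continuous f}.

Definition smooth_on (A : set V) (f : V -> W) : Prop := forall k, Ck_on k A f.

End CalculusOnSets.

(* [deriv_on k A f] is the [k]-th derivative of a curve [f] relative to [A]. *)
Definition deriv_on {R : realType} {W : normedModType R} (k : nat) (A : set R)
    (f : R -> W) : R -> W :=
  iter k (fun g x => diff_on A g x 1) f.

Section Elasticity.
Context {R : realType}.

(* The library norm on matrices is the maximum norm, hence this definition. *)
Definition enorm (y : 'cV[R]_3) : R := Num.sqrt (\sum_i y i 0 ^+ 2).

Definition oball (rho : R) : set 'cV[R]_3 := [set y | enorm y < rho].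
Definition cball (rho : R) : set 'cV[R]_3 := [set y | enorm y <= rho].
Definition esphere (rho : R) : set 'cV[R]_3 := [set y | enorm y = rho].

(* [udir 0 = 0], because [0^-1 = 0]. *)
Definition udir (y : 'cV[R]_3) : 'cV[R]_3 := (enorm y)^-1 *: y.

Definition GLp : set 'M[R]_3 := [set F | 0 < \det F].
Definition SO3 : set 'M[R]_3 := [set U | U *m U^T = 1%:M /\ \det U = 1].

Definition objective (W : 'M[R]_3 -> R) : Prop :=
  forall F U, GLp F -> SO3 U -> W (U *m F) = W F.

Definition isotropic (W : 'M[R]_3 -> R) : Prop :=
  forall F U, GLp F -> SO3 U -> W (F *m U) = W F.

Definition homogeneous (h : R) (W : 'M[R]_3 -> R) : Prop :=
  forall F s, GLp F -> 0 < s -> W (s *: F) = s `^ h * W F.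

Definition strain_energy (W : 'M[R]_3 -> R) : Prop :=
  smooth_on GLp W /\ forall F, GLp F -> 0 <= W F.

Definition piola_kirchhoff (W : 'M[R]_3 -> R) (F : 'M[R]_3) : 'M[R]_3 :=
  \matrix_(i, j) 'D_(delta_mx i j) W F.

Definition P1 (w : 'cV[R]_3) : 'M[R]_3 := w *m w^T.
Definition P2 (w : 'cV[R]_3) : 'M[R]_3 := 1%:M - P1 w.

Definition Fsph (l1 l2 : R) (w : 'cV[R]_3) : 'M[R]_3 :=
  l1 *: P1 w + l2 *: P2 w.

Definition kappah (h : R) : R := h / 3 * (h / 3 - 1).

Definition near1 : set R := [set u | `|u - 1| <= 1 / 8].

Definition betaf (f : R -> R) : R := deriv_on 2 near1 f 1.

Definition classC (M : R) (f : R -> R) : Prop :=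
  [/\ Ck_on 3 near1 f,
      f 1 = 1,
      deriv_on 1 near1 f 1 = 0,
      0 < betaf f &
      forall u, near1 u -> `|deriv_on 3 near1 f u| <= M * betaf f].

Definition grad_on (A : set 'cV[R]_3) (p : 'cV[R]_3 -> 'cV[R]_3)
    (y : 'cV[R]_3) : 'M[R]_3 :=
  \matrix_(i, j) diff_on A p y (delta_mx j 0) i 0.

Definition div_mx (A : 'cV[R]_3 -> 'M[R]_3) (y : 'cV[R]_3) : 'cV[R]_3 :=
  \col_i \sum_j 'D_(delta_mx j 0) (fun z => A z i j) y.

Definition op_deformation (p : 'cV[R]_3 -> 'cV[R]_3) : Prop :=
  [/\ set_inj (cball 1) p,
      within_differentiable (cball 1) p &
      forall y, cball 1 y -> GLp (grad_on (cball 1) p y)].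

Definition I01 : set R := [set r | 0 <= r <= 1].

Definition spherical_C2 (phi : R -> R) (p : 'cV[R]_3 -> 'cV[R]_3) : Prop :=
  [/\ Ck_on 2 I01 phi,
      phi 0 = 0,
      deriv_on 2 I01 phi 0 = 0,
      forall r, I01 r -> 0 < deriv_on 1 I01 phi r &
      forall y, cball 1 y -> p y = phi (enorm y) *: udir y].

Definition Itau (tau : \bar R) : set R := [set t | 0 <= t /\ (t%:E < tau)%E].

Definition ivp_solution (mu h a0 b0 : R) (tau : \bar R) (a : R -> R) : Prop :=
  [/\ (0 < tau)%E,
      Ck_on 2 (Itau tau) a,
      forall t, Itau tau t -> 0 < a t,
      forall t, Itau tau t -> deriv_on 2 (Itau tau) a t = mu * a t `^ (h - 1) &
      a 0 = a0 /\ deriv_on 1 (Itau tau) a 0 = b0].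

Definition maximal_ivp_solution (mu h a0 b0 : R) (tau : \bar R) (a : R -> R) :
    Prop :=
  ivp_solution mu h a0 b0 tau a /\
  forall (tau' : \bar R) (b : R -> R),
    ivp_solution mu h a0 b0 tau' b ->
    (forall t, Itau tau t -> Itau tau' t -> b t = a t) ->
    (tau' <= tau)%E.

(* [E(0)] for the initial data [a(0) = a0], [a'(0) = b0].  When [h < 0], energy
   conservation gives [a' < (2 E(0))^(1/2)], hence [(a(t) - a0) / t] stays below
   [(2 E(0))^(1/2)]; the quotient [a(t) / t] has the same limit but need not stay
   below it, not even for large [t]: for [h = -2] and [b0 >= 0],
   [a(t)^2 = 2 E(0) t^2 + 2 a0 b0 t + a0^2]. *)
Definition energy0 (mu h a0 b0 : R) : R :=
  1 / 2 * b0 ^+ 2 - mu / h * a0 `^ h.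

End Elasticity.

(* Main.v *)
Require Import Defs.
From HB Require Import structures.
From mathcomp Require Import all_boot all_order all_algebra.
From mathcomp Require Import all_classical all_reals all_analysis.
From mathcomp Require Import ring lra.

Set Implicit Arguments.
Unset Strict Implicit.
Unset Printing Implicit Defensive.

Import Order.TTheory GRing.Theory Num.Theory.
Import numFieldNormedType.Exports.

Local Open Scope classical_set_scope.
Local Open Scope ring_scope.

(** The motion separates because the stress of a homogeneous energy satisfies
S(sigma F) = sigma^(h-1) S(F) ([piola_homogeneous]): if div S(D p) = mu p with
free traction, then a(t) p(y) solves the evolution problem as soon as
a'' = mu a^(h-1). So there are two ordinary differential equations to solve.

Eigenvalue problem. Put p(y) = G(|y|^2) y and x = |y|^2. The principal
stretches are l2 = G and l1 = G + 2 x G'; write l1 / l2 = 1 + v. Objectivity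
and isotropy make S commute with every half-turn that commutes with the
gradient, which forces S to be a combination of the projections P1 and P2
([piola_Fsph]); the two coefficients are the partial derivatives of
l2^h w(l1 / l2 - 1), where w(z) = (1 + z)^(h/3) f(1 + z) ([piola_stretch]). Then
div S = mu p becomes ([div_spherical], [radial_equation])
   2 x G' = v G,   2 x v' w''(v) + (3 + h v) w'(v) - h w(v) = mu x G^(2-h),
singular at x = 0. The parameter m = mu x G^(2-h) / W0, with
W0 = w''(0) = f''(1) + kappa(h), eliminates both G and mu. Let
Q(z) = ((3 + h z) w'(z) - h w(z)) / W0; it vanishes at 0 with Q'(0) = 3. In
terms of X = Q(v) / m the equation reads m X' = (5/2) (Gamma - X), where Gamma
differs from 3/5 by a term of order m: the bounded solution X is the average
of Gamma for the weight |m|^(3/2), hence a fixed point of a contraction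
([fixed_point]) on an interval |m| < m0. As f lies in C(M) and f''(1) >= 1,
|w'''| is at most a constant times W0, the constant depending on h and M only;
so does m0.
There v is comparable to m, and w'(v) starts from h/3 at m = 0 and has slope
of order W0: it vanishes at some m of order |h| / W0 with the sign of -h, and
this m lies in the interval once f''(1) is large ([root_exists]). Putting
x = 1 there yields the free boundary condition S omega = 0, and undoing the
change of variable gives G by a quadrature ([profile_assembly]). The sign of m
is that of mu and v; since G' = G v / (2 x), it decides whether the ball
expands or shrinks.

The scale factor. The equation a'' = mu a^(h-1) is solved globally after
replacing the power by a Lipschitz function ([lipschitz_ode]); conservation of
energy confines a to the region where nothing was changed. If h < 0, the term
-(mu/h) a^h of the energy is positive and blows up at a = 0, so a stays away
from 0; a is convex with velocity below (2E)^(1/2), and the velocity cannot stay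
below a smaller constant, for energy would then bound a and hence bound the
acceleration away from 0 ([expanding_asymptotics]). If h > 3, a is concave; were
it positive forever it would be nondecreasing and its acceleration would stay
below a negative constant, so it reaches 0 in finite time ([ivp_collapsing]),
and no positive solution can be continued past that time
([no_extension_past_zero]).

All derivatives are relative to sets such as the closed ball or [0, tau).
The fields are built from functions of class C^2 on open neighbourhoods of
these sets, and the relative derivatives are then ordinary ones
([Ck_on_of_Ck]). *)

(** * Differentials relative to a set *)

Section WithinDiff.
Context {R : realType} {V W : normedModType R}.
Implicit Types (A : set V) (f : V -> W) (x v : V).

Lemma lim_within_nbhs A x : A x -> lim (within A (nbhs x)) = x.
Proof.
move=> Ax; have ? := within_nbhs_proper (subset_closure Ax).
have cx : within A (nbhs x) --> x by exact: cvg_within.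
apply: (@cvg_unique _ (@norm_hausdorff _ V) (within A (nbhs x))) => //.
exact: cvgP cx.
Qed.

(** The segments from [x] to a small ball all stay in [A]. This is what makes a
differential relative to [A] unique at [x], including at boundary points of
convex bodies, and it is weaker than having [x] in the interior. *)
Definition starlike A x := exists (c : V) (e : R), 0 < e /\
  forall v (t : R), `|v| < e -> 0 <= t <= 1 -> A (x + t *: (c + v - x)).

Definition within_expansion A f x (L : V -> W) :=
  forall e : R, 0 < e -> \forall y \near within A (nbhs x),
    `|f y - f x - L (y - x)| <= e * `|y - x|.

Lemma within_diffP A f x : A x ->
  differentiable f (within A (nbhs x)) <->
  continuous ('d f (within A (nbhs x))) /\
  within_expansion A f x ('d f (within A (nbhs x))).
Proof.
move=> Ax; split=> [/diffP[cL]|[cL E]].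
  rewrite lim_within_nbhs// => /funext H; split => // e e0.
  move/eqaddoP : H => /(_ _ e0); apply: filterS => y /=.
  by rewrite !fctE opprD addrA.
apply/diffP; split => //; rewrite lim_within_nbhs//.
move=> y; move: y; apply/funeqP.
apply/eqaddoP => e e0; have := E e e0.
by apply: filterS => y /=; rewrite !fctE opprD addrA.
Qed.

(** Two first-order expansions agree along every segment leaving [x] inside [A], hence
on the directions [c + v - x] with [v] small; the differences of these directions
fill a neighbourhood of 0. *)
Lemma within_expansion_unique A f x (L1 L2 : {linear V -> W}) :
  A x -> starlike A x ->
  within_expansion A f x L1 -> within_expansion A f x L2 ->
  L1 = L2 :> (V -> W).
Proof.
move=> Ax [c [e [e0 Ac]]] E1 E2.
pose D v := L1 v - L2 v.
have DZ (a : R) v : D (a *: v) = a *: D v by rewrite /D !linearZZ [RHS]scalerDr scalerN.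
have DB u v : D (u - v) = D u - D v.
  by rewrite /D (linearB L1) (linearB L2) !opprD addrACA.
have Dray v : `|v| < e -> D (c + v - x) = 0.
  move=> ve; set u := c + v - x; apply/eqP; rewrite -normr_le0.
  apply/ler_addgt0Pr => eps eps0; rewrite add0r.
  (* Half of the allowed error for each of the two expansions, per unit of |u|. *)
  pose k := eps / (2 * (`|u| + 1)).
  have u1 : 0 < `|u| + 1 by rewrite ltr_wpDl.
  have k0 : 0 < k by rewrite divr_gt0// mulr_gt0.
  have /nbhs_ballP[d /= d0 H] : nbhs x (fun y => A y ->
      `|f y - f x - L1 (y - x)| <= k * `|y - x| /\
      `|f y - f x - L2 (y - x)| <= k * `|y - x|).
    have h1 : nbhs x (fun y => A y -> `|f y - f x - L1 (y - x)| <= k * `|y - x|).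
      exact: E1 k0.
    have h2 : nbhs x (fun y => A y -> `|f y - f x - L2 (y - x)| <= k * `|y - x|).
      exact: E2 k0.
    by apply: filterS2 h1 h2 => y l1 l2 Ay; split; [exact: l1|exact: l2].
  pose t := Num.min 1 (d / 2 / (`|u| + 1)).
  have t0 : 0 < t by rewrite lt_min ltr01/= !divr_gt0.
  have tu : `|t *: u| < d.
    rewrite normrZ gtr0_norm//.
    apply: (@le_lt_trans _ _ (d / 2)); last by rewrite ltr_pdivrMr// ltr_pMr// ltr1n.
    apply: (@le_trans _ _ (d / 2 / (`|u| + 1) * (`|u| + 1))).
      apply: ler_pM; [exact: ltW|exact: normr_ge0| |by rewrite lerDl].
      by rewrite /t ge_min lexx orbT.
    by rewrite divfK// gt_eqF.
  have Axt : A (x + t *: u) by apply: Ac => //; rewrite (ltW t0) ge_min lexx.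
  have := H (x + t *: u); rewrite -ball_normE/= opprD addrA subrr sub0r normrN.
  move=> /(_ tu Axt); rewrite [x + _ - x]addrC addKr => -[h1 h2].
  have : `|D (t *: u)| <= (2 * k) * `|t *: u|.
    rewrite /D -[_ - _](_ : (f (x + t *: u) - f x - L2 (t *: u)) -
      (f (x + t *: u) - f x - L1 (t *: u)) = _); last first.
      by rewrite opprB addrC addrA subrK.
    rewrite mulrDl mul1r mulrDl; apply: (le_trans (ler_normB _ _)).
    by apply: lerD.
  rewrite DZ !normrZ mulrCA ler_pM2l ?normr_gt0 ?gt_eqF// => /le_trans; apply.
  rewrite (_ : 2 * k * `|u| = eps * (`|u| / (`|u| + 1))); last first.
    by rewrite /k; field; rewrite gt_eqF.
  by rewrite ler_piMr ?(ltW eps0)// ler_pdivrMr// mul1r lerDl.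
have Dsmall v : `|v| < e -> D v = 0.
  move=> ve; rewrite -[v](_ : (c + v - x) - (c + 0 - x) = _); last first.
    by rewrite addr0 opprB addrA addrNK addrAC subrr add0r.
  by rewrite DB !Dray ?normr0// subrr.
apply/funext => v; apply/eqP; rewrite -subr_eq0; apply/eqP; change (D v = 0).
have v1 : 0 < `|v| + 1 by rewrite ltr_wpDl.
pose a := e / 2 / (`|v| + 1).
have a0 : 0 < a by rewrite !divr_gt0.
have : D (a *: v) = 0.
  apply: Dsmall; rewrite normrZ gtr0_norm//.
  apply: (@le_lt_trans _ _ (e / 2)); last by rewrite ltr_pdivrMr// ltr_pMr// ltr1n.
  by rewrite /a mulrAC ler_pdivrMr// ler_wpM2l ?divr_ge0 ?(ltW e0)// lerDl.
by rewrite DZ => /eqP; rewrite scaler_eq0 gt_eqF//= => /eqP.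
Qed.

(** The differential is chosen by a choice operator, so a candidate is identified by
checking its expansion and invoking uniqueness. *)
Lemma within_differentiableE A f x (L : {linear V -> W}) :
  A x -> starlike A x -> continuous L -> within_expansion A f x L ->
  differentiable f (within A (nbhs x)) /\ diff_on A f x = L :> (V -> W).
Proof.
move=> Ax sA cL EL.
have df : differentiable f (within A (nbhs x)).
  apply/diffP.
  apply: (@getPex _ (fun df : {linear V -> W} => continuous df /\
    forall y, f y = f (lim (within A (nbhs x))) + df (y - lim (within A (nbhs x)))
       +o_(y \near within A (nbhs x)) (y - lim (within A (nbhs x))))).
  exists L; split => //; rewrite lim_within_nbhs//.
  move=> y; move: y; apply/funeqP; apply/eqaddoP => e e0; have := EL e e0.
  by apply: filterS => y /=; rewrite !fctE opprD addrA.
split => //; have [_ E] := (within_diffP f Ax).1 df.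
exact: within_expansion_unique E EL.
Qed.

Lemma differentiable_expansion f x : differentiable f x ->
  forall e : R, 0 < e -> \forall y \near x,
    `|f y - f x - 'd f x (y - x)| <= e * `|y - x|.
Proof.
move=> /diffP[_]; rewrite lim_id; last exact: norm_hausdorff.
move=> /funext H e e0.
move/eqaddoP : H => /(_ _ e0).
by apply: filterS => y /=; rewrite !fctE opprD addrA.
Qed.

Lemma expansion_differentiable f x (L : {linear V -> W}) :
  continuous L -> (forall e : R, 0 < e -> \forall y \near x,
    `|f y - f x - L (y - x)| <= e * `|y - x|) ->
  differentiable f x /\ 'd f x = L :> (V -> W).
Proof.
move=> cL E.
have H : f \o shift x = cst (f x) + L +o_ 0 id.
  apply/eqaddoP => e e0; have := E e e0; rewrite (near_shift 0).
  apply: filterS => y /=; rewrite subr0 !fctE/= opprD addrA addrK.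
  by [].
have dE := diff_unique cL H; split => //.
by apply/diff_locallyP; split; [rewrite dE|rewrite dE].
Qed.

(** The bridge from ordinary to relative differentials: a function that coincides on
[A] with a differentiable one inherits its differential. *)
Lemma diff_on_ext A f g x : A x -> starlike A x ->
  (forall y, A y -> f y = g y) -> differentiable g x ->
  differentiable f (within A (nbhs x)) /\ diff_on A f x = 'd g x :> (V -> W).
Proof.
move=> Ax sA fg dg; apply: within_differentiableE => //.
  exact: diff_continuous dg.
move=> e e0; rewrite /within/=.
apply: filterS (differentiable_expansion dg e0) => y + Ay.
by rewrite !fg.
Qed.

Lemma diff_on_interior A f x : A x -> nbhs x A ->
  differentiable f (within A (nbhs x)) ->
  differentiable f x /\ 'd f x = diff_on A f x :> (V -> W).
Proof.
move=> Ax nA /(within_diffP f Ax)[cL E].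
apply: expansion_differentiable => // e e0.
have h1 : nbhs x (fun y => A y ->
    `|f y - f x - diff_on A f x (y - x)| <= e * `|y - x|) by exact: E.
by apply: filterS2 h1 nA => y; apply.
Qed.

End WithinDiff.

(** * Functions of class C^k on open sets *)

Section Ck.
Context {R : realType}.

(** The ordinary counterpart of [Ck_on], for which sums, products and compositions
can be differentiated with the usual rules. *)
Fixpoint Ck {V W : normedModType R} (k : nat) (U : set V) (f : V -> W) : Prop :=
  if k is k'.+1 then
    (forall x, U x -> differentiable f x) /\
    forall v : V, Ck k' U (fun x => 'd f x v)
  else forall x, U x -> {for x, continuous f}.

Section CkVW.
Context {V W : normedModType R}.
Implicit Types (U A : set V) (f g : V -> W).

Lemma Ck_continuous k U f x : Ck k U f -> U x -> {for x, continuous f}.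
Proof.
case: k => [|k] /=; first exact.
by move=> [df _] Ux; apply: differentiable_continuous; exact: df.
Qed.

Lemma Ck_weaken k U f : Ck k.+1 U f -> Ck k U f.
Proof.
elim: k f => [f C x Ux|k IH f [df C]]; first exact: Ck_continuous C Ux.
by split => // v; exact: IH (C v).
Qed.

Lemma near_eq_diff f g x : (\forall y \near x, f y = g y) ->
  differentiable f x -> differentiable g x /\ 'd g x = 'd f x :> (V -> W).
Proof.
move=> fg df; apply: expansion_differentiable.
  exact: diff_continuous df.
move=> e e0; have fgx : f x = g x := nbhs_singleton fg.
apply: filterS2 fg (differentiable_expansion df e0) => y.
by rewrite fgx => ->.
Qed.

(** Openness is essential here: the differentials only agree where the functions
agree nearby. *)
Lemma Ck_eq k U f g : open U -> (forall x, U x -> f x = g x) ->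
  Ck k U f -> Ck k U g.
Proof.
move=> oU; have nU x : U x -> nbhs x U by move=> Ux; exact: open_nbhs_nbhs.
elim: k f g => [|k IH] f g fg.
  move=> C x Ux; have := C x Ux; rewrite /prop_for /continuous_at -(fg x Ux).
  apply: cvg_trans; apply: near_eq_cvg.
  by apply: filterS (nU _ Ux) => y /fg.
move=> [df C].
have H x : U x -> differentiable g x /\ 'd g x = 'd f x :> (V -> W).
  by move=> Ux; apply: near_eq_diff (df _ Ux); apply: filterS (nU _ Ux).
split => [x /H[]//|v]; apply: IH (C v) => x /H[_ ->] //.
Qed.

(** Regularity up to the boundary is obtained by extending to an open set. *)
Lemma Ck_on_of_Ck k A U f g : open U -> A `<=` U ->
  (forall x, A x -> starlike A x) -> (forall x, A x -> f x = g x) ->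
  Ck k U g -> Ck_on k A f.
Proof.
move=> oU AU sA; elim: k f g => [|k IH] f g fg.
  move=> C; apply/subspace_continuousP => x Ax; rewrite /from_subspace (fg x Ax).
  have h : g y @[y --> within A (nbhs x)] --> g x.
    by apply: cvg_within_filter; exact: C (AU _ Ax).
  apply: cvg_trans h; apply: near_eq_cvg.
  by apply: (@filterS _ (nbhs x) _ setT) => [y _ Ay|]; [rewrite (fg y Ay)|exact: filterT].
move=> [dg C]; split => [x Ax|v].
  by have [] := diff_on_ext Ax (sA _ Ax) fg (dg _ (AU _ Ax)).
apply: IH (C v) => x Ax.
by have [_ ->] := diff_on_ext Ax (sA _ Ax) fg (dg _ (AU _ Ax)).
Qed.

Lemma Ck_of_Ck_on k A U f : open U -> U `<=` A -> Ck_on k A f -> Ck k U f.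
Proof.
move=> oU UA; elim: k f => [|k IH] f.
  move=> /(continuous_subspaceW UA).
  by rewrite continuous_open_subspace// => C x Ux; apply: C; rewrite inE.
move=> [df C].
have H x : U x -> differentiable f x /\ 'd f x = diff_on A f x :> (V -> W).
  move=> Ux; apply: diff_on_interior => //; [exact: UA| |exact: df (UA _ Ux)].
  by apply: filterS UA _; exact: open_nbhs_nbhs.
split => [x /H[]//|v]; apply: (Ck_eq oU _ (IH _ (C v))) => x /H[_ ->] //.
Qed.

Lemma Ck_cst k U (c : W) : Ck k U (fun=> c).
Proof.
elim: k c => [c x _|k IH c]; first exact: cvg_cst.
split => [x _|v]; first exact: differentiable_cst.
rewrite (_ : (fun _ => _) = fun=> (0 : W)); first exact: IH.
by apply/funext => x; rewrite (diff_cst c x).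
Qed.

Lemma CkD k U f g : open U -> Ck k U f -> Ck k U g ->
  Ck k U (fun x => f x + g x).
Proof.
move=> oU; elim: k f g => [f g cf cg x Ux|k IH f g [df cf] [dg cg]].
  by apply: continuousD; [exact: cf|exact: cg].
split => [x Ux|v]; first exact: differentiableD (df _ Ux) (dg _ Ux).
apply: (Ck_eq oU _ (IH _ _ (cf v) (cg v))) => x Ux.
exact (congr1 (fun L : V -> W => L v) (esym (diffD (df _ Ux) (dg _ Ux)))).
Qed.

Lemma Ck_linear k U (f : {linear V -> W}) : continuous f -> Ck k U f.
Proof.
move=> cf; case: k => [x _|k]; first exact: cf.
split => [x _|v]; first exact: linear_differentiable.
rewrite (_ : (fun _ => _) = fun=> f v); first exact: Ck_cst.
by apply/funext => x; rewrite diff_lin.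
Qed.

Lemma CkZl k U (f : V -> R) (w : W) : open U -> Ck k U f ->
  Ck k U (fun x => f x *: w).
Proof.
move=> oU; elim: k f => [f cf x Ux|k IH f [df cf]].
  by apply: continuousZr_tmp; exact: cf.
split => [x Ux|v]; first exact: differentiableZl (df _ Ux).
apply: (Ck_eq oU _ (IH _ (cf v))) => x Ux.
by rewrite (diffZl w (df _ Ux)).
Qed.

Lemma Ck_sum n k U (f : 'I_n -> V -> W) : open U -> (forall i, Ck k U (f i)) ->
  Ck k U (fun x => \sum_(i < n) f i x).
Proof.
move=> oU C; elim: n f C => [f _|n IH f C].
  by apply: (Ck_eq oU _ (Ck_cst k U 0)) => x _; rewrite big_ord0.
apply: (Ck_eq oU _ (CkD oU (IH _ (fun i => C (widen_ord (leqnSn n) i))) (C ord_max))).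
by move=> x _; rewrite big_ord_recr.
Qed.

End CkVW.

Lemma CkM (V : normedModType R) k (U : set V) (f g : V -> R) : open U ->
  Ck k U f -> Ck k U g -> Ck k U (fun x => f x * g x).
Proof.
move=> oU; elim: k f g => [f g cf cg x Ux|k IH f g Cf Cg].
  by apply: continuousM; [exact: cf|exact: cg].
have [df cf] := Cf; have [dg cg] := Cg.
split => [x Ux|v]; first exact: differentiableM (df _ Ux) (dg _ Ux).
apply: (Ck_eq oU _ (CkD oU (IH _ _ (Ck_weaken Cf) (cg v))
  (IH _ _ (Ck_weaken Cg) (cf v)))) => x Ux.
exact (congr1 (fun L : V -> R => L v) (esym (diffM (df _ Ux) (dg _ Ux)))).
Qed.

Lemma Ck_derive k (U : set R) (f f' : R -> R) : open U ->
  (forall x, U x -> is_derive x 1 f (f' x)) -> Ck k U f' -> Ck k.+1 U f.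
Proof.
move=> oU df C; have df' x : U x -> differentiable f x.
  by move=> /df[+ _]; rewrite derivable1_diffP.
split => // v; apply: (Ck_eq oU _ (CkM oU (Ck_cst k U v) C)) => x Ux.
have <- : derive1 f x = f' x by rewrite derive1E; have [_ ->] := df _ Ux.
by rewrite (diff1E (df' _ Ux)).
Qed.

Lemma Ck_derivable k (U : set R) (f : R -> R) (x : R) : Ck k.+1 U f -> U x ->
  is_derive x 1 f ('d f x 1).
Proof.
move=> [df _] Ux; have d := df _ Ux.
by rewrite -deriveE//; apply/derivableP/diff_derivable.
Qed.

Lemma Ck_comp (V : normedModType R) k (U : set V) (U' : set R) (f : V -> R)
    (g : R -> R) : open U -> (forall x, U x -> U' (f x)) ->
  Ck k U f -> Ck k U' g -> Ck k U (fun x => g (f x)).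
Proof.
move=> oU UU; elim: k f g UU => [f g UU cf cg x Ux|k IH f g UU Cf Cg].
  by apply: continuous_comp; [exact: cf|exact: cg (UU _ Ux)].
have [df cf] := Cf; have [dg cg] := Cg.
split => [x Ux|v].
  exact: differentiable_comp (df _ Ux) (dg _ (UU _ Ux)).
apply: (Ck_eq oU _ (CkM oU (cf v) (IH _ _ UU (Ck_weaken Cf) (cg 1)))) => x Ux.
have E := congr1 (fun L : V -> R => L v) (diff_comp (df _ Ux) (dg _ (UU _ Ux))).
apply: etrans (esym E).
by rewrite /= -[in RHS](mulr1 ('d f x v)) -[_ * 1]/(_ *: 1) linearZ.
Qed.

Lemma Ck_id k (U : set R) : Ck k U (fun x : R => x).
Proof.
case: k => [x _|k]; first exact: cvg_id.
split => [x _|v]; first by [].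
rewrite (_ : (fun _ => _) = fun=> v); first exact: Ck_cst.
by apply/funext => x; rewrite diff_val.
Qed.

Lemma Ck_expR k (U : set R) : open U -> Ck k U (@expR R).
Proof.
move=> oU; elim: k => [x _|k IH]; first exact: continuous_expR.
by apply: Ck_derive IH => // x _; exact: is_derive_expR.
Qed.

End Ck.

(** * Metric forms of the definitions, and a contraction principle *)

Section MetricForms.
Context {R : realType}.
Implicit Types (f g wt : R -> R).

Lemma nbhs_distP (V : normedModType R) (z : V) (P : V -> Prop) :
  (\forall y \near z, P y) <-> exists2 r : R, 0 < r & forall y, `|y - z| < r -> P y.
Proof.
split=> [/nbhs_ballP[r /= r0 H]|[r r0 H]].
  by exists r => // y yx; apply: H; rewrite -ball_normE/= distrC.
by apply/nbhs_ballP; exists r => //= y; rewrite -ball_normE/= distrC; exact: H.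
Qed.

Lemma is_derive_expansionP f (x d : R) : is_derive x 1 f d <->
  forall e : R, 0 < e -> exists2 r : R, 0 < r & forall y, `|y - x| < r ->
    `|f y - f x - d * (y - x)| <= e * `|y - x|.
Proof.
split=> [[fd fdE] e e0|E].
  have df : differentiable f x by apply/derivable1_diffP.
  have /nbhs_distP[r r0 H] := differentiable_expansion df e0.
  exists r => // y yx; have := H y yx.
  by rewrite (diff1E df) derive1E fdE [_ *: _]mulrC.
have sx_lin : linear ( *:%R ^~ d : R -> R).
  by move=> u y z; rewrite scalerDl scalerA.
pose sxlM := GRing.isLinear.Build _ _ _ _ _ sx_lin.
pose L : {linear R -> R} := HB.pack ( *:%R ^~ d : R -> R) sxlM.
have [|e e0|df dE] := @expansion_differentiable R R R f x L.
- exact: scalel_continuous.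
- have [r r0 H] := E _ e0; apply/nbhs_distP; exists r => // y yx.
  by have := H y yx; rewrite mulrC.
split; first by apply/derivable1_diffP.
by rewrite deriveE// dE/= [_ *: _]mul1r.
Qed.

Lemma continuous_distP f (x : R) : {for x, continuous f} <->
  forall e : R, 0 < e -> exists2 r : R, 0 < r &
    forall y, `|y - x| < r -> `|f y - f x| <= e.
Proof.
split=> [/cvgrPdist_le C e e0|C].
  by have /(@nbhs_distP R)[r r0 H] := C e e0; exists r => // y yx; rewrite distrC; exact: H.
apply/cvgrPdist_le => e e0; have [r r0 H] := C e e0.
by apply/(@nbhs_distP R); exists r => // y yx; rewrite distrC; exact: H.
Qed.

(** Banach's theorem for maps on continuous functions over the whole line, with
distances measured relative to a weight [wt]. The constant weight serves the
radial equation, an exponential one makes the Picard iteration of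
[lipschitz_ode] contract globally in time. *)
Lemma weighted_contraction (wt : R -> R) (T : (R -> R) -> R -> R) (x0 : R -> R)
    (C : R) :
  continuous wt -> (forall t, 0 <= wt t) -> continuous x0 ->
  (forall x : R -> R, continuous x -> continuous (T x)) ->
  0 <= C -> (forall t, `|T x0 t - x0 t| <= C * wt t) ->
  (forall (x y : R -> R) e, continuous x -> continuous y ->
     (forall t, `|x t - y t| <= e * wt t) ->
     forall t, `|T x t - T y t| <= e / 2 * wt t) ->
  exists x : R -> R, continuous x /\ T x = x.
Proof.
move=> cw w0 cx0 cT C_ge0 TC0 TL.
pose xs n := iter n T x0.
have cxs n : continuous (xs n) by elim: n => // n; exact: cT.
have step n t : `|xs n.+1 t - xs n t| <= C / 2 ^+ n * wt t.
  elim: n t => [t|n IH t]; first by rewrite expr0 divr1; exact: TC0.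
  by rewrite exprSr invfM mulrA; exact: (TL (xs n.+1) (xs n) _ (cxs _) (cxs _) IH).
have C0 t : 0 <= C * wt t by apply: le_trans (TC0 t).
(* A geometric series with ratio 1/2 bounds the distance between iterates. *)
have dist n k t : `|xs (n + k)%N t - xs n t| <= 2 * (C * wt t) * (1 / 2 ^+ n - 1 / 2 ^+ (n + k)).
  elim: k => [|k IH]; first by rewrite addn0 !subrr normr0 mulr0.
  rewrite addnS; apply: le_trans (ler_distD (xs (n + k)%N t) _ _) _.
  apply: le_trans (lerD (step _ _) IH) _.
  rewrite exprSr; set a := 2 ^+ (n + k).
  have a0 : a != 0 by rewrite expf_neq0.
  by rewrite le_eqVlt; apply/orP; left; apply/eqP; field; rewrite a0 expf_neq0.
have dist2 n k t : `|xs (n + k)%N t - xs n t| <= 2 * (C * wt t) / 2 ^+ n.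
  apply: le_trans (dist n k t) _; rewrite ler_wpM2l ?mulr_ge0//.
  by rewrite mul1r gerBl divr_ge0.
have small (e : R) a : 0 < e -> exists n, forall m, (n <= m)%N -> a / 2 ^+ m < e.
  move=> e0.
  have : geometric a (2^-1 : R) @ \oo --> 0.
    by apply: cvg_geometric; rewrite ger0_norm ?invr_ge0// invf_lt1 ?ltr1n.
  move=> /cvgrPdist_lt/(_ e e0)[n _ H]; exists n => m nm.
  have := H m nm; rewrite /= sub0r normrN => /(le_lt_trans (ler_norm _)).
  by rewrite exprVn.
pose x t := limn (fun n => xs n t).
have cvx t : xs n t @[n --> \oo] --> x t.
  apply/cauchy_cvgP; apply/cauchy_exP => _/posnumP[e].
  have [n H] := small e%:num (2 * (C * wt t)) [gt0 of e%:num].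
  exists (xs n t); exists n => // m /= nm; rewrite -ball_normE/= distrC.
  rewrite -(subnKC nm); apply: le_lt_trans (dist2 _ _ _) _.
  exact: H.
have xxs n t : `|x t - xs n t| <= 2 * (C * wt t) / 2 ^+ n.
  have h : `|xs (m + n)%N t - xs n t| @[m --> \oo] --> `|x t - xs n t|.
    apply: cvg_norm; apply: cvgB; last exact: cvg_cst.
    by rewrite (cvg_shiftn n (fun k => xs k t)); exact: cvx.
  rewrite -(cvg_lim _ h)//; apply: limr_le; first by apply/cvg_ex; eexists; exact: h.
  by apply: nearW => m; rewrite addnC; exact: dist2.
have cx : continuous x.
  move=> t; apply/continuous_distP => e e0.
  have [r r0 Hr] := (continuous_distP wt t).1 (cw t) 1 ltr01.
  have [n Hn] := small (e / 3) (2 * (C * (wt t + 1))) (divr_gt0 e0 (ltr0Sn _ 2)).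
  have [r' r'0 Hr'] := (continuous_distP (xs n) t).1 (cxs n t) (e / 3) (divr_gt0 e0 (ltr0Sn _ 2)).
  have bnd y : `|y - t| < r -> `|x y - xs n y| <= e / 3.
    move=> yt; apply: le_trans (xxs n y) _; apply: le_trans (ltW (Hn n (leqnn _))).
    rewrite ler_wpM2r ?invr_ge0 ?exprn_ge0// ler_wpM2l//.
    apply: ler_wpM2l => //.
    by have := Hr y yt => /(le_trans (ler_norm _)); rewrite lerBlDl.
  exists (Num.min r r'); first by rewrite lt_min r0.
  move=> y; rewrite lt_min => /andP[yr yr'].
  rewrite (_ : x y - x t = (x y - xs n y) + (xs n y - xs n t) - (x t - xs n t)); last by ring.
  apply: le_trans (ler_normB _ _) _; apply: le_trans (lerD (ler_normD _ _) (lexx _)) _.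
  have := bnd y yr; have := Hr' y yr'; have := bnd t; rewrite subrr normr0 => /(_ r0).
  lra.
exists x; split => //; apply/funext => t; apply/eqP; rewrite -subr_eq0 -normr_le0.
apply/ler_addgt0Pr => e e0; rewrite add0r.
have [n Hn] := small e (2 * (C * wt t)) e0.
have h1 := TL x (xs n) (2 * C / 2 ^+ n) cx (cxs n).
have {}h1 : `|T x t - xs n.+1 t| <= C * wt t / 2 ^+ n.
  apply: le_trans (h1 _ t) _ => [s|].
    by apply: le_trans (xxs n s) _; rewrite le_eqVlt; apply/orP; left; apply/eqP; ring.
  by rewrite le_eqVlt; apply/orP; left; apply/eqP; field; rewrite expf_neq0.
have h2 := xxs n.+1 t.
have h3 : 2 * (C * wt t) / 2 ^+ n < e := Hn n (leqnn n).
rewrite (_ : T x t - x t = (T x t - xs n.+1 t) - (x t - xs n.+1 t)); last by ring.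
apply: le_trans (ler_normB _ _) _; apply: ltW; apply: le_lt_trans h3.
apply: le_trans (lerD h1 h2) _; rewrite le_eqVlt; apply/orP; left; apply/eqP.
by rewrite exprSr; field; rewrite expf_neq0.
Qed.

End MetricForms.

(** * Primitives and weighted averages *)

Section OneVariable.
Context {R : realType}.
Implicit Types (f g : R -> R) (s t : R).

Lemma scaleRE (a b : R) : a *: b = a * b.
Proof. by []. Qed.

Lemma is_derive_continuous f (x d : R) :
  is_derive x 1 f d -> {for x, continuous f}.
Proof.
by move=> [fd _]; apply: differentiable_continuous; exact/derivable1_diffP.
Qed.

(** The base point is shifted to -1 so that the fundamental theorem of calculus, which
is one-sided at the lower bound, gives a two-sided derivative at 0. *)
Definition primitive f (x : R) : R :=
  \int[lebesgue_measure]_(t in `[-1, x]) f t -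
  \int[lebesgue_measure]_(t in `[-1, 0]) f t.

Lemma primitive0 f : primitive f 0 = 0.
Proof. by rewrite /primitive subrr. Qed.

Lemma is_derive_primitive f (x : R) : continuous f -> -1 < x ->
  is_derive x 1 (primitive f) (f x).
Proof.
move=> cf x1.
have xx1 : x < x + 1 by rewrite ltrDl.
have fi : lebesgue_measure.-integrable `[-1, x + 1] (EFin \o f).
  apply: continuous_compact_integrable; first exact: segment_compact.
  exact: continuous_subspaceT.
have [dF FE] := continuous_FTC1_closed xx1 fi x1 (cf x).
rewrite -[f x]subr0; apply: is_deriveB.
by split; [exact: dF|rewrite -derive1E; exact: FE].
Qed.

Lemma within_itv_continuous f (a b : R) :
  (forall t, a <= t <= b -> {for t, continuous f}) -> {within `[a, b], continuous f}.
Proof.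
move=> cf; apply: continuous_in_subspaceT => t; rewrite inE/= in_itv/=.
exact: cf.
Qed.

(** Cauchy's mean value theorem on either side of 0, the derivatives at 0 itself being
irrelevant. *)
Lemma cauchy_quotient f g (df dg : R -> R) (s : R) :
  s != 0 -> f 0 = 0 -> g 0 = 0 ->
  (forall t, `|t| <= `|s| -> {for t, continuous f}) ->
  (forall t, `|t| <= `|s| -> {for t, continuous g}) ->
  (forall t, t != 0 -> `|t| < `|s| -> is_derive t 1 f (df t)) ->
  (forall t, t != 0 -> `|t| < `|s| -> is_derive t 1 g (dg t)) ->
  (forall t, t != 0 -> `|t| < `|s| -> dg t != 0) ->
  exists xi, [/\ xi != 0, `|xi| < `|s| & df xi / dg xi = f s / g s].
Proof.
move=> s0 f0 g0 cf cg fd gd dg0; case: (ltgtP s 0) s0 => // [sN|sP] _.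
- have sE : `|s| = - s by rewrite ltr0_norm.
  have itvE x : x \in `]s, 0[ -> x != 0 /\ `|x| < `|s|.
    rewrite in_itv/= => /andP[sx x0]; rewrite lt_eqF//; split => //.
    by rewrite sE ltr0_norm// ltrN2.
  have cE x : s <= x <= 0 -> `|x| <= `|s|.
    by move=> /andP[sx x0]; rewrite sE ler0_norm// lerN2.
  have [||x xs||x xs|c cs] := @cauchy_MVT R f df g dg s 0 sN.
  + by apply: within_itv_continuous => t /cE; exact: cf.
  + by apply: within_itv_continuous => t /cE; exact: cg.
  + by have [? ?] := itvE _ xs; exact: fd.
  + by move=> x xs; have [? ?] := itvE _ xs; exact: gd.
  + by have [? ?] := itvE _ xs; exact: dg0.
  rewrite f0 g0 !sub0r invrN mulrNN => E.
  by exists c; have [? ?] := itvE _ cs.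
- have sE : `|s| = s by rewrite gtr0_norm.
  have itvE x : x \in `]0, s[ -> x != 0 /\ `|x| < `|s|.
    rewrite in_itv/= => /andP[sx x0]; rewrite gt_eqF//; split => //.
    by rewrite sE gtr0_norm.
  have cE x : 0 <= x <= s -> `|x| <= `|s|.
    by move=> /andP[sx x0]; rewrite sE ger0_norm.
  have [||x xs||x xs|c cs] := @cauchy_MVT R f df g dg 0 s sP.
  + by apply: within_itv_continuous => t /cE; exact: cf.
  + by apply: within_itv_continuous => t /cE; exact: cg.
  + by have [? ?] := itvE _ xs; exact: fd.
  + by move=> x xs; have [? ?] := itvE _ xs; exact: gd.
  + by have [? ?] := itvE _ xs; exact: dg0.
  rewrite f0 g0 !subr0 => E.
  by exists c; have [? ?] := itvE _ cs.
Qed.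

Section Average.
Variables (k delta : R) (D P Gam : R -> R).
Hypotheses (k0 : 0 < k) (d0 : 0 < delta).
Hypotheses (D0 : D 0 = 0) (P0 : P 0 = 0).
Hypothesis cD : forall t, {for t, continuous D}.
Hypothesis Dn0 : forall t, t != 0 -> D t != 0.
Hypothesis dD : forall t, t != 0 -> is_derive t 1 D (k * D t / t).
Hypothesis cP : {for 0, continuous P}.
Hypothesis dP : forall t, t != 0 -> `|t| < delta ->
  is_derive t 1 P (k * D t / t * Gam t).
Hypothesis cG : forall t, `|t| < delta -> {for t, continuous Gam}.

(** If D' = k D / t and P' = D' Gam, then P / D is the average of [Gam] over [0, s] with
weight D', and it solves s q' = k (Gam - q). The value at 0 is the limit. *)
Definition quot (s : R) := if s == 0 then Gam 0 else P s / D s.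

Let quot0 : quot 0 = Gam 0. Proof. by rewrite /quot eqxx. Qed.

Let cPd t : `|t| < delta -> {for t, continuous P}.
Proof.
move=> td; have [->//|t0] := eqVneq t 0.
exact: is_derive_continuous (dP t0 td).
Qed.

Let kD0 t : t != 0 -> k * D t / t != 0.
Proof. by move=> t0; rewrite !mulf_neq0 ?invr_eq0 ?Dn0// gt_eqF. Qed.

(** An average lies between the extreme values; here Cauchy's theorem realises it as a
value of [Gam]. *)
Lemma quot_mean s : `|s| < delta -> exists2 xi, `|xi| <= `|s| & quot s = Gam xi.
Proof.
move=> sd; have [->|s0] := eqVneq s 0; first by exists 0 => //; rewrite quot0.
have lt_d t : `|t| <= `|s| -> `|t| < delta by move=> /le_lt_trans; exact.
have [|||t ts|t ts|t t0 ts|t t0 ts|t t0 ts|xi [xi0 xis E]] :=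
  @cauchy_quotient P D (fun t => k * D t / t * Gam t) (fun t => k * D t / t) s => //.
- exact: cPd (lt_d _ ts).
- by apply: dP => //; apply: lt_d; exact: ltW.
- exact: dD.
- exact: kD0.
exists xi; first exact: ltW.
by rewrite /quot (negbTE s0) -E mulrAC divff ?mul1r// kD0.
Qed.

Lemma is_derive_quot s : s != 0 -> `|s| < delta ->
  is_derive s 1 quot (k * (Gam s - quot s) / s).
Proof.
move=> s0 sd; have Ds := Dn0 s0.
have h : is_derive s 1 (P \* (fun t => (D t)^-1)) (k * (Gam s - quot s) / s).
  have dDs := dD s0; have dPs := dP s0 sd.
  have dV := is_deriveV Ds dDs.
  apply: is_derive_eq; rewrite /quot (negbTE s0) /=.
  by rewrite !scaleRE; field; rewrite s0.
apply: near_eq_is_derive h.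
have s1 : 0 < `|s| by rewrite normr_gt0.
apply/(@nbhs_distP _ R); exists `|s| => // y ys; rewrite /quot.
have [y0|//] := eqVneq y 0.
by move: ys; rewrite y0 sub0r normrN ltxx.
Qed.

Variable gam : R.
Hypothesis dG : is_derive (0 : R) 1 Gam gam.

Let k1 : 0 < k + 1. Proof. by rewrite ltr_wpDl// ltW. Qed.

Let slope s : s != 0 -> `|s| < delta -> exists xi, [/\ xi != 0, `|xi| < `|s| &
  (quot s - Gam 0) / s = k / (k + 1) * ((Gam xi - Gam 0) / xi)].
Proof.
move=> s0 sd.
have lt_d t : `|t| <= `|s| -> `|t| < delta by move=> /le_lt_trans; exact.
pose f t := P t - Gam 0 * D t; pose g t := t * D t.
have [|||t ts|t ts|t t0 ts|t t0 ts|t t0 ts|xi [xi0 xis E]] :=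
  @cauchy_quotient f g (fun t => k * D t / t * (Gam t - Gam 0))
    (fun t => (k + 1) * D t) s => //.
- by rewrite /f P0 D0 mulr0 subrr.
- by rewrite /g mul0r.
- apply: continuousB; first exact: cPd (lt_d _ ts).
  by apply: continuousM; [exact: cvg_cst|exact: cD].
- by apply: continuousM; [exact: cvg_id|exact: cD].
- have dDt := dD t0; have dPt := dP t0 (lt_d _ (ltW ts)).
  apply: is_derive_eq; rewrite !scaleRE; ring.
- have dDt := dD t0.
  by apply: is_derive_eq; rewrite !scaleRE; field.
- by rewrite mulf_neq0 ?Dn0// gt_eqF.
exists xi; split => //.
have Ds := Dn0 s0; have Dx := Dn0 xi0.
rewrite /quot (negbTE s0).
transitivity (f s / g s); first by rewrite /f /g; field; rewrite s0 Ds.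
by rewrite -E; field; rewrite xi0 Dx gt_eqF.
Qed.

(** The value at 0 comes from averaging [gam * t] against the weight: the mean of t is
k / (k + 1) times the end point. *)
Definition dquot (s : R) :=
  if s == 0 then k / (k + 1) * gam else k * (Gam s - quot s) / s.

Let slope_est (e : R) : 0 < e -> exists2 r, 0 < r & forall s, s != 0 -> `|s| < r ->
  `|(quot s - Gam 0) / s - k / (k + 1) * gam| <= e /\
  `|(Gam s - Gam 0) / s - gam| <= e.
Proof.
move=> e0; have [r r0 H] := (is_derive_expansionP Gam 0 gam).1 dG e e0.
have Hs s : s != 0 -> `|s| < r -> `|(Gam s - Gam 0) / s - gam| <= e.
  move=> s0 sr; have := H s; rewrite subr0 => /(_ sr).
  rewrite -ler_pdivrMr ?normr_gt0// -normf_div mulrBl mulfK//.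
exists (Num.min r delta); first by rewrite lt_min r0 d0.
move=> s s0; rewrite lt_min => /andP[sr sd]; split; last exact: Hs.
have [xi [xi0 xis ->]] := slope s0 sd.
rewrite -mulrBr normrM ger0_norm; last by rewrite divr_ge0 ?(ltW k0) ?(ltW k1).
have := Hs xi xi0 (lt_trans xis sr) => He.
apply: le_trans _ He; rewrite ler_piMl// ler_pdivrMr// mul1r lerDl.
exact: ler01.
Qed.

(** The singular point: the difference quotients of the average are k / (k + 1) times
difference quotients of [Gam] at intermediate points, by Cauchy's theorem
applied to P - Gam(0) D and t D. *)
Lemma is_derive_quot0 : is_derive (0 : R) 1 quot (k / (k + 1) * gam).
Proof.
apply/is_derive_expansionP => e e0; have [r r0 H] := slope_est e0.
exists r => // y; rewrite !subr0 quot0 => yr.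
have [->|y0] := eqVneq y 0; first by rewrite quot0 mulr0 !subrr normr0 mulr0.
rewrite -ler_pdivrMr ?normr_gt0// -normf_div mulrBl mulfK//.
by have [] := H y y0 yr.
Qed.

Lemma is_derive_quotE s : `|s| < delta -> is_derive s 1 quot (dquot s).
Proof.
move=> sd; rewrite /dquot; have [->|s0] := eqVneq s 0; first exact: is_derive_quot0.
exact: is_derive_quot.
Qed.

(** For s != 0 the derivative is k times the gap between the difference quotients of
[Gam] and of its average, which tend to gam and k / (k + 1) gam. *)
Lemma continuous_dquot s : `|s| < delta -> {for s, continuous dquot}.
Proof.
move=> sd; have [->|s0] := eqVneq s 0.
  apply/continuous_distP => e e0.
  have e20 : 0 < e / (2 * k) by rewrite divr_gt0// mulr_gt0.
  have [r r0 H] := slope_est e20.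
  exists r => // y; rewrite subr0 => yr; rewrite /dquot eqxx.
  have [_|y0] := eqVneq y 0; first by rewrite subrr normr0 ltW.
  have [h1 h2] := H y y0 yr.
  rewrite (_ : _ - _ = k * (((Gam y - Gam 0) / y - gam) -
    ((quot y - Gam 0) / y - k / (k + 1) * gam))); last first.
    by field; rewrite y0 gt_eqF.
  rewrite normrM gtr0_norm// -ler_pdivlMl//.
  apply: le_trans (ler_normB _ _) _; apply: le_trans (lerD h2 h1) _.
  by rewrite le_eqVlt; apply/orP; left; apply/eqP; field; rewrite gt_eqF.
have h : {for s, continuous (fun s => k * (Gam s - quot s) / s)}.
  apply: continuousM; last by apply: continuousV => //; exact: cvg_id.
  apply: continuousM; first exact: cvg_cst.
  apply: continuousB; first exact: cG.
  exact: is_derive_continuous (is_derive_quot s0 sd).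
have E : \forall y \near s, k * (Gam y - quot y) / y = dquot y.
  have s1 : 0 < `|s| by rewrite normr_gt0.
  apply/(@nbhs_distP _ R); exists `|s| => // y ys; rewrite /dquot.
  have [y0|//] := eqVneq y 0.
  by move: ys; rewrite y0 sub0r normrN ltxx.
move: h; rewrite /prop_for /continuous_at (nbhs_singleton E).
by apply: cvg_trans; apply: near_eq_cvg; apply: filterS E.
Qed.

End Average.

End OneVariable.

(** * Mean value estimates, inverses, clamping *)

Section MeanValue.
Context {R : realType}.
Implicit Types (f g d : R -> R) (x y a b : R).

Lemma mvt_between f d a b x y :
  (forall t, a < t < b -> is_derive t 1 f (d t)) -> a < x < b -> a < y < b ->
  exists2 t, Num.min x y <= t <= Num.max x y & f x - f y = d t * (x - y).
Proof.
move=> fd.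
wlog xy : x y / x <= y => [H ax ay|].
  have [xy|] := boolP (x <= y); first exact: H.
  rewrite -ltNge => /ltW yx.
  have [t tI E] := H _ _ yx ay ax.
  exists t; first by rewrite minC maxC.
  by rewrite -opprB E -mulrN opprB.
move=> /andP[ax xb] /andP[ay yb].
have [||c] := @MVT_segment R f d x y xy.
- move=> t; rewrite in_itv/= => /andP[xt ty]; apply: fd.
  by rewrite (lt_trans ax xt) (lt_trans ty yb).
- apply: within_itv_continuous => t /andP[xt ty].
  apply: is_derive_continuous; apply: fd.
  by rewrite (lt_le_trans ax xt) (le_lt_trans ty yb).
rewrite in_itv/= => cI E; exists c; last by rewrite -opprB E -mulrN opprB.
by rewrite min_l// max_r.
Qed.

Lemma derive_lipschitz f d a b L x y :
  (forall t, a < t < b -> is_derive t 1 f (d t)) ->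
  (forall t, a < t < b -> `|d t| <= L) -> a < x < b -> a < y < b ->
  `|f x - f y| <= L * `|x - y|.
Proof.
move=> fd dL xI yI; have [t /andP[t1 t2] ->] := mvt_between fd xI yI.
rewrite normrM ler_wpM2r// dL//; move: xI yI => /andP[ax xb] /andP[ay yb].
by rewrite (lt_le_trans _ t1) ?lt_min ?ax// (le_lt_trans t2)// gt_max xb.
Qed.

Lemma derive_increasing f d a b x y :
  (forall t, a < t < b -> is_derive t 1 f (d t)) ->
  (forall t, a < t < b -> 0 < d t) -> a < x < b -> a < y < b ->
  x < y -> f x < f y.
Proof.
move=> fd dL xI yI xy; have [t /andP[t1 t2] E] := mvt_between fd yI xI.
rewrite -subr_gt0 E mulr_gt0 ?subr_gt0// dL//.
move: xI yI => /andP[ax xb] /andP[ay yb].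
by rewrite (lt_le_trans _ t1) ?lt_min ?ax ?ay// (le_lt_trans t2)// gt_max xb yb.
Qed.

(** The left inverse is obtained by choice: [f] is injective because it increases. *)
Lemma inverse_derive f d a b :
  (forall t, a < t < b -> is_derive t 1 f (d t)) ->
  (forall t, a < t < b -> 0 < d t) ->
  exists g, forall x, a < x < b -> g (f x) = x /\ is_derive (f x) 1 g (d x)^-1.
Proof.
move=> fd dL.
have inj x y : a < x < b -> a < y < b -> f x = f y -> x = y.
  move=> xI yI E; case: (ltgtP x y) => // xy.
    by have := derive_increasing fd dL xI yI xy; rewrite E ltxx.
  by have := derive_increasing fd dL yI xI xy; rewrite E ltxx.
pose g y := xget 0 [set x | a < x < b /\ f x = y].
have gK x : a < x < b -> g (f x) = x.
  move=> xI; rewrite /g; case: xgetP => [z -> [zI E]|/(_ x)]; last by case.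
  exact: inj.
exists g => x xI; split; first exact: gK.
have nI : \forall y \near x, a < y < b.
  have [ax xb] := andP xI.
  by near=> y; apply/andP; split; near: y; [exact: lt_nbhsr|exact: lt_nbhsl].
apply: is_derive_inverse; last by rewrite gt_eqF// dL.
- by apply: filterS nI => y; exact: gK.
- by apply: filterS nI => y yI; exact: is_derive_continuous (fd _ yI).
- exact: fd.
Unshelve. all: by end_near. Qed.

Definition clamp a b x := Num.max a (Num.min b x).

Lemma clamp_itv a b x : a <= b -> a <= clamp a b x <= b.
Proof. by move=> ab; rewrite /clamp le_max lexx/= ge_max ab ge_min lexx. Qed.

Lemma clamp_id a b x : a <= x <= b -> clamp a b x = x.
Proof. by move=> /andP[ax xb]; rewrite /clamp min_r// max_r. Qed.

Lemma clamp_lipschitz a b x y : `|clamp a b x - clamp a b y| <= `|x - y|.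
Proof.
rewrite /clamp /Num.max /Num.min; do !case: ifPn; rewrite -?leNgt;
  move=> *; apply/ler_normlP; split; have := ler_norm (x - y);
  have := ler_norm (y - x); rewrite distrC; lra.
Qed.

Lemma lipschitz_continuous f (L : R) :
  (forall x y, `|f x - f y| <= L * `|x - y|) -> continuous f.
Proof.
move=> fL x; apply/continuous_distP => e e0.
have L1 : 0 < `|L| + 1 by rewrite ltr_wpDl.
exists (e / (`|L| + 1)); first by rewrite divr_gt0.
move=> y yx; apply: le_trans (fL _ _) _.
apply: (@le_trans _ _ ((`|L| + 1) * `|y - x|)).
  by rewrite ler_wpM2r// (le_trans (ler_norm _))// lerDl.
by rewrite mulrC -ler_pdivlMr// ltW.
Qed.

Lemma continuous_clamp a b : continuous (clamp a b).
Proof.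
by apply: (@lipschitz_continuous _ 1) => x y; rewrite mul1r; exact: clamp_lipschitz.
Qed.

End MeanValue.

(** * The singular radial equation as a fixed point *)

Section Weight.
Context {R : realType}.
Implicit Types (s t : R).

(** The weight |t|^(3/2) of the radial equation; its primitive is (2/5) [Wgt]. *)
Definition wgt t : R := `|t| * Num.sqrt `|t|.
Definition Wgt t : R := t * wgt t.

Lemma continuous_wgt : continuous wgt.
Proof.
move=> t; apply: continuousM; first exact: norm_continuous.
apply: continuous_comp; [exact: norm_continuous|exact: sqrt_continuous].
Qed.

Lemma wgt_gt0 t : t != 0 -> 0 < wgt t.
Proof. by move=> t0; rewrite mulr_gt0 ?sqrtr_gt0 ?normr_gt0. Qed.

Lemma is_derive_Wgt t : t != 0 -> is_derive t 1 Wgt (5 / 2 * Wgt t / t).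
Proof.
have pos s : 0 < s -> is_derive s 1 Wgt (5 / 2 * Wgt s / s).
  move=> s0; apply: (@near_eq_is_derive _ _ _ (fun s => s * (s * Num.sqrt s))).
    near=> y; rewrite /Wgt /wgt gtr0_norm//.
    by near: y; exact: lt_nbhsr.
  have ds := is_derive1_sqrt s0.
  apply: is_derive_eq; rewrite !scaleRE /Wgt /wgt gtr0_norm//.
  have r0 : Num.sqrt s != 0 by rewrite gt_eqF// sqrtr_gt0.
  have E : s = Num.sqrt s ^+ 2 by rewrite sqr_sqrtr// ltW.
  by move: (Num.sqrt s) r0 E => r r0 ->; field.
case: (ltgtP t 0) => // [tN|tP] _; last exact: pos.
have h := pos (- t); rewrite oppr_gt0 in h; have {}h := h tN.
have E : Wgt = (fun s => - Wgt (- s)).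
  by apply/funext => s; rewrite /Wgt /wgt normrN mulNr opprK.
rewrite [X in is_derive _ _ X _]E.
have := is_deriveN (is_derive1_comp h (is_deriveNid t 1)).
move=> h2; apply: is_derive_eq h2 _.
by rewrite /Wgt /wgt normrN; field; rewrite lt_eqF.
Unshelve. all: by end_near. Qed.

Lemma continuous_Wgt : continuous Wgt.
Proof. by move=> t; apply: continuousM; [exact: cvg_id|exact: continuous_wgt]. Qed.

End Weight.

Section Profile.
Context {R : realType}.
Variables (h C : R).
Hypothesis C0 : 0 <= C.

Definition lipk : R := `|5 * h - 6|.

(** On |z| <= zrad all the relative perturbations C z, h z and (2 - h) z are at most
1/8. *)
Definition zrad : R := (8 * (1 + C + `|h| + `|2 - h|))^-1.

(** For |m| <= mrad and 0 <= X <= 1 the product m X stays in the domain of the inverse of [source],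
and [defectQ] is at most 1/4 there and 1/4-Lipschitz in X. *)
Definition mrad : R := zrad / (4 * (1 + lipk)).

Lemma zrad_spec : [/\ 0 < zrad, zrad <= 1 / 8, C * zrad <= 1 / 8,
  `|h| * zrad <= 1 / 8 & `|2 - h| * zrad <= 1 / 8].
Proof.
rewrite /zrad; set S := 1 + C + _ + _.
have S1 : 1 <= S by rewrite /S -addrA -addrA lerDl !addr_ge0.
have S0 : 0 < S by apply: lt_le_trans S1.
have nh := normr_ge0 h; have nc := normr_ge0 (2 - h).
have H a : a <= S -> a * (8 * S)^-1 <= 1 / 8.
  by move=> aS; rewrite invfM mulrCA mul1r ler_piMr// ler_pdivrMr// mul1r.
split; [by rewrite invr_gt0 mulr_gt0|by rewrite -[leLHS]mul1r; exact: H|..];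
  apply: H; rewrite /S; move: (`|h|) (`|2 - h|) nh nc C0 => a b; lra.
Qed.

Lemma mrad_spec : [/\ 0 < mrad, mrad <= zrad / 4, mrad <= 1 / 32 & lipk * mrad <= 1 / 4].
Proof.
have [z0 z8 _ _ _] := zrad_spec.
have l0 : 0 <= lipk by exact: normr_ge0.
have l1 : 0 < 1 + lipk by rewrite ltr_wpDr.
have m0 : 0 < mrad by rewrite divr_gt0// mulr_gt0.
have E : mrad * (1 + lipk) = zrad / 4 by rewrite /mrad; field; rewrite gt_eqF.
have mz : mrad <= zrad / 4 by rewrite -E ler_pMr// lerDl.
split => //; first by lra.
have : mrad * lipk <= zrad / 4 by rewrite -E mulrDr; lra.
by rewrite mulrC; lra.
Qed.

Variables (W0 : R) (w0 w1 w2 w3 : R -> R).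
Hypothesis W0_gt0 : 0 < W0.
Hypothesis dw0 : forall z : R, `|z| < 1 / 8 -> is_derive z 1 w0 (w1 z).
Hypothesis dw1 : forall z : R, `|z| < 1 / 8 -> is_derive z 1 w1 (w2 z).
Hypothesis dw2 : forall z : R, `|z| < 1 / 8 -> is_derive z 1 w2 (w3 z).
Hypothesis w0_0 : w0 0 = 1.
Hypothesis w1_0 : w1 0 = h / 3.
Hypothesis w2_0 : w2 0 = W0.
Hypothesis w3_le : forall z : R, `|z| < 1 / 8 -> `|w3 z| <= C * W0.

Let delta := zrad.
Let m0 := mrad.
Let c := 2 - h.

Let itv8 (z : R) : (- (1 / 8) < z < 1 / 8) = (`|z| < 1 / 8).
Proof. by rewrite ltr_norml. Qed.

Lemma w2_near z : `|z| < delta -> 7 / 8 * W0 <= w2 z <= 9 / 8 * W0.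
Proof.
move=> zd; have [d0 d8 Cd _ _] := zrad_spec.
have z8 : `|z| < 1 / 8 := lt_le_trans zd d8.
have : `|w2 z - w2 0| <= C * W0 * `|z - 0|.
  apply: (@derive_lipschitz R w2 w3 (- (1 / 8)) (1 / 8)).
  - by move=> t; rewrite itv8; exact: dw2.
  - by move=> t; rewrite itv8; exact: w3_le.
  - by rewrite itv8.
  - by rewrite itv8 normr0 divr_gt0.
rewrite w2_0 subr0 => H1.
have : C * W0 * `|z| <= 1 / 8 * W0.
  rewrite mulrAC ler_pM2r//; apply: le_trans Cd.
  by rewrite ler_wpM2l// ltW.
move: H1; rewrite ler_norml; lra.
Qed.

(** The algebraic part Q of the radial equation; h w(0) = 3 w'(0) makes it vanish at
0. *)
Definition source (z : R) := ((3 + h * z) * w1 z - h * w0 z) / W0.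
Definition dsource (z : R) := (3 + h * z) * (w2 z / W0).

Lemma is_derive_source (z : R) : `|z| < 1 / 8 -> is_derive z 1 source (dsource z).
Proof.
move=> z8; have h0 := dw0 z8; have h1 := dw1 z8.
have -> : source = fun z => ((3 + h * z) * w1 z - h * w0 z) * W0^-1 by [].
apply: is_derive_eq; rewrite !scaleRE /dsource; field; exact: lt0r_neq0.
Qed.

Lemma source0 : source 0 = 0.
Proof. by rewrite /source w0_0 w1_0; field; exact: lt0r_neq0. Qed.

Lemma hz_near z : `|z| < delta -> `|h * z| <= 1 / 8.
Proof.
have [d0 _ _ hd _] := zrad_spec.
by move=> zd; rewrite normrM (le_trans _ hd)// ler_wpM2l// ltW.
Qed.

Lemma cz_near z : `|z| < delta -> `|c * z| <= 1 / 8.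
Proof.
have [d0 _ _ _ hd] := zrad_spec.
by move=> zd; rewrite normrM (le_trans _ hd)// ler_wpM2l// ltW.
Qed.

(** The derivative is (3 + h z) w''(z) / W0, a small perturbation of 3. *)
Lemma dsource_near z : `|z| < delta -> 2 <= dsource z <= 4.
Proof.
move=> zd; have /andP[a b] := w2_near zd; have := hz_near zd.
have a' : 7 / 8 <= w2 z / W0 by rewrite ler_pdivlMr.
have b' : w2 z / W0 <= 9 / 8 by rewrite ler_pdivrMr.
rewrite ler_norml /dsource; move: (w2 z / W0) (h * z) a' b' => A B; nra.
Qed.

Lemma source_inverse : exists Z : R -> R, forall y : R, `|y| <= delta ->
  [/\ `|Z y| < delta, source (Z y) = y, is_derive y 1 Z (dsource (Z y))^-1 &
    exists2 rho, 1 / 4 <= rho <= 1 / 2 & Z y = rho * y].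
Proof.
have [d0 d8 _ _ _] := zrad_spec.
have itvd (t : R) : (- delta < t < delta) = (`|t| < delta) by rewrite ltr_norml.
have dq (t : R) : - delta < t < delta -> is_derive t 1 source (dsource t).
  by rewrite itvd => td; apply: is_derive_source; exact: lt_le_trans td d8.
have dq0 (t : R) : - delta < t < delta -> 0 < dsource t.
  by rewrite itvd => /dsource_near/andP[+ _]; apply: lt_le_trans.
have [Z HZ] := inverse_derive dq dq0.
exists Z => y yd.
have mean (t : R) : `|t| < delta -> exists2 r, 2 <= r <= 4 & source t = r * t.
  move=> td; have [||s /andP[s1 s2]] := @mvt_between R source dsource (- delta) delta t 0 dq.
  - by rewrite itvd.
  - by rewrite itvd normr0.
  rewrite source0 !subr0 => E; exists (dsource s) => //; apply: dsource_near.
  rewrite -itvd (lt_le_trans _ s1) ?(le_lt_trans s2)//.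
  - by rewrite gt_max; move: td; rewrite -itvd => /andP[_ ->].
  - by rewrite lt_min; move: td; rewrite -itvd => /andP[-> _]; rewrite oppr_lt0.
have dh : `|delta / 2| < delta.
  by rewrite gtr0_norm ?divr_gt0// ltr_pdivrMr// ltr_pMr// ltr1n.
have [r1 /andP[r1a _] E1] := mean (delta / 2) dh.
have [|r2 /andP[r2a _] E2] := mean (- (delta / 2)); first by rewrite normrN.
have [|||z zI zE] := @IVT R source (- (delta / 2)) (delta / 2) y.
- by rewrite ge0_cp// divr_ge0// ltW.
- apply: within_itv_continuous => t tI.
  have tI' : - delta < t < delta.
    by rewrite itvd; apply: le_lt_trans dh; rewrite [leRHS]gtr0_norm ?divr_gt0// ler_norml.
  exact: is_derive_continuous (dq t tI').
- move: yd; rewrite ler_norml => /andP[ya yb]; rewrite ge_min le_max.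
  rewrite E1 E2; apply/andP; split; apply/orP; [left|right].
    by apply: le_trans ya; rewrite mulrN lerN2 mulrCA ler_peMr ?(ltW d0)// ler_pdivlMr// mul1r.
  by apply: (le_trans yb); rewrite mulrCA ler_peMr ?(ltW d0)// ler_pdivlMr// mul1r.
have zd : `|z| < delta.
  apply: le_lt_trans dh; move: zI; rewrite in_itv/= => zI.
  by rewrite [leRHS]gtr0_norm ?divr_gt0// ler_norml.
have [|ZE dZ] := HZ z; first by rewrite itvd.
rewrite -zE ZE; split => //.
have [r /andP[ra rb] ->] := mean z zd.
have r0 : 0 < r by apply: lt_le_trans ra.
exists r^-1; last by rewrite mulKf// gt_eqF.
by rewrite !mul1r !lef_pV2 ?posrE// ra rb.
Qed.

(** With v = Z (m X), Q(Z y) = y and m = mu x G^(2-h) / W0, the radial equation becomes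
m X' = (5/2) (3/5 + (2/5) (1 - X) defect(v) - X). *)
Definition defect (z : R) : R := z * (5 * h - 6) / (2 * (2 + c * z)).

Lemma cz_gt z : `|z| < delta -> 3 / 2 <= 2 + c * z.
Proof. by move=> /cz_near; rewrite ler_norml; lra. Qed.

Lemma defect_lipschitz (z z' : R) : `|z| < delta -> `|z'| < delta ->
  `|defect z - defect z'| <= lipk * `|z - z'|.
Proof.
move=> zd zd'; have := cz_gt zd; have := cz_gt zd' => b a.
have a0 : 0 < 2 + c * z by lra.
have b0 : 0 < 2 + c * z' by lra.
rewrite (_ : defect z - defect z' =
    (5 * h - 6) * (z - z') * ((2 + c * z) * (2 + c * z'))^-1); last first.
  by rewrite /defect; field; rewrite !gt_eqF.
have ab0 : 0 < (2 + c * z) * (2 + c * z') by rewrite mulr_gt0.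
rewrite normrM [X in X * _]normrM ler_piMr ?mulr_ge0// gtr0_norm ?invr_gt0//.
rewrite invf_le1//; move: (2 + c * z) (2 + c * z') a b {a0 b0 ab0} => u v; nra.
Qed.

Variable Z : R -> R.
Hypothesis HZ : forall y : R, `|y| <= delta ->
  [/\ `|Z y| < delta, source (Z y) = y, is_derive y 1 Z (dsource (Z y))^-1 &
    exists2 rho, 1 / 4 <= rho <= 1 / 2 & Z y = rho * y].

Lemma Z0 : Z 0 = 0.
Proof.
have [_ _ _ [rho _ ->]] := HZ (y := 0) ltac:(by rewrite normr0; have [/ltW] := zrad_spec).
by rewrite mulr0.
Qed.

Definition defectQ (y : R) := defect (Z y).

Lemma defectQ_lipschitz (y y' : R) : `|y| < delta -> `|y'| < delta ->
  `|defectQ y - defectQ y'| <= lipk * `|y - y'|.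
Proof.
move=> yd yd'; have [zd _ _ _] := HZ (ltW yd); have [zd' _ _ _] := HZ (ltW yd').
apply: le_trans (defect_lipschitz zd zd') _; rewrite ler_wpM2l ?normr_ge0//.
rewrite -[leRHS]mul1r.
apply: (@derive_lipschitz R Z (fun y => (dsource (Z y))^-1) (- delta) delta).
- by move=> t; rewrite -ltr_norml => /ltW/HZ[].
- move=> t; rewrite -ltr_norml => /ltW/HZ[/dsource_near/andP[a b] _ _ _].
  have q0 : 0 < dsource (Z t) by apply: lt_le_trans a.
  by rewrite gtr0_norm ?invr_gt0// invf_le1//; lra.
- by rewrite -ltr_norml.
- by rewrite -ltr_norml.
Qed.

Lemma defectQ0 : defectQ 0 = 0.
Proof. by rewrite /defectQ Z0 /defect !mul0r. Qed.

Lemma defectQ_le (y : R) : `|y| < delta -> `|defectQ y| <= lipk * `|y|.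
Proof.
move=> yd; have := defectQ_lipschitz yd (y' := 0); rewrite normr0 defectQ0 !subr0; apply.
by have [] := zrad_spec.
Qed.

(** Clamping the argument and the unknown makes the iteration defined for all continuous
functions on the line; the fixed point stays where nothing is clamped. *)
Definition clampm (m : R) := clamp (- m0) m0 m.
Definition clampX (x : R) : R := clamp 0 1 x.
Definition Gam (X : R -> R) (m : R) : R :=
  3 / 5 + 2 / 5 * (1 - clampX (X m)) * defectQ (clampm m * clampX (X m)).

(** A primitive of [Gam] against the weight; dividing by [Wgt] gives the average. *)
Definition Prim (X : R -> R) := primitive (fun t => 5 / 2 * wgt t * Gam X t).

(** The average of [Gam X] from 0 to m: its fixed points are the solutions that stay
bounded at the singular point m = 0. *)
Definition average (X : R -> R) (m : R) : R := quot Wgt (Prim X) (Gam X) (clampm m).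

Lemma clampm_le m : `|clampm m| <= m0.
Proof.
have [m1 _ _ _] := mrad_spec; rewrite ler_norml; apply: clamp_itv.
by rewrite ge0_cp// ltW.
Qed.

Lemma clampX_itv x : 0 <= clampX x <= 1. Proof. exact: clamp_itv. Qed.

Lemma clampmX_lt m x : `|clampm m * clampX x| <= m0.
Proof.
have /andP[a b] := clampX_itv x.
by rewrite normrM (ger0_norm a) (le_trans _ (clampm_le m))// ler_piMr.
Qed.

Lemma m0_lt : m0 < delta.
Proof. have [d0 _ _ _ _] := zrad_spec; have [_ + _ _] := mrad_spec; rewrite /m0 /delta; lra. Qed.

Lemma defectQ_cont y : `|y| < delta -> {for y, continuous defectQ}.
Proof.
move=> yd; have [zd _ dZ _] := HZ (ltW yd).
have cZ := is_derive_continuous dZ.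
have := cz_gt zd => a.
apply: continuousM.
  by apply: continuousM; [exact: cZ|exact: cvg_cst].
apply: continuousV; first by rewrite mulf_neq0// gt_eqF//; lra.
apply: continuousM; first exact: cvg_cst.
apply: continuousD; first exact: cvg_cst.
by apply: continuousM; [exact: cvg_cst|exact: cZ].
Qed.

Lemma Gam_cont X : continuous X -> continuous (Gam X).
Proof.
move=> cX_ m.
have c1 : {for m, continuous (fun m => clampX (X m))}.
  by apply: continuous_comp; [exact: cX_|exact: continuous_clamp].
suff : {for m, continuous (fun m => 3 / 5 + 2 / 5 * (1 - clampX (X m)) *
    defectQ (clampm m * clampX (X m)))} by [].
apply: continuousD; first exact: cvg_cst.
apply: continuousM.
  apply: continuousM; first exact: cvg_cst.
  by apply: continuousB; [exact: cvg_cst|exact: c1].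
apply: (@continuous_comp _ _ _ (fun m => clampm m * clampX (X m)) defectQ).
  by apply: continuousM; [exact: continuous_clamp|exact: c1].
by apply: defectQ_cont; exact: le_lt_trans (clampmX_lt _ _) m0_lt.
Qed.

Lemma Prim_derive X (t : R) : continuous X -> t != 0 -> `|t| < 1 ->
  is_derive t 1 (Prim X) (5 / 2 * Wgt t / t * Gam X t).
Proof.
move=> cX_ t0; rewrite ltr_norml => /andP[t1 _].
have cf s : {for s, continuous (fun t => 5 / 2 * wgt t * Gam X t)}.
  apply: continuousM; last exact: Gam_cont.
  by apply: continuousM; [exact: cvg_cst|exact: continuous_wgt].
have := is_derive_primitive cf t1; rewrite /Wgt.
by rewrite (_ : 5 / 2 * (t * wgt t) / t = 5 / 2 * wgt t)//; field.
Qed.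

Lemma Prim_cont0 X : continuous X -> {for 0, continuous (Prim X)}.
Proof.
move=> cX_.
have cf s : {for s, continuous (fun t => 5 / 2 * wgt t * Gam X t)}.
  apply: continuousM; last exact: Gam_cont.
  by apply: continuousM; [exact: cvg_cst|exact: continuous_wgt].
by apply: is_derive_continuous (is_derive_primitive cf _); rewrite oppr_lt0.
Qed.

Lemma Wgt0 : Wgt 0 = 0 :> R. Proof. by rewrite /Wgt mul0r. Qed.

Lemma Wgt_neq0 (t : R) : t != 0 -> Wgt t != 0.
Proof. by move=> t0; rewrite mulf_neq0// gt_eqF// wgt_gt0. Qed.

Lemma clampm_lt1 m : `|clampm m| < 1.
Proof. by have [_ _ m1 _] := mrad_spec; apply: le_lt_trans (clampm_le m) _; rewrite /m0; lra. Qed.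

Let k52 : 0 < 5 / 2 :> R. Proof. by rewrite divr_gt0. Qed.

Lemma quot_Prim_mean X (s : R) : continuous X -> `|s| < 1 ->
  exists2 xi, `|xi| <= `|s| & quot Wgt (Prim X) (Gam X) s = Gam X xi.
Proof.
move=> cX_ s1.
exact: (@quot_mean R (5 / 2) 1 Wgt (Prim X) (Gam X) k52 Wgt0 (primitive0 _)
  (fun t => continuous_Wgt (x := t)) Wgt_neq0 (@is_derive_Wgt R) (Prim_cont0 cX_)
  (fun t t0 t1 => Prim_derive cX_ t0 t1) s s1).
Qed.

Lemma average_mean X m : continuous X ->
  exists2 xi, `|xi| <= `|clampm m| & average X m = Gam X xi.
Proof. by move=> cX_; apply: quot_Prim_mean => //; exact: clampm_lt1. Qed.

(** Continuity at 0 follows from the mean value property. *)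
Lemma average_cont X : continuous X -> continuous (average X).
Proof.
move=> cX_ m; apply: (@continuous_comp _ _ _ clampm (quot Wgt (Prim X) (Gam X))).
  exact: continuous_clamp.
have [->|n0] := eqVneq (clampm m) 0; last first.
  exact: is_derive_continuous (@is_derive_quot R (5 / 2) 1 Wgt (Prim X) (Gam X)
    Wgt_neq0 (@is_derive_Wgt R) (fun t t0 t1 => Prim_derive cX_ t0 t1)
    (clampm m) n0 (clampm_lt1 m)).
apply/continuous_distP => e e0.
have [r r0 H] := (continuous_distP (Gam X) 0).1 (Gam_cont cX_ (x := 0)) e e0.
exists (Num.min r 1); first by rewrite lt_min r0 ltr01.
move=> y; rewrite subr0 lt_min => /andP[yr y1].
have [xi xiy ->] := quot_Prim_mean cX_ y1.
rewrite {1}/quot eqxx; apply: H; rewrite subr0; exact: le_lt_trans yr.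
Qed.

Lemma defectQ_small m x : `|defectQ (clampm m * clampX x)| <= 1 / 4.
Proof.
have le := clampmX_lt m x; have [_ _ _ lm] := mrad_spec.
apply: le_trans (defectQ_le (le_lt_trans le m0_lt)) _; apply: le_trans lm.
by rewrite ler_wpM2l ?normr_ge0.
Qed.

Lemma Gam_itv X m : 1 / 2 <= Gam X m <= 7 / 10.
Proof.
have /andP[a b] := clampX_itv (X m); have := defectQ_small m (X m).
rewrite /Gam ler_norml; move: (clampX (X m)) (defectQ _) a b => u v a b /andP[? ?].
apply/andP; split; nra.
Qed.

(** The difference of two averages is the average of the difference, and Gam depends on X
with a Lipschitz constant below 1/2, for two reasons: the defect is at most 1/4,
and so is its Lipschitz constant in X. *)
Lemma average_contraction X Y e : continuous X -> continuous Y ->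
  (forall t, `|X t - Y t| <= e) -> forall t, `|average X t - average Y t| <= e / 2.
Proof.
move=> cX_ cY XY m.
pose P t := Prim X t - Prim Y t; pose G t := Gam X t - Gam Y t.
have -> : average X m - average Y m = quot Wgt P G (clampm m).
  rewrite /average /quot; case: eqP => // _; rewrite /P [RHS]mulrBl. reflexivity.
have P0 : P 0 = 0 by rewrite /P /Prim !primitive0 subrr.
have cP : {for 0, continuous P}.
  by apply: continuousB; [exact: Prim_cont0 cX_|exact: Prim_cont0 cY].
have dP (t : R) : t != 0 -> `|t| < 1 -> is_derive t 1 P (5 / 2 * Wgt t / t * G t).
  move=> t0 t1; rewrite /G mulrBr.
  exact: is_deriveB (Prim_derive cX_ t0 t1) (Prim_derive cY t0 t1).
have [xi _ ->] := @quot_mean R (5 / 2) 1 Wgt P G k52 Wgt0 P0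
  (fun t => continuous_Wgt (x := t)) Wgt_neq0 (@is_derive_Wgt R) cP dP
  (clampm m) (clampm_lt1 m).
rewrite /G /Gam.
have XYe := XY xi.
have cXY : `|clampX (X xi) - clampX (Y xi)| <= e.
  exact: le_trans (clamp_lipschitz _ _ _ _) XYe.
have e0 : 0 <= e := le_trans (normr_ge0 _) XYe.
have [_ _ _ lm] := mrad_spec.
have kXY : `|defectQ (clampm xi * clampX (X xi)) - defectQ (clampm xi * clampX (Y xi))| <= 1 / 4 * e.
  apply: (@le_trans _ _ (lipk * (m0 * e))); last by rewrite mulrA ler_wpM2r.
  apply: le_trans (defectQ_lipschitz (le_lt_trans (clampmX_lt _ _) m0_lt)
    (le_lt_trans (clampmX_lt _ _) m0_lt)) _.
  by rewrite ler_wpM2l ?normr_ge0// -mulrBr normrM ler_pM// clampm_le.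
have /andP[ya yb] := clampX_itv (Y xi); have kX := defectQ_small xi (X xi).
set u := clampX (X xi) in cXY kXY kX *; set v := clampX (Y xi) in cXY kXY ya yb *.
set K := defectQ (clampm xi * u) in kXY kX *; set K' := defectQ (clampm xi * v) in kXY *.
rewrite (_ : _ - _ = 2 / 5 * ((1 - v) * (K - K') - (u - v) * K)); last by ring.
have h1 : `|(1 - v) * (K - K')| <= 1 / 4 * e.
  rewrite normrM ger0_norm; last by lra.
  by apply: le_trans kXY; rewrite ler_piMl//; lra.
have h2 : `|(u - v) * K| <= e * (1 / 4) by rewrite normrM ler_pM.
have h3 := ler_normB ((1 - v) * (K - K')) ((u - v) * K).
rewrite normrM ger0_norm//; nra.
Qed.

Lemma fixed_point : exists X : R -> R, continuous X /\ average X = X.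
Proof.
apply: (@weighted_contraction R (fun=> 1) average (fun=> 3 / 5) 1).
- exact: cst_continuous.
- by move=> _; exact: ler01.
- exact: cst_continuous.
- exact: average_cont.
- exact: ler01.
- move=> t; rewrite mul1r.
  have [xi _ ->] := @average_mean (fun=> 3 / 5) t ltac:(exact: cst_continuous).
  have /andP[a b] := Gam_itv (fun=> 3 / 5) xi.
  by rewrite ler_norml; lra.
- move=> X Y e cX_ cY XY t; rewrite mulr1.
  by apply: average_contraction => // s; have := XY s; rewrite mulr1.
Qed.

Lemma defectQ_derivable (y : R) : `|y| < delta -> exists d, is_derive y 1 defectQ d.
Proof.
move=> yd; have [zd _ dZ _] := HZ (ltW yd).
have a := cz_gt zd.
have n0 : 2 * (2 + c * Z y) != 0 by rewrite mulf_neq0// gt_eqF//; lra.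
pose num (y : R) : R := Z y * (5 * h - 6).
pose den (y : R) : R := 2 * (2 + c * Z y).
have [e1 d1] : exists e, is_derive y 1 den e by eexists.
have [e2 d2] : exists e, is_derive y 1 num e by eexists.
have d3 := @is_deriveV R den y e1 1 n0 d1.
by eexists; exact: (is_deriveM d2 d3).
Qed.

Variable X : R -> R.
Hypothesis cX_ : continuous X.
Hypothesis TX : average X = X.

Lemma X_itv m : 1 / 2 <= X m <= 7 / 10.
Proof. by rewrite -TX; have [xi _ ->] := average_mean m cX_; exact: Gam_itv. Qed.

Lemma GamE m : `|m| <= m0 ->
  Gam X m = 3 / 5 + 2 / 5 * (1 - X m) * defectQ (m * X m).
Proof.
move=> mm; have /andP[a b] := X_itv m.
have e1 : clampX (X m) = X m by apply: clamp_id; apply/andP; split; lra.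
have e2 : clampm m = m by apply: clamp_id; rewrite -ler_norml.
by rewrite /Gam e1 e2.
Qed.

Lemma X_quot m : `|m| <= m0 -> X m = quot Wgt (Prim X) (Gam X) m.
Proof. by move=> mm; rewrite -{1}TX /average /clampm clamp_id// -ler_norml. Qed.

(** [X] is only known to be continuous at this stage. As the defect vanishes at 0, its
product with a continuous function is nevertheless differentiable there. *)
Lemma Gam_derive0 : exists gam, is_derive (0 : R) 1 (Gam X) gam.
Proof.
have [d0 _ _ _ _] := zrad_spec; have [m1 _ _ _] := mrad_spec.
have [|k1 dk] := @defectQ_derivable 0; first by rewrite normr0.
pose a m := 2 / 5 * (1 - X m).
exists (a 0 * (k1 * X 0)).
have ca : {for 0, continuous (fun m => a m * X m)}.
  apply: continuousM; last exact: cX_.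
  apply: continuousM; first exact: cvg_cst.
  by apply: continuousB; [exact: cvg_cst|exact: cX_].
apply/is_derive_expansionP => e e0.
have e40 : 0 < e / 4 by rewrite divr_gt0.
have k10 : 0 < `|k1| + 1 by rewrite ltr_wpDl.
have [r r0 Hr] := (is_derive_expansionP defectQ 0 k1).1 dk _ e40.
have [r' r'0 Hr'] := (continuous_distP _ 0).1 ca (e / 4 / (`|k1| + 1)) (divr_gt0 e40 k10).
exists (Num.min (Num.min r r') m0); first by rewrite !lt_min r0 r'0.
move=> y; rewrite subr0 !lt_min => /andP[/andP[yr yr'] ym].
rewrite (GamE (ltW ym)) (GamE (m := 0)) ?normr0 ?(ltW m1)// mul0r defectQ0 mulr0 addr0.
have /andP[xa xb] := X_itv y.
have yX : `|y * X y| <= `|y| by rewrite normrM ler_piMr// ger0_norm; lra.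
have := Hr (y * X y); rewrite !subr0 defectQ0 subr0 => /(_ (le_lt_trans yX yr)) h1.
have := Hr' y; rewrite subr0 => /(_ yr') h2.
rewrite -/(a y) (_ : _ - _ = a y * (defectQ (y * X y) - k1 * (y * X y)) +
   k1 * (y * (a y * X y - a 0 * X 0))); last by rewrite /a; ring.
have a1 : `|a y| <= 1 by rewrite /a ger0_norm; lra.
have h3 : `|a y * (defectQ (y * X y) - k1 * (y * X y))| <= e / 4 * `|y|.
  rewrite normrM; apply: (@le_trans _ _ (1 * (e / 4 * `|y|))); last by rewrite mul1r.
  by apply: ler_pM => //; apply: le_trans h1 _; rewrite ler_wpM2l// ltW.
have h4 : `|k1 * (y * (a y * X y - a 0 * X 0))| <= e / 4 * `|y|.
  rewrite !normrM mulrCA [leRHS]mulrC; apply: ler_wpM2l => //.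
  apply: (@le_trans _ _ ((`|k1| + 1) * (e / 4 / (`|k1| + 1)))).
    by apply: ler_pM => //; rewrite lerDl.
  by rewrite mulrC divfK// gt_eqF.
apply: le_trans (ler_normD _ _) _; apply: le_trans (lerD h3 h4) _.
by rewrite -mulrDl ler_wpM2r//; lra.
Qed.

(** The average of a function that is differentiable at 0 is continuously differentiable;
off 0 this is the equation itself. *)
Lemma X_C1 : exists X1 : R -> R, forall m : R, `|m| < m0 ->
  [/\ is_derive m 1 X (X1 m), {for m, continuous X1} &
      m * X1 m = 5 / 2 * (3 / 5 + 2 / 5 * (1 - X m) * defectQ (m * X m) - X m)].
Proof.
have [m1 _ m32 _] := mrad_spec.
have [gam dG] := Gam_derive0.
have cP := Prim_cont0 cX_.
pose X1 := dquot (5 / 2) Wgt (Prim X) (Gam X) gam.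
exists X1 => m mm.
have lt1 : `|m| < 1 by apply: lt_le_trans mm _; rewrite /m0; lra.
have nE : \forall y \near m, quot Wgt (Prim X) (Gam X) y = X y.
  apply/(@nbhs_distP _ R); exists (m0 - `|m|); first by rewrite subr_gt0.
  move=> y ym; rewrite -X_quot//.
  have : `|y| <= `|y - m| + `|m| by rewrite -{1}(subrK m y) ler_normD.
  lra.
have cG (t : R) : `|t| < 1 -> {for t, continuous (Gam X)} by move=> _; exact: Gam_cont.
have dP (t : R) : t != 0 -> `|t| < 1 -> is_derive t 1 (Prim X) (5 / 2 * Wgt t / t * Gam X t).
  exact: Prim_derive.
have cW (t : R) : {for t, continuous Wgt} by exact: continuous_Wgt.
split.
- have D := is_derive_quotE k52 ltr01 Wgt0 (primitive0 _) cW Wgt_neq0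
    (@is_derive_Wgt R) cP dP dG lt1.
  exact: near_eq_is_derive nE D.
- exact: (continuous_dquot k52 ltr01 Wgt0 (primitive0 _) cW Wgt_neq0 (@is_derive_Wgt R) cP dP cG dG lt1).
- rewrite /X1 /dquot; case: eqP => [->|/eqP m00].
    rewrite mul0r mul0r defectQ0 mulr0 addr0 -TX /average /clampm clamp_id; last first.
      by rewrite -ler_norml normr0 (ltW m1).
    rewrite /quot eqxx GamE ?normr0 ?(ltW m1)// mul0r defectQ0; ring.
  rewrite -(GamE (ltW mm)) -(X_quot (ltW mm)); field; exact: m00.
Qed.

End Profile.

(** * From the fixed point to the radial profile *)

(** A radial eigenstate in the variable x = |y|^2: [G] is the tangential stretch, [v] the
excess of the ratio of the two stretches over 1, [w0] the energy as a function of v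
and [w1], [w2] its derivatives. The neighbourhood [U] of [0, 1] contains negative x,
which gives two-sided derivatives at the centre. *)
Definition radial_solution {R : realType} (h : R) (w0 w1 w2 : R -> R) : Prop :=
  exists (U : set R) (G G1 v v1 : R -> R) (mu : R),
  [/\ open U /\ (forall x, 0 <= x <= 1 -> U x),
      Ck 2 U G,
      forall x, U x ->
        [/\ is_derive x 1 G (G1 x), is_derive x 1 v (v1 x), 0 < G x,
            `|v x| < 1 / 8 /\ 2 * x * G1 x = v x * G x &
            2 * x * v1 x * w2 (v x) + ((3 + h * v x) * w1 (v x) - h * w0 (v x)) =
            mu * x * G x `^ (2 - h)],
      G 0 = 1 /\ w1 (v 1) = 0 &
      (forall x, 0 < x <= 1 -> 0 < - Num.sg h * v x) /\ Num.sg mu = - Num.sg h].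

Section Assembly.
Context {R : realType}.
Variables (h W0 mb t1 : R) (w0 w1 w2 X strain dstrain secant secant1 Jint sqrad dsqrad sqrad_inv : R -> R).
Let c := 2 - h.
Let sg := - Num.sg h.
Hypothesis h_neq0 : h != 0.
Hypothesis c_neq0 : 2 - h != 0.
Hypothesis W0_gt0 : 0 < W0.
Hypothesis mb_gt0 : 0 < mb.
Hypothesis cz_bd : forall m, `|m| < mb -> 3 / 2 <= 2 + c * strain m.
Hypothesis strain_lt8 : forall m, `|m| < mb -> `|strain m| < 1 / 8.
Hypothesis w2_neq0 : forall m, `|m| < mb -> w2 (strain m) != 0.
Hypothesis strain_slope : forall m, `|m| < mb -> exists2 rho, 0 < rho & strain m = rho * m.
Hypothesis is_derive_strain : forall m : R, `|m| < mb -> is_derive m 1 strain (dstrain m).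
Hypothesis dstrainE : forall m, dstrain m = (1 - X m) / (w2 (strain m) / W0 * (2 + c * strain m)).
Hypothesis secant_mul : forall m, secant m * m = strain m.
Hypothesis Hzeta : forall m : R, `|m| < mb ->
  is_derive m 1 secant (secant1 m) /\ {for m, continuous secant1}.
Hypothesis is_derive_Jint : forall m : R, `|m| < mb ->
  is_derive m 1 Jint (c * secant m / (2 + c * strain m)).
Hypothesis Jint0 : Jint 0 = 0.
Hypothesis sqradE : forall m, sqrad m = m * expR (- Jint m).
Hypothesis dsqradE : forall m, dsqrad m = expR (- Jint m) * (2 / (2 + c * strain m)).
Hypothesis is_derive_sqrad : forall m : R, `|m| < mb -> is_derive m 1 sqrad (dsqrad m).
Hypothesis sqrad_increasing : forall m m' : R, `|m| < mb -> `|m'| < mb -> m < m' -> sqrad m < sqrad m'.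
Hypothesis HM : forall m : R, `|m| < mb -> sqrad_inv (sqrad m) = m /\ is_derive (sqrad m) 1 sqrad_inv (dsqrad m)^-1.
Hypothesis qE : forall m, `|m| < mb ->
  (3 + h * strain m) * w1 (strain m) - h * w0 (strain m) = W0 * (m * X m).
Hypothesis t1_gt0 : 0 < t1.
Hypothesis t1_lt : t1 < mb / 2.
Hypothesis wt1 : w1 (strain (sg * t1)) = 0.

Let sg2 : sg * sg = 1.
Proof. by rewrite /sg mulrNN -expr2 sqr_sg h_neq0. Qed.

Let nsg : `|sg| = 1.
Proof. by rewrite /sg normrN normr_sg h_neq0. Qed.

(** Inverting the change of variable. Along a solution m' = (m / x) (1 + (2 - h) v / 2), so x is
a multiple of m exp(- J(m)) with J' = (2 - h) zeta / (2 + (2 - h) v) and zeta = v / m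
(the names [secant], [sqrad] and [Jint] stand for zeta, m exp(- J) and J). This function
of m is increasing, [sqrad_inv] is its inverse, and J = (2 - h) ln G.
The multiple is fixed by x = 1 at the zero [sg * t1] of w'(v). *)
Lemma profile_assembly : radial_solution h w0 w1 w2.
Proof.
have mb0 := mb_gt0.
pose mc := 3 / 4 * mb.
have ma_mc : mb / 2 < mc by rewrite /mc; lra.
have mc_mb : mc < mb by rewrite /mc; lra.
have mc0 : 0 < mc by rewrite /mc; lra.
pose m1 := sg * t1.
have m1n : `|m1| = t1 by rewrite normrM nsg mul1r gtr0_norm.
have m1c : `|m1| < mc by rewrite m1n; exact: lt_trans ma_mc.
have ltb m : `|m| <= mc -> `|m| < mb by move=> /le_lt_trans; exact.
have [s1 s1E] : exists s1, s1 = sqrad m1 by exists (sqrad m1).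
have sf0 : sqrad 0 = 0 by rewrite sqradE mul0r.
have mcn : `|mc| = mc by rewrite gtr0_norm.
have b0 : `|0 : R| < mb by rewrite normr0.
have bc : `|mc| < mb by rewrite mcn.
have bNc : `|- mc| < mb by rewrite normrN mcn.
have b1 : `|m1| < mb := lt_trans m1c mc_mb.
have sfNc : sqrad (- mc) < 0 by rewrite -sf0; apply: sqrad_increasing; rewrite ?oppr_lt0.
have sfc : 0 < sqrad mc by rewrite -sf0; apply: sqrad_increasing.
have [m1lo m1hi] : - mc < m1 /\ m1 < mc by move: m1c; rewrite ltr_norml => /andP[].
have s1lo : sqrad (- mc) < s1 by rewrite s1E; apply: sqrad_increasing.
have s1hi : s1 < sqrad mc by rewrite s1E; apply: sqrad_increasing.
pose U := [set x : R | sqrad (- mc) < s1 * x < sqrad mc].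
have oU : open U.
  have -> : U = (fun x => s1 * x) @^-1` [set` `]sqrad (- mc), sqrad mc[].
    by apply/seteqP; split => x /=; rewrite in_itv.
  apply: open_comp; last exact: interval_open.
  move=> x _; have : {for x, continuous (fun x => s1 * x)} by
    apply: continuousM; [exact: cvg_cst|exact: cvg_id].
  exact.
have U01 x : 0 <= x <= 1 -> U x.
  move=> /andP[x0 x1]; rewrite /U/=.
  have [s0|/ltW s0] := lerP 0 s1.
    have l0 : 0 <= s1 * x by rewrite mulr_ge0.
    have l1 : s1 * x <= s1 by rewrite ler_piMr.
    by rewrite (lt_le_trans sfNc l0) (le_lt_trans l1 s1hi).
  have l0 : s1 * x <= 0 by rewrite mulr_le0_ge0.
  have l1 : s1 <= s1 * x by rewrite -[leLHS]mulr1 ler_wnM2l.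
  by rewrite (lt_le_trans s1lo l1) (le_lt_trans l0 sfc).
pose mf x := sqrad_inv (s1 * x).
have mfP x : U x -> exists2 m, `|m| < mb & sqrad m = s1 * x.
  move=> /andP[xa xb].
  have [|||m mI mE] := @IVT R sqrad (- mc) mc (s1 * x).
  - by rewrite ge0_cp// ltW.
  - apply: within_itv_continuous => t tI; apply: is_derive_continuous (is_derive_sqrad _).
    by apply: ltb; rewrite ler_norml.
  - by rewrite ge_min le_max (ltW xa) (ltW xb) orbT.
  exists m => //; apply: ltb; rewrite ler_norml.
  by move: mI; rewrite in_itv.
have mfE x : U x -> `|mf x| < mb /\ sqrad (mf x) = s1 * x.
  by move=> /mfP[m mm E]; rewrite /mf -E; have [-> _] := HM mm.
pose E x := expR (Jint (mf x)).
pose v x := strain (mf x).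
pose mf1 x := s1 * (E x * ((2 + c * v x) / 2)).
have dmf (x : R) : U x -> is_derive x 1 mf (mf1 x).
  move=> Ux; have [mm sE] := mfE x Ux.
  have [_ dM] := HM mm; rewrite sE in dM.
  have d1 : is_derive x 1 (fun x => s1 * x) s1.
    by apply: is_derive_eq; rewrite scaleRE mulr1.
  have := @is_derive1_comp R sqrad_inv (fun x => s1 * x) x _ _ dM d1.
  move=> H; apply: is_derive_eq H _; rewrite /mf1 /E /v dsqradE expRN.
  have a := cz_bd mm; have e0 : expR (Jint (mf x)) != 0 by rewrite gt_eqF ?expR_gt0.
  by field; rewrite e0 gt_eqF//; lra.
pose v1 x := dstrain (mf x) * mf1 x.
have dv (x : R) : U x -> is_derive x 1 v (v1 x).
  move=> Ux; have [mm sE] := mfE x Ux.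
  exact: (@is_derive1_comp R strain mf x _ _ (is_derive_strain mm) (dmf x Ux)).
pose G x := expR (Jint (mf x) / c).
pose G1 x := s1 / 2 * secant (mf x) * E x * G x.
have dJm (x : R) : U x -> is_derive x 1 (fun x => Jint (mf x)) ((c * secant (mf x) / (2 + c * strain (mf x))) * mf1 x).
  move=> Ux; have [mm sE] := mfE x Ux.
  exact: (@is_derive1_comp R Jint mf x _ _ (is_derive_Jint mm) (dmf x Ux)).
have dG (x : R) : U x -> is_derive x 1 G (G1 x).
  move=> Ux; have [mm sE] := mfE x Ux; have a := cz_bd mm.
  have d1 : is_derive x 1 (fun x => Jint (mf x) / c) ((c * secant (mf x) / (2 + c * strain (mf x))) * mf1 x / c).
    have := is_deriveM (dJm x Ux) (is_derive_cst (c^-1) x 1).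
    by move=> H; apply: is_derive_eq H _; rewrite scaler0 add0r scaleRE mulrC.
  have := @is_derive1_comp R expR (fun x => Jint (mf x) / c) x _ _ (is_derive_expR _) d1.
  move=> H; apply: is_derive_eq H _; rewrite /G1 /mf1 /E /G /v.
  by field; rewrite c_neq0 gt_eqF//; lra.
have xE x : U x -> s1 * x * E x = mf x.
  move=> Ux; have [mm <-] := mfE x Ux; rewrite sqradE /E expRN -mulrA mulVf ?mulr1//.
  by rewrite gt_eqF ?expR_gt0.
have cmf x : U x -> {for x, continuous mf}.
  by move=> Ux; exact: is_derive_continuous (dmf x Ux).
have cE x : U x -> {for x, continuous E}.
  move=> Ux; apply: (@continuous_comp _ _ _ (fun x => Jint (mf x)) expR).
    exact: is_derive_continuous (dJm x Ux).
  exact: continuous_expR.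
have cv x : U x -> {for x, continuous v}.
  by move=> Ux; exact: is_derive_continuous (dv x Ux).
have cmf1 x : U x -> {for x, continuous mf1}.
  move=> Ux; apply: continuousM; first exact: cvg_cst.
  apply: continuousM; first exact: cE.
  apply: continuousM; last exact: cvg_cst.
  apply: continuousD; first exact: cvg_cst.
  by apply: continuousM; [exact: cvg_cst|exact: cv].
have C1mf : Ck 1 U mf by apply: Ck_derive dmf _.
have C1zeta : Ck 1 U (fun x => secant (mf x)).
  have oV : open [set m : R | `|m| < mb].
    rewrite (_ : [set m : R | _] = ball (0 : R) mb); first exact: ball_open.
    by rewrite -ball_normE; apply/seteqP; split => x /=; rewrite sub0r normrN.
  apply: (@Ck_comp R R 1 U [set m : R | `|m| < mb] mf secant) => //.
    by move=> x /mfE[].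
  apply: (@Ck_derive R 0 [set m : R | `|m| < mb] secant secant1) => // m mm.
    by have [] := Hzeta mm.
  by have [] := Hzeta mm.
have C1J : Ck 1 U (fun x => Jint (mf x)).
  apply: Ck_derive dJm _ => // x Ux; apply: continuousM; last exact: cmf1.
  have [mm sE] := mfE x Ux; have a := cz_bd mm.
  apply: (@continuousM _ _ (fun x => c * secant (mf x)) (fun x => (2 + c * v x)^-1)).
    apply: continuousM; first exact: cvg_cst.
    exact: (Ck_continuous C1zeta Ux).
  apply: continuousV; first by rewrite gt_eqF// /v; lra.
  apply: continuousD; first exact: cvg_cst.
  by apply: continuousM; [exact: cvg_cst|exact: cv].
have C1E : Ck 1 U E.
  exact: (Ck_comp oU (fun _ _ => I) C1J (Ck_expR 1 openT)).
have C1G : Ck 1 U G.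
  apply: (Ck_comp oU (fun _ _ => I) _ (Ck_expR 1 openT)).
  exact: (CkM oU C1J (Ck_cst 1 U c^-1)).
have C1G1 : Ck 1 U G1 :=
  CkM oU (CkM oU (CkM oU (Ck_cst 1 U (s1 / 2)) C1zeta) C1E) C1G.
have C2G : Ck 2 U G := Ck_derive oU dG C1G1.
have m1E : mf 1 = m1 by rewrite /mf mulr1 s1E; have [] := HM b1.
have mf0 : mf 0 = 0 by rewrite -xE ?mulr0 ?mul0r//; apply: U01; rewrite lexx ler01.
exists U, G, G1, v, v1, (W0 * s1); split => //.
- move=> x Ux; have [mm sE] := mfE x Ux; have a := cz_bd mm.
  have w0' := w2_neq0 mm.
  split; [exact: dG|exact: dv|exact: expR_gt0| |].
    split; first exact: strain_lt8 mm.
    transitivity (secant (mf x) * (s1 * x * E x) * G x).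
      by rewrite /G1; field.
    by rewrite (xE x Ux) secant_mul.
  rewrite (qE mm).
  (* This is why J was divided by 2 - h in the definition of G. *)
  have -> : G x `^ (2 - h) = E x.
    by rewrite /G -expRM -/c divfK.
  have -> : W0 * s1 * x * E x = W0 * mf x by rewrite -(xE x Ux); ring.
  rewrite (_ : 2 * x * v1 x * w2 (v x) = W0 * (mf x * (1 - X (mf x)))); first by ring.
  transitivity (W0 * (s1 * x * E x * (1 - X (mf x)))); last by rewrite (xE x Ux).
  rewrite /v1 dstrainE /mf1 /v; field.
  by rewrite w0' lt0r_neq0//= gt_eqF//; lra.
- split; first by rewrite /G mf0 Jint0 mul0r expR0.
  by rewrite /v m1E.
- have sgs (m : R) : `|m| < mb -> 0 < sg * m -> 0 < sg * strain m.
    move=> mm m0'; have [rho r1 ->] := strain_slope mm.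
    by rewrite mulrCA mulr_gt0.
  have sgm1 : 0 < sg * m1 by rewrite /m1 mulrA sg2 mul1r.
  have sgs1 : 0 < sg * s1 by rewrite s1E sqradE mulrA mulr_gt0// expR_gt0.
  split.
    move=> x /andP[x0 x1]; have Ux : U x by apply: U01; rewrite (ltW x0) x1.
    have [mm sE] := mfE x Ux; apply: sgs => //.
    by rewrite -(xE x Ux) 2!mulrA mulr_gt0 ?expR_gt0// mulr_gt0.
  rewrite sgrM (gtr0_sg W0_gt0) mul1r.
  have : Num.sg (sg * s1) = 1 by rewrite gtr0_sg.
  rewrite sgrM => /(congr1 ( *%R sg)).
  have -> : Num.sg sg = sg by rewrite /sg sgrN sgr_id.
  by rewrite mulrA sg2 mul1r mulr1.
Qed.

End Assembly.

Section ProfileOfParameter.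
Context {R : realType}.
Variables (h C : R).
Hypothesis C0 : 0 <= C.
Hypothesis h_neq0 : h != 0.
Hypothesis c_neq0 : 2 - h != 0.
Variables (W0 : R) (w0 w1 w2 w3 : R -> R).
Hypothesis W0_gt0 : 0 < W0.
Hypothesis dw0 : forall z : R, `|z| < 1 / 8 -> is_derive z 1 w0 (w1 z).
Hypothesis dw1 : forall z : R, `|z| < 1 / 8 -> is_derive z 1 w1 (w2 z).
Hypothesis dw2 : forall z : R, `|z| < 1 / 8 -> is_derive z 1 w2 (w3 z).
Hypothesis w0_0 : w0 0 = 1.
Hypothesis w1_0 : w1 0 = h / 3.
Hypothesis w2_0 : w2 0 = W0.
Hypothesis w3_le : forall z : R, `|z| < 1 / 8 -> `|w3 z| <= C * W0.
Hypothesis W0_large : 20 * `|h| <= W0 * mrad h C.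

Let delta := zrad h C.
Let m0 := mrad h C.
Let c := 2 - h.
Let qhat := source h W0 w0 w1.
Let dqhat := dsource h W0 w2.

Variable Z : R -> R.
Hypothesis HZ : forall y : R, `|y| <= delta ->
  [/\ `|Z y| < delta, qhat (Z y) = y, is_derive y 1 Z (dqhat (Z y))^-1 &
    exists2 rho, 1 / 4 <= rho <= 1 / 2 & Z y = rho * y].
Variables X X1 : R -> R.
Hypothesis X_bd : forall m, 1 / 2 <= X m <= 7 / 10.
Hypothesis dX : forall m : R, `|m| < m0 ->
  [/\ is_derive m 1 X (X1 m), {for m, continuous X1} &
      m * X1 m = 5 / 2 * (3 / 5 + 2 / 5 * (1 - X m) * defectQ h Z (m * X m) - X m)].

(** The ratio excess v as a function of the parameter m. *)
Definition strain m := Z (m * X m).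
Definition dstrain m := (1 - X m) / (w2 (strain m) / W0 * (2 + c * strain m)).

Let m0_gt0 : 0 < m0. Proof. by have [] := mrad_spec h C0. Qed.
Let m0_lt_delta : m0 < delta. Proof. exact: m0_lt. Qed.

Lemma mX_le m : `|m * X m| <= `|m|.
Proof. by have /andP[a b] := X_bd m; rewrite normrM ler_piMr// ger0_norm; lra. Qed.

Lemma mX_delta m : `|m| < m0 -> `|m * X m| <= delta.
Proof. by move=> mm; apply: le_trans (mX_le m) _; apply: ltW; apply: lt_trans m0_lt_delta. Qed.

Lemma strain_lt m : `|m| < m0 -> `|strain m| < delta.
Proof. by move=> /mX_delta/HZ[]. Qed.

Lemma strain_lt8 m : `|m| < m0 -> `|strain m| < 1 / 8.
Proof. by move=> /strain_lt zd; have [_ + _ _ _] := zrad_spec h C0; exact: lt_le_trans. Qed.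

Lemma cz_bd m : `|m| < m0 -> 3 / 2 <= 2 + c * strain m.
Proof. by move=> /strain_lt zd; exact: (cz_gt C0 zd). Qed.

Lemma w2_bd m : `|m| < m0 -> 7 / 8 * W0 <= w2 (strain m) <= 9 / 8 * W0.
Proof. by move=> /strain_lt zd; exact: (w2_near C0 W0_gt0 dw2 w2_0 w3_le zd). Qed.

(** v has the sign of m and is comparable to it. *)
Lemma strain_slope m : `|m| < m0 -> exists2 rho, 1 / 8 <= rho <= 1 / 2 & strain m = rho * m.
Proof.
move=> mm; have [_ _ _ [rho /andP[r1 r2] E]] := HZ (mX_delta mm).
have /andP[x1 x2] := X_bd m.
exists (rho * X m); last by rewrite /strain E; ring.
by apply/andP; split; nra.
Qed.

Lemma strain0 : strain 0 = 0.
Proof. by have [|rho _ ->] := @strain_slope 0; [rewrite normr0|rewrite mulr0]. Qed.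

(** v' is (X + m X') / Q'(v), from which the equation for X removes X'. So v gains one derivative
over X, which the regularity of G depends on. *)
Lemma is_derive_strain (m : R) : `|m| < m0 -> is_derive m 1 strain (dstrain m).
Proof.
move=> mm; have [_ _ dZ _] := HZ (mX_delta mm); have [dXm _ E] := dX mm.
have a := cz_bd mm; have /andP[b _] := w2_bd mm.
have hz : `|h * strain m| <= 1 / 8 by exact: (hz_near C0 (strain_lt mm)).
have d1 := is_deriveM (is_derive_id m 1) dXm.
have d2 : is_derive m 1 strain ((dqhat (Z (m * X m)))^-1 * (m *: X1 m + X m *: 1)).
  exact: (@is_derive1_comp R Z (fun m => m * X m) m _ _ dZ d1).
apply: is_derive_eq d2 _; rewrite !scaleRE mulr1 E.
rewrite /dstrain /dqhat /dsource /defectQ /defect -/(strain m) /c; field.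
have w0' : w2 (strain m) != 0 by rewrite gt_eqF// (lt_le_trans _ b)// mulr_gt0// divr_gt0.
move: hz; rewrite ler_norml => /andP[? ?].
move: a; rewrite /c => a.
by rewrite w0' !gt_eqF//; lra.
Qed.

Lemma is_derive_dstrain (m : R) : `|m| < m0 -> exists d, is_derive m 1 dstrain d.
Proof.
move=> mm; have [dXm _ _] := dX mm; have dz := is_derive_strain mm.
have a := cz_bd mm; have /andP[b _] := w2_bd mm.
have w0' : w2 (strain m) != 0 by rewrite gt_eqF// (lt_le_trans _ b)// mulr_gt0// divr_gt0.
pose num m := 1 - X m; pose den m := w2 (strain m) / W0 * (2 + c * strain m).
have d1 : is_derive m 1 (w2 \o strain) (w3 (strain m) * dstrain m).
  by apply: is_derive1_comp => //; exact: dw2 (strain_lt8 mm).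
have d1' : is_derive m 1 (fun m => w2 (strain m)) (w3 (strain m) * dstrain m) by exact: d1.
have [e1 dn] : exists e, is_derive m 1 num e by eexists.
have [e2 dd] : exists e, is_derive m 1 den e by eexists.
have n0 : den m != 0.
  rewrite /den !mulf_neq0 ?invr_eq0//; first exact: lt0r_neq0.
  by rewrite gt_eqF//; lra.
by eexists; exact: (is_deriveM dn (@is_deriveV R den m e2 1 n0 dd)).
Qed.

(** The quotient v / m, extended through m = 0: the average of v' with constant weight, hence of
class C^1 by the same lemmas as [X]. *)
Definition secant := quot (fun m => m) strain dstrain.

Lemma secant_mul m : secant m * m = strain m.
Proof.
by rewrite /secant /quot; case: eqP => [->|/eqP m0']; [rewrite mulr0 strain0|rewrite divfK].
Qed.

Lemma secant_C1 : exists secant1 : R -> R, forall m : R, `|m| < m0 ->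
  is_derive m 1 secant (secant1 m) /\ {for m, continuous secant1}.
Proof.
have [|gam dG] := @is_derive_dstrain 0; first by rewrite normr0.
pose D := fun m : R => m.
have cD (t : R) : {for t, continuous D} by exact: cvg_id.
have Dn0 (t : R) : t != 0 -> D t != 0 by [].
have dD (t : R) : t != 0 -> is_derive t 1 D (1 * D t / t).
  by move=> t0; rewrite mul1r divff//; exact: is_derive_id.
have cP : {for 0, continuous strain}.
  by apply: is_derive_continuous (is_derive_strain _); rewrite normr0.
have dP (t : R) : t != 0 -> `|t| < m0 -> is_derive t 1 strain (1 * D t / t * dstrain t).
  by move=> t0 tm; rewrite mul1r divff// mul1r; exact: is_derive_strain.
have cG (t : R) : `|t| < m0 -> {for t, continuous dstrain}.
  by move=> /is_derive_dstrain[d]; exact: is_derive_continuous.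
exists (dquot 1 D strain dstrain gam) => m mm; split.
  exact: (is_derive_quotE ltr01 m0_gt0 erefl strain0 cD Dn0 dD cP dP dG mm).
exact: (continuous_dquot ltr01 m0_gt0 erefl strain0 cD Dn0 dD cP dP cG dG mm).
Qed.

Definition mb := m0 / 2.

(** The integrand is clamped because [primitive] integrates over a fixed range. *)
Definition Jint := primitive (fun m => let t := clamp (- mb) mb m in
  c * secant t / (2 + c * strain t)).
Definition dJint m := c * secant m / (2 + c * strain m).

Let mb_gt0 : 0 < mb. Proof. by rewrite divr_gt0. Qed.
Let mb_lt : mb < m0.
Proof. by rewrite /mb ltr_pdivrMr// ltr_pMr// ltr1n. Qed.
Let mb_lt1 : mb < 1.
Proof.
have [_ _ mm _] := mrad_spec h C0; apply: lt_le_trans mb_lt _.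
by apply: le_trans mm _; rewrite ler_pdivrMr// mul1r ler1n.
Qed.
Let mbW (m : R) : `|m| < mb -> `|m| < m0. Proof. by move=> /lt_trans; apply. Qed.

Lemma is_derive_Jint (m : R) : `|m| < mb -> is_derive m 1 Jint (dJint m).
Proof.
move=> mm; have [secant1 Hz] := secant_C1.
have cf (t : R) : {for t, continuous (fun m => let t := clamp (- mb) mb m in
    c * secant t / (2 + c * strain t))}.
  apply: (@continuous_comp _ _ _ (clamp (- mb) mb) dJint).
    exact: continuous_clamp.
  set u := clamp _ _ _.
  have um : `|u| < m0.
    by apply: le_lt_trans mb_lt; rewrite ler_norml; apply: clamp_itv; rewrite ge0_cp// ltW.
  have cz : {for u, continuous strain} := is_derive_continuous (is_derive_strain um).
  have ce : {for u, continuous secant} := is_derive_continuous (Hz u um).1.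
  have a := cz_bd um.
  apply: continuousM.
    by apply: continuousM; [exact: cvg_cst|exact: ce].
  apply: continuousV; first by rewrite gt_eqF//; lra.
  apply: continuousD; first exact: cvg_cst.
  by apply: continuousM; [exact: cvg_cst|exact: cz].
have m1 : -1 < m.
  by move: mm; rewrite ltr_norml => /andP[+ _]; apply: lt_trans; rewrite ltrN2.
have := is_derive_primitive cf m1.
by rewrite clamp_id// -ler_norml ltW.
Qed.

Definition sqrad m := m * expR (- Jint m).
Definition dsqrad m := expR (- Jint m) * (2 / (2 + c * strain m)).

Lemma is_derive_sqrad (m : R) : `|m| < mb -> is_derive m 1 sqrad (dsqrad m).
Proof.
move=> mm; have dJ := is_derive_Jint mm.
have a := cz_bd (mbW mm).
have d1 : is_derive m 1 (fun m => expR (- Jint m)) (expR (- Jint m) * (- dJint m)).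
  exact: (@is_derive1_comp R expR (fun m => - Jint m) m _ _ (is_derive_expR _) (is_deriveN dJ)).
have d2 := is_deriveM (is_derive_id m 1) d1.
apply: is_derive_eq d2 _; rewrite !scaleRE /dsqrad /dJint.
rewrite -secant_mul in a *; field.
by rewrite gt_eqF//; lra.
Qed.

Let mbE (m : R) : (- mb < m < mb) = (`|m| < mb). Proof. by rewrite ltr_norml. Qed.

Lemma dsqrad_gt0 m : `|m| < mb -> 0 < dsqrad m.
Proof.
move=> mm; have a := cz_bd (mbW mm).
by rewrite mulr_gt0 ?expR_gt0// divr_gt0//; lra.
Qed.

Lemma sqrad_increasing (m m' : R) : `|m| < mb -> `|m'| < mb -> m < m' -> sqrad m < sqrad m'.
Proof.
move=> mm mm'; apply: (@derive_increasing R sqrad dsqrad (- mb) mb); rewrite ?mbE//.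
- by move=> t; rewrite mbE; exact: is_derive_sqrad.
- by move=> t; rewrite mbE; exact: dsqrad_gt0.
Qed.

Lemma sqrad_inverse : exists sqrad_inv : R -> R, forall m : R, `|m| < mb ->
  sqrad_inv (sqrad m) = m /\ is_derive (sqrad m) 1 sqrad_inv (dsqrad m)^-1.
Proof.
have [||sqrad_inv HM] := @inverse_derive R sqrad dsqrad (- mb) mb.
- by move=> t; rewrite mbE; exact: is_derive_sqrad.
- by move=> t; rewrite mbE; exact: dsqrad_gt0.
- by exists sqrad_inv => m; rewrite -mbE; exact: HM.
Qed.

Let sg := - Num.sg h.
Let ma := mb / 2.

Let sg2 : sg * sg = 1.
Proof. by rewrite /sg mulrNN -expr2 sqr_sg h_neq0. Qed.

Let sgh : sg * h = - `|h|.
Proof. by rewrite /sg mulNr -normrEsg. Qed.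

Let nsg : `|sg| = 1.
Proof. by rewrite /sg normrN normr_sg h_neq0. Qed.

Let ma_gt0 : 0 < ma. Proof. by rewrite divr_gt0. Qed.

(** w'(v) starts from h / 3 at m = 0 and its derivative in v is about W0, while v is at least
m / 8 in absolute value. On an interval of length m0 / 4 it therefore changes sign as soon as
W0 m0 dominates |h|, which is what a large f''(1) is for. *)
Lemma root_exists : exists t : R, 0 < t < ma /\ w1 (strain (sg * t)) = 0.
Proof.
have nh : 0 < `|h| by rewrite normr_gt0.
have maE : ma = m0 / 4 by rewrite /ma /mb; field.
have ma_mb : ma < mb by rewrite /ma ltr_pdivrMr// ltr_pMr// ltr1n.
have stE t : 0 <= t <= ma -> `|sg * t| < m0.
  move=> /andP[t0 t1]; rewrite normrM nsg mul1r ger0_norm//.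
  exact: le_lt_trans t1 (lt_trans ma_mb mb_lt).
have d8 : zrad h C <= 1 / 8 by have [] := zrad_spec h C0.
pose f t := sg * w1 (strain (sg * t)).
have f0 : f 0 = - `|h| / 3 by rewrite /f mulr0 strain0 w1_0 mulrA sgh.
have fma : 0 < f ma.
  have mm : `|sg * ma| < m0 by apply: stE; rewrite lexx ltW.
  have [rho /andP[r1 r2] zE] := strain_slope mm.
  have [|||t /andP[t1 t2] E] := @mvt_between R w1 w2 (- delta) delta (strain (sg * ma)) 0.
  - by move=> t; rewrite -ltr_norml => td; apply: dw1; exact: lt_le_trans d8.
  - by rewrite -ltr_norml strain_lt.
  - by rewrite oppr_lt0 (lt_trans m0_gt0 m0_lt_delta).
  have td : `|t| < delta.
    have := strain_lt mm; rewrite !ltr_norml => /andP[z1 z2].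
    have dl : 0 < delta := lt_trans m0_gt0 m0_lt_delta.
    rewrite (lt_le_trans _ t1) ?(le_lt_trans t2)//.
    - by rewrite gt_max z2.
    - by rewrite lt_min z1 oppr_lt0.
  have /andP[wa _] := w2_near C0 W0_gt0 dw2 w2_0 w3_le td.
  move: E; rewrite w1_0 subr0 zE => /eqP; rewrite subr_eq => /eqP E.
  rewrite /f zE E mulrDr.
  rewrite (_ : sg * (w2 t * (rho * (sg * ma))) = (sg * sg) * (w2 t * rho * ma)); last by ring.
  rewrite sg2 mul1r [sg * (h / 3)]mulrA sgh.
  have h1 : 7 / 64 * (W0 * ma) <= w2 t * rho * ma.
    rewrite (_ : 7 / 64 * (W0 * ma) = (7 / 8 * W0) * (1 / 8) * ma); last by field.
    by rewrite ler_pM2r// ler_pM// mulr_ge0// ltW// divr_gt0.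
  have h2 : 20 * `|h| <= 4 * (W0 * ma).
    by apply: le_trans W0_large _; rewrite maE le_eqVlt; apply/orP; left; apply/eqP; rewrite -/m0; field.
  by lra.
have [|||t tI tE] := @IVT R f 0 ma 0.
- exact: ltW.
- apply: within_itv_continuous => t tI; rewrite /f.
  have tm := stE t tI.
  apply: continuousM; first exact: cvg_cst.
  apply: (@continuous_comp _ _ _ (fun t => sg * t) (w1 \o strain)).
    by apply: continuousM; [exact: cvg_cst|exact: cvg_id].
  apply: continuous_comp; first exact: is_derive_continuous (is_derive_strain tm).
  exact: is_derive_continuous (dw1 (strain_lt8 tm)).
- rewrite ge_min le_max f0 (ltW fma) orbT andbT; apply/orP; left.
  by rewrite mulNr oppr_le0 divr_ge0.
move: tI; rewrite in_itv/= => /andP[t0 t1].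
exists t; split.
  rewrite !lt_neqAle t0 t1 !andbT; apply/andP; split; apply/eqP => E.
    by move: tE; rewrite -E f0; lra.
  by move: fma; rewrite -E tE ltxx.
by move: tE => /(congr1 ( *%R sg)); rewrite /f mulrA sg2 mul1r mulr0.
Qed.

Lemma profile_inner : radial_solution h w0 w1 w2.
Proof.
have [t1 [/andP[t10 t1a] wt1]] := root_exists.
have [sqrad_inv HM] := sqrad_inverse.
have [secant1 Hzeta] := secant_C1.
apply: (@profile_assembly R h W0 mb t1 w0 w1 w2 X strain dstrain secant secant1 Jint sqrad dsqrad sqrad_inv) => //.
- by move=> m /mbW; exact: cz_bd.
- by move=> m /mbW; exact: strain_lt8.
- move=> m /mbW/w2_bd/andP[b _].
  by rewrite gt_eqF// (lt_le_trans _ b)// mulr_gt0// divr_gt0.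
- move=> m /mbW/strain_slope[rho /andP[r _] E]; exists rho => //.
  by rewrite (lt_le_trans _ r)// divr_gt0.
- by move=> m /mbW; exact: is_derive_strain.
- exact: secant_mul.
- by move=> m /mbW; exact: Hzeta.
- exact: is_derive_Jint.
- exact: primitive0.
- exact: is_derive_sqrad.
- exact: sqrad_increasing.
- move=> m /mbW/mX_delta/HZ[_ qE _ _].
  by rewrite -[X in _ = W0 * X]qE /qhat /source -/(strain m) [RHS]mulrC divfK// lt0r_neq0.
Qed.

End ProfileOfParameter.

(** The size of W0 is compared with a radius that depends on [h] and on the ratio [C] of the
third derivative to the second one only. *)
Lemma radial_profile {R : realType} (h C W0 : R) (w0 w1 w2 w3 : R -> R) :
  0 <= C -> h != 0 -> 2 - h != 0 -> 0 < W0 ->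
  (forall z : R, `|z| < 1 / 8 -> is_derive z 1 w0 (w1 z)) ->
  (forall z : R, `|z| < 1 / 8 -> is_derive z 1 w1 (w2 z)) ->
  (forall z : R, `|z| < 1 / 8 -> is_derive z 1 w2 (w3 z)) ->
  w0 0 = 1 -> w1 0 = h / 3 -> w2 0 = W0 ->
  (forall z : R, `|z| < 1 / 8 -> `|w3 z| <= C * W0) ->
  20 * `|h| <= W0 * mrad h C ->
  radial_solution h w0 w1 w2.
Proof.
move=> C0 hn0 cn0 W00 dw0 dw1 dw2 w00 w10 w20 w3C large.
have [Z HZ] := source_inverse C0 W00 dw0 dw1 dw2 w00 w10 w20 w3C.
have [X [cX_ TX]] := fixed_point C0 W00 dw2 w20 w3C HZ.
have [X1 HX1] := X_C1 C0 W00 dw2 w20 w3C HZ cX_ TX.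
exact: (profile_inner C0 hn0 cn0 W00 dw1 dw2 w10 w20 w3C large HZ
  (X_itv C0 W00 dw2 w20 w3C HZ cX_ TX) HX1).
Qed.

(** * Second order equations with Lipschitz right-hand side *)

#[local] Opaque primitive.

Section ODE.
Context {R : realType}.
Implicit Types (t : R) (f g : R -> R).

Lemma mvt_on f (d : R -> R) (lo x y : R) :
  (forall t, lo < t -> is_derive t 1 f (d t)) -> lo < x -> x <= y ->
  exists2 t, x <= t <= y & f y - f x = d t * (y - x).
Proof.
move=> fd lx xy.
have [|||t tI E] := @mvt_between R f d lo (y + 1) y x.
- by move=> t /andP[lt _]; exact: fd.
- by rewrite (lt_le_trans lx xy) ltrDl ltr01.
- by rewrite lx (le_lt_trans xy)// ltrDl ltr01.
by exists t => //; move: tI; rewrite min_r// max_l.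
Qed.

(** Integrating an exponential bound gains the factor 1 / k, which is what makes the
Picard operator contract for large k. *)
Lemma exp_growth f (d : R -> R) (lo c k t : R) : 0 < k -> lo < 0 -> f 0 = 0 ->
  (forall s, lo < s -> is_derive s 1 f (d s)) ->
  (forall s, 0 <= s <= t -> `|d s| <= c * expR (k * s)) ->
  0 <= t -> `|f t| <= c / k * expR (k * t).
Proof.
move=> k0 lo0 f0 fd dc t0.
have c0 : 0 <= c.
  have := dc 0; rewrite lexx t0 mulr0 expR0 mulr1 => /(_ isT).
  exact: le_trans.
have main (s : R) : `|s| = 1 -> 0 <= c / k * expR (k * t) - s * f t.
  move=> s1; pose H x := c / k * expR (k * x) - s * f x.
  have dH (x : R) : lo < x -> is_derive x 1 H (c * expR (k * x) - s * d x).
    move=> lx; have dx := fd x lx.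
    have d1 : is_derive x 1 (fun x => k * x) k.
      by apply: is_derive_eq; rewrite scaleRE mulr1.
    have d2 := @is_derive1_comp R expR (fun x => k * x) x _ _ (is_derive_expR _) d1.
    have d3 := is_deriveB (is_deriveZ (c / k) d2) (is_deriveZ s dx).
    by apply: is_derive_eq d3 _; rewrite !scaleRE; field; rewrite gt_eqF.
  have [x /andP[x0 xt] E] := mvt_on dH lo0 t0.
  change (0 <= H t); rewrite -(subrK (H 0) (H t)) E addr_ge0//; last first.
    by rewrite /H f0 !mulr0 subr0 expR0 mulr1 divr_ge0// ltW.
  rewrite mulr_ge0 ?subr0// subr_ge0.
  apply: le_trans (ler_norm _) _; rewrite normrM s1 mul1r; apply: dc.
  by rewrite x0.
have h1 := main 1; rewrite normr1 mul1r in h1; have {}h1 := h1 erefl.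
have h2 := main (- 1); rewrite normrN normr1 mulN1r opprK in h2; have {}h2 := h2 erefl.
by rewrite ler_norml; lra.
Qed.

(** The unknown is sought as an even function on the whole line, so that no boundary intervenes
in the contraction; the integral formula is then read for t > -1/2 without the |t|.
With k = 1 + 2 L two integrations contract by L / k^2 <= 1/2. *)
Lemma lipschitz_ode (Phi : R -> R) (L a0 b0 : R) : 0 <= L ->
  (forall x y, `|Phi x - Phi y| <= L * `|x - y|) ->
  exists b b1 b2 : R -> R, [/\ b 0 = a0, b1 0 = b0,
    forall t, - (1 / 2) < t -> is_derive t 1 b (b1 t),
    forall t, - (1 / 2) < t -> is_derive t 1 b1 (b2 t) &
    continuous b2 /\ forall t, 0 <= t -> b2 t = Phi (b t)].
Proof.
move=> L0 PhiL.
have cPhi : continuous Phi := lipschitz_continuous PhiL.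
pose k : R := 1 + 2 * L.
have k1 : 1 <= k by rewrite /k lerDl mulr_ge0.
have k0 : 0 < k by apply: lt_le_trans k1.
pose rhs (a : R -> R) (s : R) := Phi (a `|s|).
pose P1 (a : R -> R) := primitive (rhs a).
pose q (a : R -> R) (s : R) := P1 a (Num.max (- (1 / 2)) s).
pose P2 (a : R -> R) := primitive (q a).
have crhs a : continuous a -> continuous (rhs a).
  move=> ca s; apply: (@continuous_comp _ _ _ (fun s => a `|s|) Phi); last exact: cPhi.
  by apply: (@continuous_comp _ _ _ (fun s : R => `|s|) a); [exact: norm_continuous|exact: ca].
have dP1 a (t : R) : continuous a -> -1 < t -> is_derive t 1 (P1 a) (rhs a t).
  by move=> ca t1; apply: is_derive_primitive t1; exact: crhs.
have cq a : continuous a -> continuous (q a).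
  move=> ca s; suff : {for s, continuous (P1 a \o (fun s => Num.max (- (1 / 2)) s))} by [].
  apply: continuous_comp.
    by apply: continuous_max; [exact: cvg_cst|exact: cvg_id].
  apply: is_derive_continuous (dP1 a _ ca _).
  by rewrite lt_max; apply/orP; left; lra.
have dP2 a (t : R) : continuous a -> - (1 / 2) < t -> is_derive t 1 (P2 a) (P1 a t).
  move=> ca t1; have t2 : -1 < t by lra.
  have <- : q a t = P1 a t by rewrite /q max_r// ltW.
  exact: is_derive_primitive (cq a ca) t2.
pose T (a : R -> R) (t : R) := a0 + b0 * `|t| + P2 a `|t|.
have half : - (1 / 2) < 0 :> R by lra.
have neg1 : -1 < 0 :> R by lra.
have est a b e : continuous a -> continuous b ->
    (forall s, 0 <= s -> `|rhs a s - rhs b s| <= e * expR (k * s)) ->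
    forall t, 0 <= t -> `|P2 a t - P2 b t| <= e / k / k * expR (k * t).
  move=> ca cb ab t t0.
  apply: (@exp_growth (fun t => P2 a t - P2 b t) (fun t => P1 a t - P1 b t) (- (1 / 2))) => //.
  - by rewrite /P2 !primitive0 subrr.
  - by move=> s s1; apply: is_deriveB; exact: dP2.
  - move=> s /andP[s0 _].
    apply: (@exp_growth (fun t => P1 a t - P1 b t) (fun t => rhs a t - rhs b t) (-1)) => //.
    + by rewrite /P1 !primitive0 subrr.
    + by move=> r r1; apply: is_deriveB; exact: dP1.
    + by move=> r /andP[r0 _]; exact: ab.
have [a [ca Ta]] : exists x : R -> R, continuous x /\ T x = x.
  apply: (@weighted_contraction R (fun t => expR (k * `|t|)) T (fun=> 0)
    (`|a0| + `|b0| + `|Phi 0|)).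
  - move=> t; apply: (@continuous_comp _ _ _ (fun t => k * `|t|) expR); last exact: continuous_expR.
    by apply: continuousM; [exact: cvg_cst|exact: norm_continuous].
  - by move=> t; exact: expR_ge0.
  - exact: cst_continuous.
  - move=> x cx t.
    suff : {for t, continuous (fun t => a0 + b0 * `|t| + P2 x `|t|)} by [].
    apply: continuousD.
      apply: continuousD; first exact: cvg_cst.
      by apply: continuousM; [exact: cvg_cst|exact: norm_continuous].
    apply: (@continuous_comp _ _ _ (fun s : R => `|s|) (P2 x)); first exact: norm_continuous.
    by apply: is_derive_continuous (dP2 x _ cx _); apply: lt_le_trans half _.
  - by rewrite !addr_ge0.
  - move=> t; rewrite subr0 /T.
    have e1 : 1 <= expR (k * `|t|) by rewrite -expR0 ler_expR mulr_ge0// ltW.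
    have e2 : `|t| <= expR (k * `|t|).
      apply: le_trans (expR_ge1Dx _); apply: (@le_trans _ _ (k * `|t|)).
        by rewrite ler_peMl.
      by rewrite lerDr.
    have h : `|P2 (fun=> 0) `|t| | <= `|Phi 0| / k / k * expR (k * `|t|).
      apply: (@exp_growth (P2 (fun=> 0)) (P1 (fun=> 0)) (- (1 / 2))) => //.
      + exact: primitive0.
      + by move=> s s1; apply: dP2 => // ?; exact: cst_continuous.
      + move=> s /andP[s0 _].
        apply: (@exp_growth (P1 (fun=> 0)) (rhs (fun=> 0)) (-1)) => //.
        * exact: primitive0.
        * by move=> r r1; apply: dP1 => // ?; exact: cst_continuous.
        * move=> r /andP[r0 _]; rewrite /rhs ler_peMr// -expR0 ler_expR mulr_ge0//.
          exact: ltW.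
    have h' : `|Phi 0| / k / k <= `|Phi 0|.
      rewrite ler_pdivrMr// ler_pdivrMr// -mulrA ler_peMr//.
      by rewrite -[leLHS]mulr1 ler_pM.
    apply: le_trans (ler_normD _ _) _; apply: le_trans (lerD (ler_normD _ _) (lexx _)) _.
    rewrite mulrDl mulrDl; apply: lerD; first apply: lerD.
    + by rewrite ler_peMr.
    + by rewrite normrM normr_id ler_wpM2l.
    + by apply: le_trans h _; rewrite ler_wpM2r// expR_ge0.
  - move=> x y e cx cy xy t.
    have e0 : 0 <= e.
      by have := le_trans (normr_ge0 _) (xy 0); rewrite normr0 mulr0 expR0 mulr1.
    have -> : T x t - T y t = P2 x `|t| - P2 y `|t|.
      by rewrite /T; move: (P2 x _) (P2 y _) => u v; ring.
    apply: (@le_trans _ _ (L * e / k / k * expR (k * `|t|))).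
      apply: est => // s s0; rewrite /rhs; apply: le_trans (PhiL _ _) _.
      rewrite -mulrA ler_wpM2l//; apply: le_trans (xy _) _.
      by rewrite normr_id ger0_norm.
    rewrite ler_wpM2r ?expR_ge0// ler_pdivrMr// ler_pdivrMr//.
    rewrite (_ : e / 2 * k * k = e * (k * k / 2)); last by field.
    rewrite [leLHS]mulrC ler_wpM2l// ler_pdivlMr//.
    apply: (@le_trans _ _ k); first by rewrite /k; lra.
    by rewrite ler_peMl// ltW.
exists (fun t => a0 + b0 * t + P2 a t), (fun t => b0 + P1 a t), (rhs a); split.
- by rewrite /P2 primitive0 mulr0 !addr0.
- by rewrite /P1 primitive0 addr0.
- move=> t t1; have d2 := dP2 a t ca t1.
  by apply: is_derive_eq; rewrite !scaleRE; ring.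
- move=> t t1; have t2 : -1 < t by lra.
  have d1 := dP1 a t ca t2.
  have d0 := is_deriveD (is_derive_cst b0 t 1) d1.
  by apply: is_derive_eq d0 _; rewrite add0r.
- split; first exact: crhs.
  move=> t t0; rewrite /rhs -[in LHS]Ta /T normr_id ger0_norm//.
Qed.

Lemma first_zero f (t1 : R) : (forall t, 0 <= t -> {for t, continuous f}) ->
  0 < f 0 -> 0 <= t1 -> f t1 <= 0 ->
  exists T, [/\ 0 < T, T <= t1, f T = 0 & forall t, 0 <= t < T -> 0 < f t].
Proof.
move=> cf f0 t10 ft1.
pose S := [set t : R | 0 <= t <= t1 /\ f t <= 0].
have S1 : S t1 by rewrite /S/= t10 lexx.
have lbS : lbound S 0 by move=> t [/andP[]].
have iS : has_inf S by split; [exists t1|exists 0].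
pose T := inf S.
have T0 : 0 <= T by apply: lb_le_inf => //; exists t1.
have Tt1 : T <= t1 by apply: ge_inf S1; exists 0.
have below t : 0 <= t < T -> 0 < f t.
  move=> /andP[t0 tT]; rewrite ltNge; apply/negP => ft.
  have : T <= t.
    by apply: ge_inf; [exists 0|split => //; rewrite t0 (le_trans (ltW tT))].
  by rewrite leNgt tT.
have fT : f T = 0.
  apply/eqP; rewrite eq_le; apply/andP; split; rewrite leNgt; apply/negP => fT.
    have f20 : 0 < f T / 2 by rewrite divr_gt0.
    have [r r0 H] := (continuous_distP f T).1 (cf T T0) _ f20.
    have [s Ss sT] := inf_adherent r0 iS.
    have Ts : T <= s by apply: ge_inf Ss; exists 0.
    have := H s; rewrite ger0_norm ?subr_ge0//.
    rewrite ltrBlDl => /(_ sT); case: Ss => _ fs.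
    by rewrite ler_norml => /andP[]; lra.
  have f20 : 0 < - f T / 2 by rewrite divr_gt0// oppr_gt0.
  have [r r0 H] := (continuous_distP f T).1 (cf T T0) _ f20.
  have Tp : 0 < T.
    by rewrite lt_neqAle T0 andbT; apply/eqP => E; move: fT; rewrite -E; lra.
  pose t := T - Num.min (T / 2) (r / 2).
  have m1 : 0 < Num.min (T / 2) (r / 2) by rewrite lt_min !divr_gt0.
  have m2 : Num.min (T / 2) (r / 2) <= T / 2 by rewrite ge_min lexx.
  have m3 : Num.min (T / 2) (r / 2) <= r / 2 by rewrite ge_min lexx orbT.
  have tI : 0 <= t < T by rewrite /t; apply/andP; split; lra.
  have := H t; rewrite ltr0_norm ?subr_lt0; last by case/andP: tI.
  have h : - (t - T) < r by rewrite /t; lra.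
  move=> /(_ h); rewrite ler_norml => /andP[_ ?]; have := below t tI; lra.
have Tp : 0 < T.
  by rewrite lt_neqAle T0 andbT; apply/eqP => E; move: f0; rewrite [X in f X]E fT ltxx.
by exists T.
Qed.

(** Monotone either way, a power is at most the sum of its values at the ends; this avoids
distinguishing the sign of the exponent. *)
Lemma powR_le_ends (p m M x : R) : 0 < m -> m <= x <= M -> x `^ p <= m `^ p + M `^ p.
Proof.
move=> m0 /andP[mx xM]; have x0 := lt_le_trans m0 mx; have M0 := lt_le_trans x0 xM.
have [p0|p0] := leP 0 p.
  apply: ler_wpDl; first exact: powR_ge0.
  by apply: ge0_ler_powR; rewrite ?nnegrE// ltW.
apply: ler_wpDr; first exact: powR_ge0.
have [q pE] : exists q, p = - q by exists (- p); rewrite opprK.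
rewrite pE oppr_lt0 in p0.
rewrite pE !powRN lef_pV2 ?posrE ?powR_gt0//.
by apply: ge0_ler_powR; rewrite ?nnegrE// ltW.
Qed.

Lemma powR_lt_neg (p x y : R) : p < 0 -> 0 < x -> 0 < y -> x `^ p < y `^ p -> y < x.
Proof.
move=> p0 x0 y0 xy; rewrite ltNge; apply/negP => yx; move: xy.
rewrite ltNge => /negP; apply.
have [q pE] : exists q, p = - q by exists (- p); rewrite opprK.
rewrite pE oppr_lt0 in p0.
rewrite pE !powRN lef_pV2 ?posrE ?powR_gt0//.
by apply: ge0_ler_powR; rewrite ?nnegrE// ltW.
Qed.

Lemma powR_lipschitz (p m M x y : R) : 0 < m -> m <= x <= M -> m <= y <= M ->
  `|x `^ p - y `^ p| <= `|p| * ((m / 2) `^ (p - 1) + (M + 1) `^ (p - 1)) * `|x - y|.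
Proof.
move=> m0 /andP[x1 x2] /andP[y1 y2].
have := @derive_lipschitz R (fun x => x `^ p) (fun x => p * x `^ (p - 1)) (m / 2)
  (M + 1) (`|p| * ((m / 2) `^ (p - 1) + (M + 1) `^ (p - 1))) x y; apply.
- by move=> t /andP[t1 _]; apply: is_derive1_powR; apply: lt_trans t1; rewrite divr_gt0.
- move=> t /andP[t1 t2]; rewrite normrM ler_wpM2l// ger0_norm ?powR_ge0//.
  by apply: powR_le_ends; rewrite ?divr_gt0// !ltW.
- by apply/andP; split; lra.
- by apply/andP; split; lra.
Qed.

End ODE.

(** * The initial value problem for the scale factor *)

Section WithinSets.
Context {R : realType}.

Lemma starlike_convex {V : normedModType R} (A : set V) (c : V) (x : V) :
  nbhs c A -> A x ->
  (forall y z (t : R), A y -> A z -> 0 <= t <= 1 -> A (y + t *: (z - y))) ->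
  starlike A x.
Proof.
move=> /nbhs_distP[r r0 H] Ax cA; exists c, r; split => // v t vr t01.
by apply: cA => //; apply: H; rewrite addrC addKr.
Qed.

Lemma within_diff_continuous {V W : normedModType R} (A : set V) (f : V -> W) :
  within_differentiable A f -> {within A, continuous f}.
Proof.
move=> df; apply/subspace_continuousP => x Ax; rewrite /from_subspace.
have [cL E] := (within_diffP f Ax).1 (df x Ax).
pose L : {linear V -> W} := 'd f (within A (nbhs x)).
have {}E : within_expansion A f x L by exact: E.
have {}cL : continuous L by exact: cL.
have cLx : {for x, continuous (L \o (fun y => y - x))}.
  apply: continuous_comp; last exact: cL.
  by apply: continuousB; [exact: cvg_id|exact: cvg_cst].
apply/cvgrPdist_le => e e0; have e2 : 0 < e / 2 by rewrite divr_gt0.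
have n1 : \forall y \near x, `|L (y - x)| <= e / 2.
  move/cvgrPdist_le : cLx => /(_ _ e2); apply: filterS => y.
  by rewrite /= subrr linear0 sub0r normrN.
have n2 : nbhs x (fun y => A y -> `|f y - f x - L (y - x)| <= 1 * `|y - x|).
  exact: E ltr01.
have n3 : \forall y \near x, `|y - x| < e / 2 by apply/nbhs_distP; exists (e / 2).
suff : nbhs x (fun y => A y -> `|f x - f y| <= e) by [].
apply: filterS3 n1 n2 n3 => y h1 h2 h3 Ay; have {}h2 := h2 Ay.
rewrite distrC -(subrK (L (y - x)) (f y - f x)).
apply: le_trans (ler_normD _ _) _; lra.
Qed.

Lemma Ck_on_continuous {V W : normedModType R} k (A : set V) (f : V -> W) :
  Ck_on k A f -> {within A, continuous f}.
Proof. by case: k => [//|k] [df _]; exact: within_diff_continuous. Qed.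

End WithinSets.

Section IVP.
Context {R : realType}.
Implicit Types (t : R) (tau : \bar R).

Lemma Itau_next tau t : Itau tau t -> exists2 T, t < T & Itau tau T.
Proof.
move=> [t0]; case: tau => [r| |] //=.
  rewrite lte_fin => tr; exists ((t + r) / 2); first by lra.
  by split; [lra|rewrite lte_fin; lra].
by move=> _; exists (t + 1); [lra|split; [lra|rewrite ltry]].
Qed.

Lemma Itau_le tau t s : Itau tau t -> 0 <= s <= t -> Itau tau s.
Proof.
by move=> [t0 tt] /andP[s0 st]; split => //; apply: le_lt_trans tt; rewrite lee_fin.
Qed.

Lemma Itau_nbhs tau t : Itau tau t -> 0 < t -> nbhs t (Itau tau).
Proof.
move=> It t0; have [T tT IT] := Itau_next It.
have h : \forall s \near t, 0 < s < T.
  by near=> s; apply/andP; split; near: s; [exact: lt_nbhsr|exact: lt_nbhsl].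
apply: filterS h => s /andP[s0 sT]; apply: Itau_le IT _.
by rewrite (ltW s0) ltW.
Unshelve. all: by end_near. Qed.

Lemma Itau_convex tau (y z t : R) : Itau tau y -> Itau tau z -> 0 <= t <= 1 ->
  Itau tau (y + t *: (z - y)).
Proof.
move=> Iy Iz /andP[t0 t1]; rewrite scaleRE.
have [y0 _] := Iy; have [z0 _] := Iz.
have [yz|/ltW zy] := leP y z.
  by apply: Itau_le Iz _; apply/andP; split; nra.
by apply: Itau_le Iy _; apply/andP; split; nra.
Qed.

(** The left end 0 is a genuine boundary point, where derivatives are one-sided. *)
Lemma Itau_starlike tau t : (0 < tau)%E -> Itau tau t -> starlike (Itau tau) t.
Proof.
move=> tau0 It; have I0 : Itau tau 0 by [].
have [T T0 IT] := Itau_next I0.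
apply: (@starlike_convex R R (Itau tau) T) => //; first exact: Itau_nbhs.
by move=> y z s; exact: Itau_convex.
Qed.

(** A solution extended to t > -1/2 with ordinary derivatives [b1] and [b2], the differential
equation being required on [0, tau) only. *)
Definition twosided_solution (mu h a0 b0 : R) tau (b b1 b2 : R -> R) :=
  [/\ (0 < tau)%E, b 0 = a0 /\ b1 0 = b0,
    forall t, - (1 / 2) < t -> is_derive t 1 b (b1 t) /\ is_derive t 1 b1 (b2 t),
    continuous b2 &
    forall t, Itau tau t -> 0 < b t /\ b2 t = mu * b t `^ (h - 1)].

Let U : set R := [set t | - (1 / 2) < t].

Lemma open_start : open U. Proof. exact: open_gt. Qed.

Lemma deriv_on1E {W : normedModType R} (A : set R) (f g g1 : R -> W) :
  (forall t, A t -> starlike A t) -> (forall t, A t -> f t = g t) ->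
  (forall t, A t -> is_derive t 1 g (g1 t)) ->
  forall t, A t -> deriv_on 1 A f t = g1 t.
Proof.
move=> sA fg dg t At; have [dgt gE] := dg t At.
have dg' : differentiable g t by apply/derivable1_diffP.
have [_ E] := diff_on_ext At (sA t At) fg dg'.
by rewrite /deriv_on /= E -deriveE.
Qed.

Lemma deriv_on2E {W : normedModType R} (A : set R) (f g g1 g2 : R -> W) :
  (forall t, A t -> starlike A t) -> (forall t, A t -> f t = g t) ->
  (forall t, A t -> is_derive t 1 g (g1 t)) ->
  (forall t, A t -> is_derive t 1 g1 (g2 t)) ->
  forall t, A t -> deriv_on 2 A f t = g2 t.
Proof.
move=> sA fg dg dg1 t At.
exact: (deriv_on1E sA (deriv_on1E sA fg dg) dg1 At).
Qed.

Lemma twosided_Ck mu h a0 b0 tau b b1 b2 :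
  twosided_solution mu h a0 b0 tau b b1 b2 -> Ck 2 U b.
Proof.
move=> [_ _ db cb2 _]; apply: (Ck_derive open_start (f' := b1)) => [t /db[]//|].
by apply: (Ck_derive open_start (f' := b2)) => [t /db[]//|t _]; exact: cb2.
Qed.

Lemma Itau_start tau t : Itau tau t -> U t.
Proof. by move=> [t0 _]; rewrite /U/=; lra. Qed.

Lemma twosided_ivp mu h a0 b0 tau b b1 b2 :
  twosided_solution mu h a0 b0 tau b b1 b2 -> ivp_solution mu h a0 b0 tau b.
Proof.
move=> gb; have [tau0 [b00 b10] db _ bE] := gb.
have sA t : Itau tau t -> starlike (Itau tau) t by exact: Itau_starlike.
have d1 t : Itau tau t -> is_derive t 1 b (b1 t) by move=> /Itau_start/db[].
have d2 t : Itau tau t -> is_derive t 1 b1 (b2 t) by move=> /Itau_start/db[].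
have fg t : Itau tau t -> b t = b t by [].
split => //.
- exact: (Ck_on_of_Ck open_start (@Itau_start tau) sA fg (twosided_Ck gb)).
- by move=> t /bE[].
- by move=> t It; rewrite (deriv_on2E sA fg d1 d2 It); have [] := bE t It.
- by split => //; rewrite (deriv_on1E sA fg d1).
Qed.

(** The squared distance in phase space, damped by exp(- (L + 1) t), is nonincreasing. *)
Lemma second_order_unique (T L : R) (a a1 a2 b b1 b2 : R -> R) : 0 < T -> 0 <= L ->
  (forall s : R, 0 < s < T -> is_derive s 1 a (a1 s)) ->
  (forall s : R, 0 < s < T -> is_derive s 1 a1 (a2 s)) ->
  (forall s : R, 0 < s < T -> is_derive s 1 b (b1 s)) ->
  (forall s : R, 0 < s < T -> is_derive s 1 b1 (b2 s)) ->
  {within `[0, T], continuous a} -> {within `[0, T], continuous a1} ->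
  {within `[0, T], continuous b} -> {within `[0, T], continuous b1} ->
  (forall s : R, 0 < s < T -> `|a2 s - b2 s| <= L * `|a s - b s|) ->
  a 0 = b 0 -> a1 0 = b1 0 -> a T = b T.
Proof.
move=> T0 L0 da da1 db db1 ca ca1 cb cb1 lip ab0 ab10.
pose N s := ((a s - b s) ^+ 2 + (a1 s - b1 s) ^+ 2) * expR (- (L + 1) * s).
pose N1 s := (2 * (a s - b s) * (a1 s - b1 s) + 2 * (a1 s - b1 s) * (a2 s - b2 s)
   - (L + 1) * ((a s - b s) ^+ 2 + (a1 s - b1 s) ^+ 2)) * expR (- (L + 1) * s).
have dN (s : R) : 0 < s < T -> is_derive s 1 N (N1 s).
  move=> sI.
  have d1 := is_deriveB (da s sI) (db s sI); have d2 := is_deriveB (da1 s sI) (db1 s sI).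
  have d3 := is_deriveD (is_deriveM d1 d1) (is_deriveM d2 d2).
  have d4 : is_derive s 1 (fun s => - (L + 1) * s) (- (L + 1)).
    by apply: is_derive_eq; rewrite scaleRE mulr1.
  have d5 := @is_derive1_comp R expR (fun s => - (L + 1) * s) s _ _ (is_derive_expR _) d4.
  have d6 := is_deriveM d3 d5.
  have -> : N = (((a - b) * (a - b) + (a1 - b1) * (a1 - b1)) *
      (expR \o (fun s => - (L + 1) * s))).
    by apply/funext => x; rewrite /N !expr2.
  by apply: is_derive_eq d6 _; rewrite !scaleRE /N1 !fctE /=; ring.
have cN : {within `[0, T], continuous N}.
  rewrite continuous_subspace_in => s sI.
  apply: cvgM; last first.
    have : {for s, continuous (fun s => expR (- (L + 1) * s))}.
      apply: (@continuous_comp _ _ _ (fun s => - (L + 1) * s) expR); last exact: continuous_expR.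
      by apply: continuousM; [exact: cvg_cst|exact: cvg_id].
    by apply: continuous_subspaceT_for; rewrite inE in sI.
  apply: cvgD; rewrite !expr2.
    by apply: cvgM; (apply: cvgB; [exact: ca|exact: cb]).
  by apply: cvgM; (apply: cvgB; [exact: ca1|exact: cb1]).
have : N T <= N 0.
  apply: (@ler0_derive1_le_cc R N 0 T) => //; rewrite ?in_itv/= ?lexx ?ltW//.
  - by move=> s; rewrite in_itv/= => /dN[].
  - move=> s; rewrite in_itv/= => sI; have [_ dE] := dN s sI.
    rewrite derive1E dE /N1 pmulr_lle0 ?expR_gt0//.
    have := lip s sI; move: (a s - b s) (a1 s - b1 s) (a2 s - b2 s) => x y z zL.
    have h1 : 2 * x * y <= x ^+ 2 + y ^+ 2 by have := sqr_ge0 (x - y); rewrite !expr2; lra.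
    have h2 : 2 * y * z <= L * (x ^+ 2 + y ^+ 2).
      apply: le_trans (ler_norm _) _; rewrite !normrM ger0_norm//.
      apply: (@le_trans _ _ (2 * `|y| * (L * `|x|))).
        by rewrite ler_wpM2l// mulr_ge0.
      rewrite (_ : _ * (L * _) = L * (2 * `|y| * `|x|)); last by ring.
      rewrite ler_wpM2l// -(real_normK (num_real x)) -(real_normK (num_real y)).
      by have := sqr_ge0 (`|x| - `|y|); rewrite !expr2; lra.
    lra.
rewrite {2}/N ab0 ab10 !subrr expr0n/= addr0 mul0r => NT.
have := expR_gt0 (- (L + 1) * T) => e0.
move: NT; rewrite /N pmulr_lle0// => NT.
have h1 := sqr_ge0 (a T - b T); have h2 := sqr_ge0 (a1 T - b1 T).
have : (a T - b T) ^+ 2 = 0 by lra.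
by move/eqP; rewrite expf_eq0/= subr_eq0 => /eqP.
Qed.

(** On a compact interval both solutions lie between positive constants, where the power is
Lipschitz. *)
Lemma ivp_unique mu h a0 b0 tau tau' a b b1 b2 :
  ivp_solution mu h a0 b0 tau a -> twosided_solution mu h a0 b0 tau' b b1 b2 ->
  forall t, Itau tau t -> Itau tau' t -> a t = b t.
Proof.
move=> [tau0 Ca a_gt0 aE [a00 a10]] [tau'0 [b00 b10] db cb2 bE] T IT IT'.
have [T0 _] := IT; move: T0; rewrite le_eqVlt => /predU1P[<-|T0].
  by rewrite a00 b00.
have [wda Ca1] := Ca; pose a1 := deriv_on 1 (Itau tau) a.
have {}Ca1 : Ck_on 1 (Itau tau) a1 := Ca1 1.
pose a2 := deriv_on 2 (Itau tau) a.
have sub : `[0, T] `<=` Itau tau.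
  by move=> s; rewrite /= in_itv/=; exact: Itau_le.
have ca : {within `[0, T], continuous a}.
  exact: continuous_subspaceW sub (Ck_on_continuous Ca).
have ca1 : {within `[0, T], continuous a1}.
  exact: continuous_subspaceW sub (Ck_on_continuous Ca1).
have da (s : R) : 0 < s < T -> is_derive s 1 a (a1 s).
  move=> /andP[s0 sT]; have Is : Itau tau s by apply: Itau_le IT _; rewrite (ltW s0) ltW.
  have [d E] := diff_on_interior Is (Itau_nbhs Is s0) (wda s Is).
  by split; [apply/derivable1_diffP|rewrite deriveE// E].
have da1 (s : R) : 0 < s < T -> is_derive s 1 a1 (a2 s).
  move=> /andP[s0 sT]; have Is : Itau tau s by apply: Itau_le IT _; rewrite (ltW s0) ltW.
  have [wda1 _] := Ca1.
  have [d E] := diff_on_interior Is (Itau_nbhs Is s0) (wda1 s Is).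
  by split; [apply/derivable1_diffP|rewrite deriveE// E].
have UT (s : R) : 0 <= s -> - (1 / 2) < s by lra.
have cb : {within `[0, T], continuous b}.
  apply: within_itv_continuous => s /andP[s0 _].
  by have [d _] := db s (UT s s0); exact: is_derive_continuous d.
have cb1 : {within `[0, T], continuous b1}.
  apply: within_itv_continuous => s /andP[s0 _].
  by have [_ d] := db s (UT s s0); exact: is_derive_continuous d.
have [x1 x1I m1] := EVT_min (ltW T0) ca.
have [x2 x2I M1] := EVT_max (ltW T0) ca.
have [x3 x3I m2] := EVT_min (ltW T0) cb.
have [x4 x4I M2] := EVT_max (ltW T0) cb.
pose m := Num.min (a x1) (b x3); pose MM := Num.max (a x2) (b x4).
have m0 : 0 < m.
  rewrite lt_min; apply/andP; split; first by apply: a_gt0; exact: sub.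
  have [] // := bE x3 _; apply: Itau_le IT' _.
  by move: x3I; rewrite in_itv.
have [L [L0 lip]] : exists L : R, 0 <= L /\
    forall s : R, 0 < s < T -> `|a2 s - b2 s| <= L * `|a s - b s|.
  (* The margins m / 2 and MM + 1 make room for the open interval of the mean value theorem. *)
  exists (`|mu| * (`|h - 1| * ((m / 2) `^ (h - 1 - 1) + (MM + 1) `^ (h - 1 - 1)))).
  split; first by rewrite !mulr_ge0// addr_ge0 ?powR_ge0.
  move=> s /andP[s0 sT]; have sI : s \in `[0, T] by rewrite in_itv/= (ltW s0) ltW.
  have Is : Itau tau s by exact: sub.
  have Is' : Itau tau' s by apply: Itau_le IT' _; rewrite (ltW s0) ltW.
  rewrite /a2 aE//; have [_ ->] := bE s Is'.
  rewrite -mulrBr normrM -mulrA ler_wpM2l//.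
  apply: powR_lipschitz => //.
    by rewrite ge_min le_max m1// M1.
  by rewrite ge_min le_max m2// M2 ?orbT.
apply: (@second_order_unique T L a a1 a2 b b1 b2) => //.
- by move=> s /andP[s0 _]; have [] := db s (UT s (ltW s0)).
- by move=> s /andP[s0 _]; have [] := db s (UT s (ltW s0)).
- by rewrite a00 b00.
- by rewrite b10; exact: a10.
Qed.

End IVP.

(** * Energy, expansion and collapse *)

Section Existence.
Context {R : realType}.
Implicit Types (t : R).

Lemma powR_antitone (p m x : R) : p <= 0 -> 0 < m -> m <= x -> x `^ p <= m `^ p.
Proof.
move=> p0 m0 mx; have x0 := lt_le_trans m0 mx.
have [q pE] : exists q, p = - q by exists (- p); rewrite opprK.
rewrite pE oppr_le0 in p0.
rewrite pE !powRN lef_pV2 ?posrE ?powR_gt0//.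
by apply: ge0_ler_powR; rewrite ?nnegrE// ltW.
Qed.

Lemma powR_surj (h y : R) : h != 0 -> 0 < y -> exists2 c, 0 < c & c `^ h = y.
Proof.
move=> h0 y0; exists (y `^ h^-1); first exact: powR_gt0.
by rewrite -powRrM mulVf// powRr1// ltW.
Qed.

Section Sol.
Variables (mu h : R) (b b1 b2 : R -> R).
Hypothesis h_neq0 : h != 0.
Hypothesis db : forall t, - (1 / 2) < t -> is_derive t 1 b (b1 t).
Hypothesis db1 : forall t, - (1 / 2) < t -> is_derive t 1 b1 (b2 t).

Let half t : 0 <= t -> - (1 / 2) < t.
Proof. by lra. Qed.

Lemma two_sided_continuous t : 0 <= t -> {for t, continuous b}.
Proof. by move=> /half t0; exact: is_derive_continuous (db t0). Qed.

Lemma energy_conservation (T : R) : 0 <= T ->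
  (forall t, 0 <= t <= T -> 0 < b t /\ b2 t = mu * b t `^ (h - 1)) ->
  energy0 mu h (b T) (b1 T) = energy0 mu h (b 0) (b1 0).
Proof.
move=> T0 eqn.
pose e s := 1 / 2 * b1 s ^+ 2 - mu / h * b s `^ h.
have de (s : R) : 0 <= s <= T -> is_derive s 1 e 0.
  move=> sI; have [bs b2E] := eqn s sI; have /andP[s0 _] := sI.
  have d1 := db1 (half s0); have d0 := db (half s0).
  have d2 := @is_derive1_comp R (fun x : R => x `^ h) b s _ _ (@is_derive1_powR R h _ bs) d0.
  have d3 := is_deriveB (is_deriveZ (1 / 2) (is_deriveM d1 d1)) (is_deriveZ (mu / h) d2).
  have -> : e = (1 / 2) \*: (b1 * b1) - (mu / h) \*: ((fun x : R => x `^ h) \o b).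
    by apply/funext => x; rewrite /e expr2.
  apply: is_derive_eq d3 _; rewrite !scaleRE b2E.
  by field.
have [||t _] := @MVT_segment R e (fun=> 0) 0 T T0.
- by move=> t; rewrite in_itv/= => /andP[t0 tT]; apply: de; rewrite (ltW t0) ltW.
- by apply: within_itv_continuous => t tI; exact: is_derive_continuous (de t tI).
by rewrite mul0r /e /energy0 => /eqP; rewrite subr_eq0 => /eqP.
Qed.

End Sol.

(** The power is frozen below a level [c] whose potential energy exceeds the total energy, so
the solution of the modified equation never reaches [c]. *)
Lemma ivp_expanding (mu h a0 b0 : R) : h < 0 -> 0 < mu -> 0 < a0 ->
  exists b b1 b2 : R -> R, twosided_solution mu h a0 b0 +oo%E b b1 b2.
Proof.
move=> h0 mu0 a00; have hn0 : h != 0 by rewrite lt_eqF.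
pose E0 := energy0 mu h a0 b0.
have kp : 0 < - (mu / h) by rewrite -mulrN -invrN divr_gt0// oppr_gt0.
have E0ge : - (mu / h) * a0 `^ h <= E0.
  by rewrite /E0 /energy0 mulNr lerDr mulr_ge0// sqr_ge0.
have E0p : 0 < E0 by apply: lt_le_trans E0ge; rewrite mulr_gt0// powR_gt0.
pose K := E0 / - (mu / h).
have K0 : 0 < K by rewrite divr_gt0.
have K10 : 0 < K + 1 by rewrite addr_gt0.
have [c c0 ch] := powR_surj hn0 K10.
have cE : E0 < - (mu / h) * c `^ h.
  by rewrite ch -ltr_pdivrMl// mulrC ltrDl ltr01.
have ca0 : c < a0.
  apply: (powR_lt_neg h0 a00 c0); rewrite ch.
  apply: (@le_lt_trans _ _ K); last by rewrite ltrDl ltr01.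
  by rewrite /K ler_pdivlMr// mulrC.
pose Phi x := mu * (Num.max c x) `^ (h - 1).
have PhiL x y : `|Phi x - Phi y| <= mu * (`|h - 1| * (c / 2) `^ (h - 1 - 1)) * `|x - y|.
  rewrite /Phi -mulrBr normrM gtr0_norm// -mulrA ler_wpM2l ?(ltW mu0)//.
  set u := Num.max c x; set v := Num.max c y.
  have cu : c <= u by rewrite le_max lexx.
  have cv : c <= v by rewrite le_max lexx.
  apply: (@le_trans _ _ (`|h - 1| * (c / 2) `^ (h - 1 - 1) * `|u - v|)).
    have := @derive_lipschitz R (fun x => x `^ (h - 1)) (fun x => (h - 1) * x `^ (h - 1 - 1))
      (c / 2) (Num.max u v + 1) (`|h - 1| * (c / 2) `^ (h - 1 - 1)) u v; apply.
    - move=> t /andP[t1 _]; apply: is_derive1_powR; apply: lt_trans t1.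
      by rewrite divr_gt0.
    - move=> t /andP[t1 _]; rewrite normrM ler_wpM2l// ger0_norm ?powR_ge0//.
      by apply: powR_antitone; [lra|rewrite divr_gt0|exact: ltW].
    - apply/andP; split; first by lra.
      by apply: (@le_lt_trans _ _ (Num.max u v)); [rewrite le_max lexx|rewrite ltrDl ltr01].
    - apply/andP; split; first by lra.
      by apply: (@le_lt_trans _ _ (Num.max u v)); [rewrite le_max lexx orbT|rewrite ltrDl ltr01].
  rewrite ler_wpM2l ?mulr_ge0 ?powR_ge0// /u /v.
  rewrite /Num.max; do !case: ifPn; rewrite -?leNgt => *;
    apply/ler_normlP; split; have := ler_norm (x - y);
    have := ler_norm (y - x); rewrite distrC; lra.
have [|b [b1 [b2 [b00 b10 db db1 [cb2 b2E]]]]] := lipschitz_ode a0 b0 _ PhiL.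
  by rewrite mulr_ge0 ?(ltW mu0)// mulr_ge0 ?powR_ge0.
have cb t : 0 <= t -> {for t, continuous b} by move=> t0; exact: (two_sided_continuous db t0).
have above t : 0 <= t -> c < b t.
  move=> t0; rewrite ltNge; apply/negP => btc.
  have [|||T [T0 _ fT Tpos]] := @first_zero R (fun t => b t - c) t _ _ t0.
  - by move=> s s0; apply: continuousB; [exact: cb|exact: cvg_cst].
  - by rewrite b00 subr_gt0.
  - by rewrite subr_le0.
  have bT : b T = c by apply/eqP; rewrite -subr_eq0 fT.
  have := @energy_conservation mu h b b1 b2 hn0 db db1 T (ltW T0).
  have eqn s : 0 <= s <= T -> 0 < b s /\ b2 s = mu * b s `^ (h - 1).
    move=> /andP[s0 sT].
    have cs : c <= b s.
      move: sT; rewrite le_eqVlt => /predU1P[->|sT]; first by rewrite bT.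
      by have := Tpos s; rewrite s0 sT subr_gt0 => /(_ isT)/ltW.
    by split; [exact: lt_le_trans cs|rewrite b2E// /Phi max_r].
  move=> /(_ eqn); rewrite b00 b10 -/E0 bT /energy0 => EE.
  have : - (mu / h) * c `^ h <= E0.
    by rewrite -EE mulNr lerDr mulr_ge0// sqr_ge0.
  by rewrite leNgt cE.
exists b, b1, b2; split => //.
- by move=> t t1; split; [exact: db|exact: db1].
- move=> t [t0 _]; have ct := above t t0; split; first exact: lt_trans ct.
  by rewrite b2E// /Phi max_r// ltW.
Qed.

Lemma velocity_nondecreasing (b1 b2 : R -> R) (s t : R) :
  (forall t, - (1 / 2) < t -> is_derive t 1 b1 (b2 t)) ->
  (forall t, 0 <= t -> 0 <= b2 t) -> 0 <= s -> s <= t -> b1 s <= b1 t.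
Proof.
move=> d p s0 st; have s1 : - (1 / 2) < s by lra.
have [x /andP[x0 xt] E] := mvt_on d s1 st.
by rewrite -subr_ge0 E mulr_ge0 ?subr_ge0// p// (le_trans s0).
Qed.

(** The velocity increases and stays below S = (2 E)^(1/2). If it stayed below S - e / 2, energy
would bound a(t), hence bound the acceleration from below, a contradiction; so
a(t) exceeds (S - e / 2) (t - t1) from some time t1 on. *)
Lemma expanding_asymptotics (mu h a0 b0 : R) (b b1 b2 : R -> R) :
  h < 0 -> 0 < mu -> 0 < a0 -> twosided_solution mu h a0 b0 +oo%E b b1 b2 ->
  let S := Num.sqrt (2 * energy0 mu h a0 b0) in
  (forall t, 0 < t -> 0 < S - (b t - a0) / t) /\
  (S - b t / t @[t --> +oo] --> 0).
Proof.
move=> h0 mu0 a00 [_ [b00 b10] dbb cb2 bE] S.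
have hn0 : h != 0 by rewrite lt_eqF.
have db t : - (1 / 2) < t -> is_derive t 1 b (b1 t) by move=> /dbb[].
have db1 t : - (1 / 2) < t -> is_derive t 1 b1 (b2 t) by move=> /dbb[].
have Iy t : 0 <= t -> Itau +oo%E t by move=> t0; split => //; rewrite ltry.
have kp : 0 < - (mu / h) by rewrite -mulrN -invrN divr_gt0// oppr_gt0.
set E0 := energy0 mu h a0 b0 in S *.
have en t : 0 <= t -> 1 / 2 * b1 t ^+ 2 + - (mu / h) * b t `^ h = E0.
  move=> t0; rewrite /E0 -b00 -b10 mulNr.
  apply: (energy_conservation hn0 db db1 t0) => s /andP[s0 _]; exact: bE (Iy s s0).
have bp t : 0 <= t -> 0 < b t by move=> /Iy/bE[].
have E0p : 0 < E0.
  have p : 0 < - (mu / h) * b 0 `^ h by apply: mulr_gt0 => //; apply: powR_gt0; exact: bp.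
  have := en 0 (lexx 0); have := sqr_ge0 (b1 0); lra.
have S0 : 0 < S by rewrite sqrtr_gt0 mulr_gt0.
have S2 : S ^+ 2 = 2 * E0 by rewrite sqr_sqrtr// mulr_ge0// ltW.
have b1S t : 0 <= t -> `|b1 t| < S.
  move=> t0; have := en t t0; have : 0 < - (mu / h) * b t `^ h.
    by apply: mulr_gt0 => //; apply: powR_gt0; exact: bp.
  move=> p e; rewrite -[ltRHS]gtr0_norm// -ltr_sqr ?nnegrE//.
  by rewrite !real_normK ?num_real// S2; lra.
have b2p t : 0 <= t -> 0 <= b2 t.
  move=> t0; have [_ ->] := bE t (Iy t t0).
  by rewrite mulr_ge0 ?powR_ge0// ltW.
have half : - (1 / 2) < 0 :> R by lra.
have upper t : 0 < t -> b t - a0 < S * t.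
  move=> t0; have [x /andP[x0 _] E] := mvt_on db half (ltW t0).
  rewrite -b00 E subr0 ltr_pM2r//; apply: le_lt_trans (ler_norm _) _.
  exact: b1S.
split.
  by move=> t t0; rewrite subr_gt0 ltr_pdivrMr//; exact: upper.
apply/cvgrPdist_le => e e0.
have e2 : 0 < e / 2 by rewrite divr_gt0.
have [t1 [t10 b1t1]] : exists t1, 0 <= t1 /\ S - e / 2 <= b1 t1.
  apply: contrapT => H.
  have lt_all t : 0 <= t -> b1 t < S - e / 2.
    by move=> t0; rewrite ltNge; apply/negP => l; apply: H; exists t.
  have b0S : - S < b0.
    by have := b1S 0 (lexx 0); rewrite b10 ltr_norml => /andP[].
  (* The velocity is increasing, so it also stays above its initial value, which exceeds - S. *)
  pose d := Num.min (e / 2) (S + b0).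
  have d0 : 0 < d by rewrite lt_min e2; lra.
  have d1 : d <= e / 2 by rewrite ge_min lexx.
  have d2 : d <= S + b0 by rewrite ge_min lexx orbT.
  have bd t : 0 <= t -> `|b1 t| <= S - d.
    move=> t0; rewrite ler_norml; apply/andP; split; last by have := lt_all t t0; lra.
    have := velocity_nondecreasing db1 b2p (lexx 0) t0; rewrite b10; lra.
  have Sd : 0 <= S - d by apply: le_trans (bd 0 (lexx 0)).
  pose q := d * (2 * S - d) / 4 / - (mu / h).
  have q0 : 0 < q by rewrite !divr_gt0// mulr_gt0//; lra.
  have [B B0 BE] := powR_surj hn0 q0.
  have bB t : 0 <= t -> b t < B.
    move=> t0; apply: (powR_lt_neg h0 B0 (bp t t0)); rewrite BE.
    rewrite /q ltr_pdivrMr// [ltRHS]mulrC.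
    have := en t t0; have := bd t t0 => bt ent.
    have : b1 t ^+ 2 <= (S - d) ^+ 2.
      by rewrite -[X in X <= _]real_normK ?num_real// ler_sqr ?nnegrE.
    have p1 : 0 < d * (2 * S - d) by rewrite mulr_gt0//; lra.
    have : (S - d) ^+ 2 = S ^+ 2 - d * (2 * S - d) by ring.
    rewrite S2 => -> ?; lra.
  pose k := mu * B `^ (h - 1).
  have k0 : 0 < k by rewrite mulr_gt0// powR_gt0.
  have b2k t : 0 <= t -> k <= b2 t.
    move=> t0; have [bt ->] := bE t (Iy t t0).
    rewrite ler_wpM2l ?(ltW mu0)//; apply: powR_antitone => //; first by lra.
    exact: ltW (bB t t0).
  pose t := (S - b0) / k.
  have t0 : 0 <= t.
    rewrite divr_ge0 ?(ltW k0)// subr_ge0.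
    by have := b1S 0 (lexx 0); rewrite b10 ltr_norml => /andP[_ /ltW].
  have [x /andP[x0 _] E] := mvt_on db1 half t0.
  have := lt_all t t0.
  have : S - b0 <= b1 t - b0.
    rewrite -{2}b10 E subr0 /t -{1}(divfK (lt0r_neq0 k0) (S - b0)) mulrC ler_wpM2r//.
    exact: b2k.
  lra.
pose A := Num.max (a0 / e) (2 * `|S - e / 2| * t1 / e).
have lower t : t1 <= t -> (S - e / 2) * (t - t1) <= b t.
  move=> tt; have ht1 : - (1 / 2) < t1 by lra.
  have [x /andP[x0 _] E] := mvt_on db ht1 tt.
  apply: (@le_trans _ _ (b t - b t1)); last by rewrite gerBl ltW// bp.
  rewrite E ler_wpM2r ?subr_ge0//; apply: le_trans b1t1 _.
  exact: velocity_nondecreasing db1 b2p t10 x0.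
near=> t.
have tp : 0 < t by near: t; apply: nbhs_pinfty_gt; exact: num_real.
have t1t : t1 <= t by near: t; apply: nbhs_pinfty_ge; exact: num_real.
have tA : A <= t by near: t; apply: nbhs_pinfty_ge; exact: num_real.
have tA1 : a0 <= e * t.
  by rewrite mulrC -ler_pdivrMr//; apply: le_trans tA; rewrite le_max lexx.
have tA2 : 2 * `|S - e / 2| * t1 <= e * t.
  by rewrite mulrC [leRHS]mulrC mulrC -ler_pdivrMr//; apply: le_trans tA; rewrite le_max lexx orbT.
have up := upper t tp; have lo := lower t t1t.
rewrite sub0r normrN ler_norml; apply/andP; split.
  by rewrite lerBrDl -lerBrDr opprK ler_pdivrMr//; lra.
rewrite lerBlDr -lerBlDl ler_pdivlMr//.
have n := ler_norm (S - e / 2).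
have : (S - e / 2) * t1 <= `|S - e / 2| * t1 by rewrite ler_wpM2r.
have tA3 : 2 * (`|S - e / 2| * t1) <= e * t by rewrite mulrA.
by move: (`|S - e / 2| * t1) tA3 => y; lra.
Unshelve. all: by end_near. Qed.

Lemma powR_lipschitz0 (p K x y : R) : 1 <= p -> 0 < K -> 0 <= x <= K -> 0 <= y <= K ->
  `|x `^ p - y `^ p| <= p * (K + 1) `^ (p - 1) * `|x - y|.
Proof.
move=> p1 K0.
have pn0 : p != 0 by rewrite gt_eqF// (lt_le_trans ltr01).
have p0 : 0 <= p by apply: le_trans p1.
have zero (z : R) : 0 < z <= K -> `|z `^ p| <= p * (K + 1) `^ (p - 1) * z.
  move=> /andP[z0 zK]; rewrite ger0_norm ?powR_ge0//.
  rewrite -(@mulr_powRB1 _ z p (ltW z0)) ?(lt_le_trans ltr01 p1)// mulrC ler_wpM2r ?(ltW z0)//.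
  apply: (@le_trans _ _ ((K + 1) `^ (p - 1))); last by rewrite ler_peMl ?powR_ge0.
  by apply: ge0_ler_powR; rewrite ?nnegrE; lra.
move=> /andP[x0 xK] /andP[y0 yK].
have pos (z : R) : 0 <= z -> 0 = z \/ 0 < z by rewrite le_eqVlt => /predU1P.
have [<-|{}x0] := pos x x0; have [<-|{}y0] := pos y y0.
- by rewrite !subrr normr0 mulr0.
- rewrite powR0// !sub0r !normrN [X in _ * X]gtr0_norm//.
  by apply: zero; rewrite y0.
- rewrite powR0// !subr0 [X in _ * X]gtr0_norm//.
  by apply: zero; rewrite x0.
have := @derive_lipschitz R (fun x => x `^ p) (fun x => p * x `^ (p - 1)) 0
  (K + 1) (p * (K + 1) `^ (p - 1)) x y; apply.
- by move=> t /andP[t1 _]; exact: is_derive1_powR.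
- move=> t /andP[t1 t2]; rewrite normrM (ger0_norm p0) ler_wpM2l// ger0_norm ?powR_ge0//.
  by apply: ge0_ler_powR; rewrite ?nnegrE; lra.
- by apply/andP; split; lra.
- by apply/andP; split; lra.
Qed.

(** The energy bounds a(t) by [K] as long as it is positive, so freezing the power above [K] and
below 0 is harmless up to the first zero. There is one: a concave positive function on the
half-line is nondecreasing, so the acceleration would stay below a negative constant. *)
Lemma ivp_collapsing (mu h a0 b0 : R) : 3 < h -> mu < 0 -> 0 < a0 ->
  exists (T : R) (b b1 b2 : R -> R),
    twosided_solution mu h a0 b0 T%:E b b1 b2 /\ b T = 0.
Proof.
move=> h3 mu0 a00; have hp : 0 < h by lra.
have hn0 : h != 0 by rewrite gt_eqF.
pose E0 := energy0 mu h a0 b0.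
have kp : 0 < - (mu / h) by rewrite -mulNr divr_gt0// oppr_gt0.
have E0p : 0 <= E0.
  have h1 : 0 <= - (mu / h) * a0 `^ h by rewrite mulr_ge0 ?(ltW kp)// powR_ge0.
  have h2 := sqr_ge0 b0; rewrite /E0 /energy0; lra.
have Kp : 0 < E0 / - (mu / h) + 1.
  by apply: ltr_wpDl; [rewrite divr_ge0// (ltW kp)|exact: ltr01].
have [c c0 ch] := powR_surj hn0 Kp.
pose K := a0 + c.
have K0 : 0 < K by rewrite addr_gt0.
have a0K : a0 < K by rewrite ltrDl.
have KE : E0 < - (mu / h) * K `^ h.
  apply: (@lt_le_trans _ _ (- (mu / h) * c `^ h)).
    by rewrite ch -ltr_pdivrMl// mulrC ltrDl ltr01.
  rewrite ler_wpM2l ?(ltW kp)//; apply: ge0_ler_powR; rewrite ?nnegrE ?(ltW hp) ?(ltW c0) ?(ltW K0)//.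
  by rewrite lerDr ltW.
pose Phi x := mu * (clamp 0 K x) `^ (h - 1).
have PhiL x y : `|Phi x - Phi y| <= `|mu| * ((h - 1) * (K + 1) `^ (h - 1 - 1)) * `|x - y|.
  rewrite /Phi -mulrBr normrM -mulrA ler_wpM2l//.
  apply: (@le_trans _ _ ((h - 1) * (K + 1) `^ (h - 1 - 1) * `|clamp 0 K x - clamp 0 K y|)).
    by apply: powR_lipschitz0 => //; [lra|apply: clamp_itv; exact: ltW|apply: clamp_itv; exact: ltW].
  rewrite ler_wpM2l ?mulr_ge0 ?powR_ge0//; first by lra.
  exact: clamp_lipschitz.
have [|b [b1 [b2 [b00 b10 db db1 [cb2 b2E]]]]] := lipschitz_ode a0 b0 _ PhiL.
  by rewrite !mulr_ge0 ?powR_ge0//; lra.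
have cb t : 0 <= t -> {for t, continuous b} by move=> t0; exact: (two_sided_continuous db t0).
have b2E' t : 0 <= t -> 0 <= b t <= K -> b2 t = mu * b t `^ (h - 1).
  by move=> t0 bt; rewrite b2E// /Phi clamp_id.
have below t : 0 <= t -> (forall s, 0 <= s <= t -> 0 < b s) -> b t < K.
  move=> t0 pos; rewrite ltNge; apply/negP => btc.
  have [|||T [T0 Tt fT Tpos]] := @first_zero R (fun t => K - b t) t _ _ t0.
  - by move=> s s0; apply: continuousB; [exact: cvg_cst|exact: cb].
  - by rewrite b00 subr_gt0.
  - by rewrite subr_le0.
  have bT : b T = K by apply/eqP; rewrite eq_sym -subr_eq0 fT.
  have := @energy_conservation mu h b b1 b2 hn0 db db1 T (ltW T0).
  have eqn s : 0 <= s <= T -> 0 < b s /\ b2 s = mu * b s `^ (h - 1).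
    move=> /andP[s0 sT].
    have bs : 0 < b s by apply: pos; rewrite s0 (le_trans sT).
    have cs : b s <= K.
      move: sT; rewrite le_eqVlt => /predU1P[->|sT]; first by rewrite bT.
      by have := Tpos s; rewrite s0 sT subr_gt0 => /(_ isT)/ltW.
    by split => //; apply: b2E' => //; rewrite (ltW bs).
  move=> /(_ eqn); rewrite b00 b10 -/E0 bT /energy0 => EE.
  have : - (mu / h) * K `^ h <= E0.
    by rewrite -EE mulNr lerDr mulr_ge0// sqr_ge0.
  by rewrite leNgt KE.
have half : - (1 / 2) < 0 :> R by lra.
have [t1 [t10 bt1]] : exists t1, 0 <= t1 /\ b t1 <= 0.
  apply: contrapT => H.
  have pos t : 0 <= t -> 0 < b t.
    by move=> t0; rewrite ltNge; apply/negP => l; apply: H; exists t.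
  have b2n t : 0 <= t -> b2 t = mu * b t `^ (h - 1).
    move=> t0; apply: b2E' => //; rewrite (ltW (pos t t0)) ltW//.
    by apply: below => // s /andP[s0 _]; exact: pos.
  have mono s t : 0 <= s -> s <= t -> b1 t <= b1 s.
    move=> s0 st; rewrite -lerN2.
    apply: (@velocity_nondecreasing (fun t => - b1 t) (fun t => - b2 t)) => //.
      by move=> u u1; have d := db1 u u1; exact: is_deriveN.
    move=> u u0; rewrite b2n// -mulNr mulr_ge0 ?powR_ge0// oppr_ge0.
    exact: ltW.
  have b1p t : 0 <= t -> 0 <= b1 t.
    move=> t0; rewrite leNgt; apply/negP => bn.
    (* If the velocity were negative at t, the tangent line would reach 0 at time s. *)
    pose s := t + b t / - b1 t.
    have nb : 0 < - b1 t by rewrite oppr_gt0.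
    have ts : t <= s by rewrite lerDl divr_ge0// ltW// pos.
    have ht : - (1 / 2) < t by lra.
    have [x /andP[x0 _] E] := mvt_on db ht ts.
    have : b s <= 0.
      have -> : b s = b t + b1 x * (s - t) by rewrite -E addrC subrK.
      have h1 : b1 x * (s - t) <= b1 t * (s - t).
        by rewrite ler_wpM2r ?subr_ge0//; exact: mono.
      apply: le_trans (lerD (lexx (b t)) h1) _.
      rewrite /s [t + _]addrC addrK -[b1 t]opprK mulNr opprK mulrC divfK ?gt_eqF//.
      by rewrite subrr.
    by rewrite leNgt pos// (le_trans t0).
  have ba0 t : 0 <= t -> a0 <= b t.
    move=> t0; have [x /andP[x0 _] E] := mvt_on db half t0.
    by rewrite -b00 -subr_ge0 E subr0 mulr_ge0// b1p.
  pose k := - mu * a0 `^ (h - 1).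
  have k0 : 0 < k by rewrite mulr_gt0 ?oppr_gt0// powR_gt0.
  pose t := (`|b0| + 1) / k.
  have t0 : 0 <= t by rewrite divr_ge0 ?addr_ge0// ltW.
  have [x /andP[x0 _] E] := mvt_on db1 half t0.
  have b2k : b2 x <= - k.
    rewrite b2n// /k mulNr opprK ler_nM2l//.
    by apply: ge0_ler_powR; rewrite ?nnegrE ?(ltW a00) ?(ltW (pos x x0)) ?ba0//; lra.
  have := b1p t t0.
  have : b1 t - b0 <= - (`|b0| + 1).
    rewrite -{1}b10 E subr0 (_ : - (`|b0| + 1) = - k * t); last first.
      by rewrite /t mulNr mulrC divfK// gt_eqF.
    by rewrite ler_wpM2r.
  have := ler_norm b0; lra.
have [|T [T0 _ bT Tpos]] := @first_zero R b t1 cb _ t10 bt1; first by rewrite b00.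
exists T, b, b1, b2; split => //; split => //.
- by move=> t tn; split; [exact: db|exact: db1].
- move=> t [t0]; rewrite lte_fin => tT.
  have bt : 0 < b t by apply: Tpos; rewrite t0.
  split => //; apply: b2E' => //; rewrite (ltW bt) ltW//; apply: below => // s /andP[s0 st].
  by apply: Tpos; rewrite s0 (le_lt_trans st).
Qed.

End Existence.

(** * Maximal solutions *)

Section MaximalSolution.
Context {R : realType}.

(** A positive solution on a longer interval would agree with [b] before [T] and vanish at [T] by
continuity. *)
Lemma no_extension_past_zero (mu h a0 b0 T : R) (b b1 b2 a : R -> R) (tau : \bar R) :
  twosided_solution mu h a0 b0 T%:E b b1 b2 -> b T = 0 ->
  ivp_solution mu h a0 b0 tau a ->
  (forall t, Itau tau t -> Itau T%:E t -> a t = b t) -> (tau <= T%:E)%E.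
Proof.
move=> [T0 _ db _ _] bT [tau0 Ca a_gt0 _ _] ab; rewrite leNgt; apply/negP => Ttau.
rewrite lte_fin in T0.
have IT : Itau tau T by split => //; exact: ltW.
have aT := a_gt0 T IT.
have cab : {within `[0, T], continuous (fun s => a s - b s)}.
  have sub : `[0, T] `<=` Itau tau.
    by move=> s; rewrite /= in_itv/=; exact: Itau_le.
  rewrite continuous_subspace_in => s sI; apply: cvgB.
    exact: (continuous_subspaceW sub (Ck_on_continuous Ca)).
  have s0 : - (1 / 2) < s.
    by rewrite inE/= in_itv/= in sI; have /andP[? _] := sI; lra.
  have [d _] := db s s0.
  by apply: continuous_subspaceT_for (is_derive_continuous d); rewrite inE in sI.
have T2 : 0 < a T / 2 by rewrite divr_gt0.
move/subspace_continuousP : cab => /(_ T).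
rewrite /= in_itv/= lexx ltW// => /(_ isT)/cvgrPdist_le/(_ _ T2) H.
have {}H : nbhs T (fun s => s \in `[0, T] -> `|a T - b T - (a s - b s)| <= a T / 2).
  exact: H.
have /(@nbhs_distP R)[r r0 Hr] := H.
pose s := T - Num.min (T / 2) (r / 2).
have m1 : 0 < Num.min (T / 2) (r / 2) by rewrite lt_min !divr_gt0.
have m2 : Num.min (T / 2) (r / 2) <= T / 2 by rewrite ge_min lexx.
have m3 : Num.min (T / 2) (r / 2) <= r / 2 by rewrite ge_min lexx orbT.
have sI : 0 <= s < T by rewrite /s; apply/andP; split; lra.
have [s0 sT] := andP sI.
have := Hr s; rewrite ltr0_norm ?subr_lt0// in_itv/= s0 (ltW sT).
have sr : - (s - T) < r by rewrite /s; lra.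
move=> /(_ sr isT); rewrite (ab s); first last.
- by split.
- by apply: Itau_le IT _; rewrite s0 ltW.
by rewrite subrr subr0 bT subr0 ger0_norm; lra.
Qed.

Lemma ivp_maximal (mu h a0 b0 : R) :
  (h < 0 /\ 0 < mu) \/ (3 < h /\ mu < 0) -> 0 < a0 ->
  exists (tau : \bar R) (b b1 b2 : R -> R),
  [/\ twosided_solution mu h a0 b0 tau b b1 b2,
      maximal_ivp_solution mu h a0 b0 tau b,
      forall (tau' : \bar R) (a : R -> R), maximal_ivp_solution mu h a0 b0 tau' a ->
        tau' = tau /\ forall t, Itau tau t -> a t = b t,
      h < 0 -> [/\ tau = +oo%E,
        forall t, 0 < t ->
          0 < Num.sqrt (2 * energy0 mu h a0 b0) - (b t - a0) / t &
        Num.sqrt (2 * energy0 mu h a0 b0) - b t / t @[t --> +oo] --> 0] &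
      3 < h -> (tau < +oo)%E /\ b t @[t --> (fine tau)^'-] --> 0].
Proof.
move=> hmu a00.
have uniq tau b b1 b2 : twosided_solution mu h a0 b0 tau b b1 b2 ->
    (forall (tau' : \bar R) (a : R -> R), ivp_solution mu h a0 b0 tau' a ->
      (forall t, Itau tau' t -> Itau tau t -> a t = b t) -> (tau' <= tau)%E) ->
    maximal_ivp_solution mu h a0 b0 tau b /\
    forall (tau' : \bar R) (a : R -> R), maximal_ivp_solution mu h a0 b0 tau' a ->
        tau' = tau /\ forall t, Itau tau t -> a t = b t.
  move=> gb bd; have ib := twosided_ivp gb; split.
    split => // tau' a ia ab; apply: bd ia _ => t t1 t2; exact: ab.
  move=> tau' a [ia maxa].
  have ab t : Itau tau' t -> Itau tau t -> a t = b t by exact: ivp_unique ia gb t.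
  have E : tau' = tau.
    apply/eqP; rewrite eq_le (bd _ _ ia ab)/=; apply: maxa ib _ => t t1 t2.
    by rewrite ab.
  by split => // t It; apply: ab => //; rewrite E.
case: hmu => -[h0 mu0].
  have [b [b1 [b2 gb]]] := ivp_expanding b0 h0 mu0 a00.
  have [] := uniq _ _ _ _ gb; first by move=> *; rewrite leey.
  move=> mb ub; exists +oo%E, b, b1, b2; split => //.
    by move=> _; have [l1 l2] := expanding_asymptotics h0 mu0 a00 gb; split.
  by move=> h3; exfalso; lra.
have [T [b [b1 [b2 [gb bT]]]]] := ivp_collapsing b0 h0 mu0 a00.
have [] := uniq _ _ _ _ gb.
  by move=> tau' a ia ab; exact: no_extension_past_zero gb bT ia ab.
move=> mb ub; exists T%:E, b, b1, b2; split => //.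
  by move=> h3; exfalso; lra.
move=> _; split; first by rewrite ltry.
have [T0 _ db _ _] := gb; rewrite lte_fin in T0.
have [d _] := db T ltac:(lra).
rewrite -bT /=; apply: cvg_at_left_filter.
exact: is_derive_continuous d.
Qed.

End MaximalSolution.

(** * The energy as a function of the stretch ratio *)

(** The interior of the interval carries ordinary derivatives. *)
Lemma class_derivatives {R : realType} (M : R) (f : R -> R) : classC M f ->
  exists f1 f2 f3 : R -> R,
  [/\ forall x : R, `|x - 1| < 1 / 8 -> is_derive x 1 f (f1 x),
      forall x : R, `|x - 1| < 1 / 8 -> is_derive x 1 f1 (f2 x),
      forall x : R, `|x - 1| < 1 / 8 -> is_derive x 1 f2 (f3 x),
      forall x : R, `|x - 1| < 1 / 8 -> `|f3 x| <= M * betaf f &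
      [/\ f 1 = 1, f1 1 = 0 & f2 1 = betaf f]].
Proof.
move=> [C3 f1 f'1 _ f3].
have near1_nbhs (x : R) : `|x - 1| < 1 / 8 -> near1 x /\ nbhs x near1.
  move=> x1; split; first exact: ltW.
  apply/(@nbhs_distP _ R); exists (1 / 8 - `|x - 1|); first by rewrite subr_gt0.
  move=> y yx; rewrite /near1/=.
  have := ler_normD (y - x) (x - 1); rewrite addrA subrK => yx1.
  by apply: le_trans yx1 _; rewrite -lerBrDr ltW.
have diff_near1 (g : R -> R) k (x : R) : Ck_on k.+1 near1 g -> `|x - 1| < 1 / 8 ->
  is_derive x 1 g (diff_on near1 g x 1).
  move=> [dg _] x1; have [nx nnx] := near1_nbhs x x1.
  have [d E] := diff_on_interior nx nnx (dg x nx).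
  by split; [exact/derivable1_diffP|rewrite deriveE// E].
have C2 : Ck_on 2 near1 (deriv_on 1 near1 f) := C3.2 1.
have C1 : Ck_on 1 near1 (deriv_on 2 near1 f) := C2.2 1.
exists (deriv_on 1 near1 f), (deriv_on 2 near1 f), (deriv_on 3 near1 f); split.
- by move=> x; exact: diff_near1 C3.
- by move=> x; exact: diff_near1 C2.
- by move=> x; exact: diff_near1 C1.
- by move=> x /ltW x1; exact: f3.
- by split.
Qed.

Section StoredEnergy.
Context {R : realType}.
Variables (h M : R).
Hypothesis kappa_gt0 : 0 < kappah h.
Hypothesis M_ge0 : 0 <= M.

Let p := h / 3.
Let p1 := p - 1.
Let p2 := p1 - 1.
Let p3 := p2 - 1.

(** Bounds (1 + z)^q for |z| <= 1/8, whatever the sign of q. *)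
Definition powR_bound (q : R) : R := (1 / 2) `^ q + 2 `^ q.

(** Collects the four terms of the third derivative of (1 + z)^(h/3) f(1 + z), each factor of f
being at most (2 + M) f''(1). *)
Definition wconst : R := (2 + M) * (`|p * p1 * p2| * powR_bound p3 +
  3 * `|p * p1| * powR_bound p2 + 3 * `|p| * powR_bound p1 + powR_bound p).

Lemma powR_bound_ge0 q : 0 <= powR_bound q.
Proof. by rewrite addr_ge0 ?powR_ge0. Qed.

Lemma wconst_ge0 : 0 <= wconst.
Proof.
rewrite mulr_ge0 ?addr_ge0 ?mulr_ge0 ?powR_bound_ge0//.
Qed.

Variables (f f1 f2 f3 : R -> R) (beta : R).
Hypothesis beta1 : 1 <= beta.
Hypothesis df : forall x : R, `|x - 1| < 1 / 8 -> is_derive x 1 f (f1 x).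
Hypothesis df1 : forall x : R, `|x - 1| < 1 / 8 -> is_derive x 1 f1 (f2 x).
Hypothesis df2 : forall x : R, `|x - 1| < 1 / 8 -> is_derive x 1 f2 (f3 x).
Hypothesis f3_le : forall x : R, `|x - 1| < 1 / 8 -> `|f3 x| <= M * beta.
Hypothesis f_1 : f 1 = 1.
Hypothesis f1_1 : f1 1 = 0.
Hypothesis f2_1 : f2 1 = beta.

Let itvE (x : R) : (7 / 8 < x < 9 / 8) = (`|x - 1| < 1 / 8).
Proof.
rewrite ltr_norml; apply/idP/idP => /andP[a b]; apply/andP; split; lra.
Qed.

(** Integrating the bound on f''' down from f''(1) = beta >= 1, f'(1) = 0 and f(1) = 1. *)
Lemma classC_bounds (x : R) : `|x - 1| < 1 / 8 ->
  [/\ `|f x| <= (2 + M) * beta, `|f1 x| <= (2 + M) * beta,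
      `|f2 x| <= (2 + M) * beta & `|f3 x| <= (2 + M) * beta].
Proof.
move=> x1; have b1 := beta1; have M0 := M_ge0.
have n11 : `|1 - 1 : R| < 1 / 8 by rewrite subrr normr0 divr_gt0.
have Mb : 0 <= M * beta by rewrite mulr_ge0// (le_trans ler01).
have est (g g' : R -> R) c :
    (forall y : R, `|y - 1| < 1 / 8 -> is_derive y 1 g (g' y)) ->
    (forall y : R, `|y - 1| < 1 / 8 -> `|g' y| <= c) ->
    forall y : R, `|y - 1| < 1 / 8 -> `|g y - g 1| <= c / 8.
  move=> dg H y y1.
  have c0 : 0 <= c by apply: le_trans (H y y1).
  apply: (@le_trans _ _ (c * `|y - 1|)).
    have := @derive_lipschitz R g g' (7 / 8) (9 / 8) c y 1; apply.
    - by move=> t; rewrite itvE; exact: dg.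
    - by move=> t; rewrite itvE; exact: H.
    - by rewrite itvE.
    - by rewrite itvE.
  by rewrite ler_wpM2l// -div1r ltW.
have e2 (y : R) : `|y - 1| < 1 / 8 -> `|f2 y| <= (1 + M) * beta.
  move=> y1; have := est f2 f3 (M * beta) df2 f3_le y y1.
  rewrite f2_1 !ler_norml => /andP[a b].
  by apply/andP; split; lra.
have e1 (y : R) : `|y - 1| < 1 / 8 -> `|f1 y| <= (1 + M) * beta.
  move=> y1; have := est f1 f2 _ df1 e2 y y1.
  rewrite f1_1 subr0 => /le_trans; apply; lra.
split.
- have := est f f1 _ df e1 x x1.
  by rewrite f_1 !ler_norml => /andP[a b]; apply/andP; split; lra.
- by apply: le_trans (e1 x x1) _; lra.
- by apply: le_trans (e2 x x1) _; lra.
- by apply: le_trans (f3_le x1) _; lra.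
Qed.

(** The energy at the stretches l1 = 1 + z, l2 = 1; the factor l2^h gives the energy at all spherical
gradients ([energy_stretch]). The next three are its derivatives. *)
Definition wz0 (z : R) := (1 + z) `^ p * f (1 + z).
Definition wz1 (z : R) := p * (1 + z) `^ p1 * f (1 + z) + (1 + z) `^ p * f1 (1 + z).
Definition wz2 (z : R) := p * p1 * (1 + z) `^ p2 * f (1 + z) +
  2 * p * (1 + z) `^ p1 * f1 (1 + z) + (1 + z) `^ p * f2 (1 + z).
Definition wz3 (z : R) := p * p1 * p2 * (1 + z) `^ p3 * f (1 + z) +
  3 * (p * p1) * (1 + z) `^ p2 * f1 (1 + z) +
  3 * p * (1 + z) `^ p1 * f2 (1 + z) + (1 + z) `^ p * f3 (1 + z).

Let shiftE (z : R) : `|z| < 1 / 8 -> `|1 + z - 1| < 1 / 8.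
Proof. by rewrite addrAC subrr add0r. Qed.

Let zpos (z : R) : `|z| < 1 / 8 -> 0 < 1 + z.
Proof. by rewrite ltr_norml => /andP[]; lra. Qed.

Let dshift (g g' : R -> R) (z : R) : is_derive (1 + z) 1 g (g' (1 + z)) ->
  is_derive z 1 (fun z => g (1 + z)) (g' (1 + z)).
Proof.
move=> dg.
have ds : is_derive z 1 (fun z : R => 1 + z) 1.
  by have := is_deriveD (is_derive_cst (1 : R) z 1) (is_derive_id z 1); rewrite add0r.
have := @is_derive1_comp R g (fun z => 1 + z) z _ _ dg ds.
by rewrite mulr1.
Qed.

Let dpow (q z : R) : `|z| < 1 / 8 ->
  is_derive z 1 (fun z => (1 + z) `^ q) (q * (1 + z) `^ (q - 1)).
Proof.
move=> z8; apply: (@dshift (fun x => x `^ q) (fun x => q * x `^ (q - 1))).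
exact: is_derive1_powR (zpos z8).
Qed.

Let dterm (a q : R) (g g' : R -> R) (z : R) :
  (forall x : R, `|x - 1| < 1 / 8 -> is_derive x 1 g (g' x)) -> `|z| < 1 / 8 ->
  is_derive z 1 (fun z => a * (1 + z) `^ q * g (1 + z))
   (a * q * (1 + z) `^ (q - 1) * g (1 + z) + a * (1 + z) `^ q * g' (1 + z)).
Proof.
move=> dg z8.
have := is_deriveM (is_deriveZ a (dpow q z8)) (dshift (dg _ (shiftE z8))).
move=> d; apply: is_derive_eq d _; rewrite /= !scaleRE; ring.
Qed.

Lemma dwz0 (z : R) : `|z| < 1 / 8 -> is_derive z 1 wz0 (wz1 z).
Proof.
move=> z8; have := dterm 1 p df z8.
rewrite (_ : (fun z => _) = wz0); last by apply/funext => y; rewrite mul1r.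
by move=> d; apply: is_derive_eq d _; rewrite /wz1 /p1; ring.
Qed.

Lemma dwz1 (z : R) : `|z| < 1 / 8 -> is_derive z 1 wz1 (wz2 z).
Proof.
move=> z8; have d0 := dterm p p1 df z8; have d1 := dterm 1 p df1 z8.
have -> : wz1 = (fun z => p * (1 + z) `^ p1 * f (1 + z)) \+
    (fun z => 1 * (1 + z) `^ p * f1 (1 + z)).
  by apply/funext => y; rewrite /= mul1r.
apply: is_derive_eq (is_deriveD d0 d1) _; rewrite /wz2 -/p1 -/p2; ring.
Qed.

Lemma dwz2 (z : R) : `|z| < 1 / 8 -> is_derive z 1 wz2 (wz3 z).
Proof.
move=> z8; have d0 := dterm (p * p1) p2 df z8.
have d1 := dterm (2 * p) p1 df1 z8; have d2 := dterm 1 p df2 z8.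
have -> : wz2 = (fun z => p * p1 * (1 + z) `^ p2 * f (1 + z)) \+
    (fun z => 2 * p * (1 + z) `^ p1 * f1 (1 + z)) \+
    (fun z => 1 * (1 + z) `^ p * f2 (1 + z)).
  by apply/funext => y; rewrite /= mul1r.
apply: is_derive_eq (is_deriveD (is_deriveD d0 d1) d2) _.
rewrite /wz3 -/p1 -/p2 -/p3; ring.
Qed.

Lemma wz_at0 : [/\ wz0 0 = 1, wz1 0 = h / 3 & wz2 0 = beta + kappah h].
Proof.
rewrite /wz0 /wz1 /wz2 addr0 !powR1 f_1 f1_1 f2_1 /kappah /p1 /p; split; ring.
Qed.

Lemma wz3_le (z : R) : `|z| < 1 / 8 -> `|wz3 z| <= wconst * (beta + kappah h).
Proof.
move=> z8; have [b0 b1' b2 b3] := classC_bounds (shiftE z8).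
have pw q : (1 + z) `^ q <= powR_bound q.
  apply: powR_le_ends; first by rewrite divr_gt0.
  by move: z8; rewrite ltr_norml => /andP[? ?]; apply/andP; split; lra.
have b1 : 1 <= beta := beta1; have M0 := M_ge0; have k0 := kappa_gt0.
have B0 : 0 <= (2 + M) * beta by rewrite mulr_ge0//; lra.
have term (a q : R) (y : R) : `|y| <= (2 + M) * beta ->
    `|a * (1 + z) `^ q * y| <= `|a| * powR_bound q * ((2 + M) * beta).
  move=> yb; rewrite !normrM; apply: ler_pM; [by rewrite mulr_ge0|exact: normr_ge0| |exact: yb].
  by apply: ler_wpM2l; [exact: normr_ge0|rewrite ger0_norm ?powR_ge0].
apply: (@le_trans _ _ (wconst * beta)); last first.
  by rewrite ler_wpM2l ?wconst_ge0//; lra.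
have t0 := term (p * p1 * p2) p3 _ b0; have t1 := term (3 * (p * p1)) p2 _ b1'.
have t2 := term (3 * p) p1 _ b2; have t3 := term 1 p _ b3.
rewrite mul1r normr1 mul1r in t3.
have n3 (x : R) : `|3 * x| = 3 * `|x| by rewrite normrM ger0_norm.
rewrite n3 in t1; rewrite n3 in t2.
rewrite /wz3 (_ : wconst * beta = `|p * p1 * p2| * powR_bound p3 * ((2 + M) * beta) +
  3 * `|p * p1| * powR_bound p2 * ((2 + M) * beta) + 3 * `|p| * powR_bound p1 * ((2 + M) * beta) +
  powR_bound p * ((2 + M) * beta)); last by rewrite /wconst; ring.
by do 3 (apply: le_trans (ler_normD _ _) _; apply: lerD => //).
Qed.

End StoredEnergy.

(** * Stress of an objective isotropic energy at a spherical gradient *)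

Section Mat3.
Context {R : realType}.

Definition i0 : 'I_3 := ord0.
Definition i1 : 'I_3 := lift ord0 ord0.
Definition i2 : 'I_3 := lift ord0 (lift ord0 ord0).

Lemma sum3 (V : zmodType) (F : 'I_3 -> V) : \sum_i F i = F i0 + F i1 + F i2.
Proof. by rewrite !big_ord_recl big_ord0 addr0 addrA. Qed.

Lemma det2 (A : 'M[R]_2) : \det A =
  A ord0 ord0 * A (lift ord0 ord0) (lift ord0 ord0) -
  A ord0 (lift ord0 ord0) * A (lift ord0 ord0) ord0.
Proof.
rewrite (expand_det_row _ ord0) !big_ord_recl big_ord0 addr0 /cofactor !det_mx11 !mxE.
rewrite /= !expr0 !expr1 mul1r mulN1r mulrN.
by congr (_ * A _ _ - _ * A _ _); apply: val_inj.
Qed.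

Lemma det3 (A : 'M[R]_3) : \det A =
  A i0 i0 * (A i1 i1 * A i2 i2 - A i1 i2 * A i2 i1) -
  A i0 i1 * (A i1 i0 * A i2 i2 - A i1 i2 * A i2 i0) +
  A i0 i2 * (A i1 i0 * A i2 i1 - A i1 i1 * A i2 i0).
Proof.
rewrite (expand_det_row _ ord0) sum3 /cofactor !det2 !mxE /=.
rewrite expr0 expr1 -signr_odd /= expr0 !mul1r mulN1r mulrN.
by congr (_ * (A _ _ * A _ _ - A _ _ * A _ _) - _ * (A _ _ * A _ _ - A _ _ * A _ _)
  + _ * (A _ _ * A _ _ - A _ _ * A _ _)); apply: val_inj.
Qed.

Definition nsq (y : 'cV[R]_3) : R := \sum_i y i 0 ^+ 2.

Lemma nsq_ge0 y : 0 <= nsq y.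
Proof. by apply: sumr_ge0 => i _; exact: sqr_ge0. Qed.

Lemma enorm_sqr y : enorm y ^+ 2 = nsq y.
Proof. by rewrite /enorm sqr_sqrtr// nsq_ge0. Qed.

Lemma outerE (x y : 'cV[R]_3) i j : (x *m y^T) i j = x i 0 * y j 0.
Proof. by rewrite !mxE big_ord1 !mxE. Qed.

Lemma innerE (x y : 'cV[R]_3) : (x^T *m y) 0 0 = \sum_i x i 0 * y i 0.
Proof. by rewrite mxE; apply: eq_bigr => i _; rewrite mxE. Qed.

Lemma inner_nsq (y : 'cV[R]_3) : y^T *m y = (nsq y)%:M.
Proof.
by rewrite [LHS]mx11_scalar innerE; congr (_%:M).
Qed.

Lemma det_rank1 (a b : R) (y : 'cV[R]_3) :
  \det (a *: 1%:M + b *: (y *m y^T)) = a ^+ 2 * (a + b * nsq y).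
Proof.
rewrite det3 /nsq sum3.
have E i j : (a *: 1%:M + b *: (y *m y^T)) i j = a * (i == j)%:R + b * (y i 0 * y j 0).
  by rewrite !mxE big_ord1 !mxE.
by rewrite !E /=; move: (y i0 0) (y i1 0) (y i2 0) => p q r; ring.
Qed.

Lemma continuous_entry m n i j : continuous (fun A : 'M[R]_(m, n) => A i j).
Proof. by move=> A; exact: differentiable_continuous (differentiable_coord A i j). Qed.

Lemma continuous_det3 : continuous (fun A : 'M[R]_3 => \det A).
Proof.
rewrite (_ : (fun A : 'M[R]_3 => \det A) = (fun A : 'M[R]_3 =>
  A i0 i0 * (A i1 i1 * A i2 i2 - A i1 i2 * A i2 i1) -
  A i0 i1 * (A i1 i0 * A i2 i2 - A i1 i2 * A i2 i0) +
  A i0 i2 * (A i1 i0 * A i2 i1 - A i1 i1 * A i2 i0))); last first.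
  by apply/funext => A; rewrite det3.
have c i j : continuous (fun A : 'M[R]_3 => A i j) by exact: continuous_entry.
have cM (f g : 'M[R]_3 -> R) : continuous f -> continuous g ->
    continuous (fun A => f A * g A).
  by move=> cf cg A; exact: (@continuousM _ _ f g A (cf A) (cg A)).
have cB (f g : 'M[R]_3 -> R) : continuous f -> continuous g ->
    continuous (fun A => f A - g A).
  by move=> cf cg A; exact: (@continuousB _ _ _ f g A (cf A) (cg A)).
have cD (f g : 'M[R]_3 -> R) : continuous f -> continuous g ->
    continuous (fun A => f A + g A).
  by move=> cf cg A; exact: (@continuousD _ _ _ f g A (cf A) (cg A)).
by apply: (cD); [apply: (cB)|]; apply: (cM) => //; apply: (cB); apply: (cM).
Qed.

Lemma open_GLp : open (@GLp R).
Proof.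
rewrite (_ : GLp = (fun A : 'M[R]_3 => \det A) @^-1` [set x | 0 < x])//.
by apply: open_comp; [move=> A _; exact: continuous_det3|exact: open_gt].
Qed.

Lemma line_derive {V W : normedModType R} (f : V -> W) (x v : V) :
  differentiable f x -> is_derive (0 : R) 1 (fun t => f (x + t *: v)) ('d f x v).
Proof.
move=> df.
have dl : is_diff (0 : R) (cst x + ( *:%R ^~ v)) (0 + ( *:%R ^~ v)).
  by apply: is_diffD.
have x0 : (cst x + ( *:%R ^~ v)) (0 : R) = x by rewrite fctE scale0r addr0.
have df' : is_diff ((cst x + ( *:%R ^~ v)) (0 : R)) f ('d f x).
  by rewrite x0; exact: differentiableP.
have [dc dE] := is_diff_comp dl df'.
split; first by apply/derivable1_diffP.
by rewrite deriveE// dE /= fctE add0r scale1r.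
Qed.

Lemma near_line {V : normedModType R} (A : set V) (x v : V) : nbhs x A ->
  \forall t \near (0 : R), A (x + t *: v).
Proof.
move=> nA.
have c : {for (0 : R), continuous (fun t : R => x + t *: v)}.
  apply: continuousD; first exact: cvg_cst.
  by apply: continuousZr_tmp; exact: cvg_id.
by apply: c; rewrite scale0r addr0.
Qed.

Lemma is_derive_near_unique {W : normedModType R} (f g : R -> W) (x : R) (a b : W) :
  is_derive x 1 f a -> is_derive x 1 g b -> (\forall t \near x, f t = g t) -> a = b.
Proof.
move=> df dg fg; have := near_eq_is_derive fg df.
by move=> dg'; rewrite -(@derive_val _ _ _ _ _ _ _ dg') (@derive_val _ _ _ _ _ _ _ dg).
Qed.

(** The hypothesis says that S commutes with the symmetric tensors of the plane on which P
projects, in coordinates. Contracting l = j gives 3 S P = tr(P S) P + (P S P)^T; hence S P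
preserves the plane, is symmetric, and is half its trace times P. *)
Lemma polarized_scalar (S P : 'M[R]_3) : P^T = P -> P *m P = P -> \tr P = 2 ->
  (forall i j k l, (S *m P) k i * P l j + (S *m P) k j * P l i =
                   P k i * (P *m S) j l + P k j * (P *m S) i l) ->
  exists s, S *m P = s *: P.
Proof.
move=> PT PP trP polar.
have key : 3 *: (S *m P) = \tr (P *m S) *: P + P *m S^T *m P.
  apply/matrixP => k i.
  have addE (A B : 'M[R]_3) : (A + B) k i = A k i + B k i by rewrite mxE.
  have ZE (A : 'M[R]_3) c : (c *: A) k i = c * A k i by rewrite mxE.
  have E : \sum_j ((S *m P) k i * P j j + (S *m P) k j * P j i) =
    \sum_j (P k i * (P *m S) j j + P k j * (P *m S) i j).
    by apply: eq_bigr => j _; rewrite polar.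
  move: E; rewrite !big_split /= -!mulr_sumr -!/(mxtrace _) trP => E.
  rewrite addE !ZE.
  have E1 : \sum_j (S *m P) k j * P j i = (S *m P) k i.
    transitivity ((S *m P *m P) k i); first by rewrite [RHS]mxE.
    by rewrite -mulmxA PP.
  have E2 : \sum_j P k j * (P *m S) i j = (P *m S^T *m P) k i.
    rewrite -mulmxA [RHS]mxE; apply: eq_bigr => j _; congr (_ * _).
    by rewrite -[in RHS]PT -trmx_mul [RHS]mxE.
  move: E; rewrite E1 E2 [\tr _ * _]mulrC => <-; ring.
pose N := P *m S *m P.
have keyN : 3 *: N = \tr (P *m S) *: P + N^T.
  have := congr1 (mulmx P) key.
  rewrite -scalemxAr mulmxDr -scalemxAr !mulmxA PP => ->.
  by congr (_ + _); rewrite /N !trmx_mul PT mulmxA.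
have SN : S *m P = N.
  have : 3 *: (S *m P) = 3 *: N.
    by rewrite key keyN; congr (_ + _); rewrite /N !trmx_mul PT mulmxA.
  by move=> /(congr1 ( *:%R 3^-1)); rewrite !scalerA mulVf// !scale1r.
exists (\tr (P *m S) / 2); rewrite SN; apply/matrixP => i j.
have E1 := congr1 (fun A : 'M[R]_3 => A i j) keyN.
have E2 := congr1 (fun A : 'M[R]_3 => A j i) keyN.
have E3 := congr1 (fun A : 'M[R]_3 => A i j) PT.
have addE (A B : 'M[R]_3) k l : (A + B) k l = A k l + B k l by rewrite mxE.
have ZE (A : 'M[R]_3) c k l : (c *: A) k l = c * A k l by rewrite mxE.
have trE (A : 'M[R]_3) k l : A^T k l = A l k by rewrite mxE.
move: E1 E2 E3; rewrite !addE !ZE !trE; move: (P i j) (P j i) (N i j) (N j i) (\tr _).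
move=> a b c d t E1 E2 E3; rewrite E3 in E2; lra.
Qed.

Section Energy.
Variable W : 'M[R]_3 -> R.
Hypothesis dW : forall F, GLp F -> differentiable W F.

Let S := piola_kirchhoff W.

Lemma piolaE F i j : GLp F -> S F i j = 'd W F (delta_mx i j).
Proof. by move=> GF; rewrite mxE deriveE//; exact: dW. Qed.

Lemma diff_piola F H : GLp F -> 'd W F H = \tr ((S F)^T *m H).
Proof.
move=> GF; rewrite {1}(matrix_sum_delta H) linear_sum/=.
rewrite /mxtrace.
under [RHS]eq_bigr => i _.
  rewrite mxE; under eq_bigr => j _ do rewrite mxE. over.
rewrite [RHS]exchange_big/=; apply: eq_bigr => i _.
rewrite linear_sum/=; apply: eq_bigr => j _.
by rewrite linearZ/= piolaE// [_ *: _]mulrC.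
Qed.

Lemma piola_homogeneous h F s : homogeneous h W -> GLp F -> 0 < s ->
  S (s *: F) = s `^ (h - 1) *: S F.
Proof.
move=> hW GF s0.
have GsF : GLp (s *: F) by rewrite /GLp/= detZ mulr_gt0// exprn_gt0.
apply/matrixP => i j; rewrite piolaE// [RHS]mxE piolaE//; set v := delta_mx i j.
have d1 := line_derive v (dW GsF).
have d2 : is_derive (0 : R) 1 (fun t => W (F + t *: (s^-1 *: v))) (s^-1 * 'd W F v).
  have := line_derive (s^-1 *: v) (dW GF).
  by rewrite linearZ.
have d3 := is_deriveZ (s `^ h) d2.
have E : s `^ (h - 1) = s `^ h * s^-1.
  rewrite powRB; last by apply/implyP => _; rewrite gt_eqF.
  by rewrite (powRr1 (ltW s0)).
rewrite E -mulrA; apply: (is_derive_near_unique d1 d3).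
apply: filterS (near_line (s^-1 *: v) (open_nbhs_nbhs (conj open_GLp GF))) => t Gt.
rewrite /= -[_ *: W _]/(_ * W _) -hW//; congr W.
by rewrite scalerDr !scalerA mulrAC divff ?mul1r// gt_eqF.
Qed.

Hypothesis oW : objective W.
Hypothesis iW : isotropic W.

(** Objectivity and isotropy together make W invariant under conjugation. *)
Lemma diff_conj F U H : GLp F -> SO3 U -> U *m F *m U^T = F ->
  'd W F (U *m H *m U^T) = 'd W F H.
Proof.
move=> GF [UU dU] UF.
have SU : SO3 U by split.
have ST : SO3 U^T by split; rewrite ?trmxK ?det_tr//; exact: mulmx1C.
have d1 := line_derive H (dW GF); have d2 := line_derive (U *m H *m U^T) (dW GF).
apply: (is_derive_near_unique d2 d1).
apply: filterS (near_line H (open_nbhs_nbhs (conj open_GLp GF))) => t Gt.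
have -> : F + t *: (U *m H *m U^T) = U *m (F + t *: H) *m U^T.
  by rewrite mulmxDr mulmxDl UF -scalemxAr -scalemxAl.
rewrite iW ?oW//.
by rewrite /GLp/= det_mulmx dU mul1r.
Qed.

Definition halfturn (e : 'cV[R]_3) : 'M[R]_3 := 2 *: (e *m e^T) - 1%:M.

Lemma halfturn_tr e : (halfturn e)^T = halfturn e.
Proof. by rewrite /halfturn linearB/= linearZ/= trmx_mul trmxK trmx1. Qed.

Lemma outer_sqr (e : 'cV[R]_3) : nsq e = 1 -> e *m e^T *m (e *m e^T) = e *m e^T.
Proof. by move=> e1; rewrite mulmxA -(mulmxA e) inner_nsq e1 mulmx1. Qed.

Lemma halfturn_sqr e : nsq e = 1 -> halfturn e *m halfturn e = 1%:M.
Proof.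
move=> e1; rewrite /halfturn mulmxBl mulmxBr mul1mx mulmx1 -scalemxAl -scalemxAr.
rewrite outer_sqr// scalerA opprB.
by apply/matrixP => i j; rewrite !mxE; ring.
Qed.

Lemma halfturn_SO3 e : nsq e = 1 -> SO3 (halfturn e).
Proof.
move=> e1; split; first by rewrite halfturn_tr halfturn_sqr.
rewrite /halfturn addrC -scaleN1r det_rank1 e1; ring.
Qed.

(** The half-turn about [e] conjugates F to itself, hence fixes the gradient of W at F. *)
Lemma piola_comm F e : GLp F -> nsq e = 1 -> e *m e^T *m F = F *m (e *m e^T) ->
  S F *m (e *m e^T) = e *m e^T *m S F.
Proof.
move=> GF e1 comm; set U := halfturn e.
have UF : U *m F *m U^T = F.
  have UFc : U *m F = F *m U.
    by rewrite /U /halfturn mulmxBl mulmxBr mul1mx mulmx1 -scalemxAl -scalemxAr comm.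
  by rewrite UFc halfturn_tr -mulmxA halfturn_sqr// mulmx1.
have key : U *m (S F)^T *m U = (S F)^T.
  apply/matrixP => i j.
  have := diff_conj (delta_mx j i) GF (halfturn_SO3 e1) UF.
  rewrite !diff_piola// halfturn_tr -/U !mulmxA mxtrace_mulC !mulmxA.
  have trd (A : 'M[R]_3) : \tr (A *m delta_mx j i) = A i j.
    rewrite /mxtrace (bigD1 i)//= mxE (bigD1 j)//= mxE !eqxx mulr1.
    rewrite big1 ?addr0 => [|k kj]; last by rewrite mxE (negbTE kj) mulr0.
    rewrite big1 ?addr0// => k ki; rewrite mxE big1// => l _.
    by rewrite mxE (negbTE ki) andbF mulr0.
  by rewrite !trd.
have key2 : S F *m U = U *m S F.
  have := congr1 trmx key; rewrite !trmx_mul trmxK halfturn_tr => {1}<-.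
  by rewrite -!mulmxA halfturn_sqr// mulmx1.
move: key2; rewrite /U /halfturn mulmxBl mulmxBr mul1mx mulmx1 => /addIr.
rewrite -scalemxAl -scalemxAr => /(congr1 ( *:%R 2^-1)).
by rewrite !scalerA mulVf ?scale1r.
Qed.

Section Sph.
Variables (l1 l2 : R) (w : 'cV[R]_3).
Hypothesis l1_gt0 : 0 < l1.
Hypothesis l2_gt0 : 0 < l2.
Hypothesis w1 : nsq w = 1.

Let F := Fsph l1 l2 w.
Let P := P2 w.

Lemma FsphE : F = l2 *: 1%:M + (l1 - l2) *: (w *m w^T).
Proof.
by rewrite /F /Fsph /P2 /P1; apply/matrixP => i j; rewrite !mxE; ring.
Qed.

Lemma GLp_Fsph : GLp F.
Proof.
rewrite /GLp/= FsphE det_rank1 w1 mulr1 subrKC mulr_gt0// exprn_gt0//.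
Qed.

Let PT : P^T = P.
Proof. by rewrite /P /P2 /P1 linearB/= trmx1 trmx_mul trmxK. Qed.

Let Pw : P *m w = 0.
Proof. by rewrite /P /P2 /P1 mulmxBl mul1mx -mulmxA inner_nsq w1 mulmx1 subrr. Qed.

Let wP : w^T *m P = 0.
Proof. by rewrite -[LHS]trmxK trmx_mul trmxK PT Pw trmx0. Qed.

Let PP : P *m P = P.
Proof.
by rewrite {1}/P /P2 /P1 mulmxBl mul1mx -mulmxA wP mulmx0 subr0.
Qed.

Let trP : \tr P = 2.
Proof.
rewrite /P /P2 /P1 linearB/= mxtrace1 mxtrace_mulC inner_nsq w1 mxtrace1.
by rewrite -natrB.
Qed.

(** Every direction orthogonal to the axis [w] is an eigenvector of the gradient. *)
Lemma piola_perp (x : 'cV[R]_3) : w^T *m x = 0 ->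
  S F *m (x *m x^T) = x *m x^T *m S F.
Proof.
move=> wx.
have [n0|n0] := eqVneq (nsq x) 0.
  suff -> : x = 0 by rewrite mul0mx mulmx0 mul0mx.
  apply/matrixP => i j; rewrite ord1 mxE; apply/eqP.
  have := n0 => /eqP; rewrite psumr_eq0 => [|k _]; last exact: sqr_ge0.
  by move=> /allP/(_ i); rewrite mem_index_enum sqrf_eq0 => /(_ isT).
have np : 0 < nsq x by rewrite lt_neqAle eq_sym n0 nsq_ge0.
pose e := (enorm x)^-1 *: x.
have e0 : enorm x != 0 by rewrite gt_eqF// sqrtr_gt0.
have ee : x *m x^T = enorm x ^+ 2 *: (e *m e^T).
  rewrite /e linearZ/= -scalemxAl -scalemxAr !scalerA.
  rewrite (_ : _ * _ = 1) ?scale1r//; field; exact: e0.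
have e1 : nsq e = 1.
  rewrite /nsq /e; under eq_bigr => i _ do rewrite mxE exprMn.
  by rewrite -mulr_sumr -/(nsq x) -enorm_sqr -exprMn mulVf// expr1n.
have we : w^T *m e = 0 by rewrite /e -scalemxAr wx scaler0.
have ew : e^T *m w = 0 by rewrite -[LHS]trmxK trmx_mul trmxK we trmx0.
move: ee e1 we ew; move: (e) => e' ee e1 we ew.
rewrite ee -scalemxAl -scalemxAr (piola_comm GLp_Fsph e1)//.
rewrite FsphE mulmxDr mulmxDl -!scalemxAr -!scalemxAl mul1mx mulmx1.
rewrite -!mulmxA (mulmxA e'^T) ew (mulmxA w^T) we !mul0mx !mulmx0 //.
Qed.

Lemma piola_axis : S F *m P1 w = P1 w *m S F.
Proof.
apply: (piola_comm GLp_Fsph w1); rewrite FsphE mulmxDr mulmxDl.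
by rewrite -!scalemxAr -!scalemxAl mul1mx mulmx1.
Qed.

(** Polarisation of [piola_perp] at the sum of two columns of P, written in coordinates. *)
Lemma piola_polar i j k l :
  (S F *m P) k i * P l j + (S F *m P) k j * P l i =
  P k i * (P *m S F) j l + P k j * (P *m S F) i l.
Proof.
move: (P) PT wP => Q QT wQ.
have wc a : w^T *m col a Q = 0 by rewrite colE mulmxA wQ mul0mx.
have wcc : w^T *m (col i Q + col j Q) = 0 by rewrite mulmxDr !wc addr0.
have c1 := piola_perp (wc i); have c2 := piola_perp (wc j).
have Tc a b : (S F *m (col a Q *m (col b Q)^T)) k l = (S F *m Q) k a * Q l b.
  by rewrite mulmxA outerE colE mulmxA -colE !mxE.
have T'c a b : (col a Q *m (col b Q)^T *m S F) k l = Q k a * (Q *m S F) b l.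
  rewrite -mulmxA tr_col QT -row_mul mxE big_ord1.
  by congr (_ * _); rewrite mxE.
have c3 := piola_perp wcc.
move: c1 c2 c3 => /matrixP/(_ k l) c1 /matrixP/(_ k l) c2.
rewrite linearD/= !mulmxDl !mulmxDr !mulmxDl => /matrixP/(_ k l).
have addE (A B : 'M[R]_3) : (A + B) k l = A k l + B k l by rewrite mxE.
move: c1 c2; rewrite !addE !Tc !T'c => c1 c2 c3. lra.
Qed.

Lemma piola_cross : exists s : R, S F *m P = s *: P.
Proof. exact: polarized_scalar PT PP trP piola_polar. Qed.

(** The coefficients are directional derivatives: the gradient of W paired with P1 and with
P2, whose squared norms are 1 and 2. *)
Lemma piola_Fsph : S F = 'd W F (P1 w) *: P1 w + ('d W F P / 2) *: P.
Proof.
have [s sE] := piola_cross.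
pose c := (w^T *m S F *m w) 0 0.
have S1 : S F *m P1 w = c *: P1 w.
  have PP1 : P1 w *m P1 w = P1 w by rewrite /P1 outer_sqr.
  rewrite -{1}PP1 mulmxA piola_axis /P1.
  have -> : w *m w^T *m S F *m (w *m w^T) = w *m (w^T *m S F *m w) *m w^T.
    by rewrite !mulmxA.
  by rewrite [w^T *m S F *m w]mx11_scalar -/c mul_mx_scalar -scalemxAl.
have SE : S F = c *: P1 w + s *: P.
  by rewrite -S1 -sE -mulmxDr /P /P2 subrKC mulmx1.
have ST : (S F)^T = S F.
  rewrite SE linearD/= !linearZ/= PT; congr (_ *: _ + _).
  by rewrite /P1 trmx_mul trmxK.
have tr1 : \tr (P1 w) = 1 by rewrite /P1 mxtrace_mulC inner_nsq w1 mxtrace1.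
have -> : 'd W F (P1 w) = c.
  by rewrite (diff_piola _ GLp_Fsph) -/S ST S1 linearZ/= tr1 mulr1.
have -> : 'd W F P / 2 = s.
  by rewrite (diff_piola _ GLp_Fsph) -/S ST sE linearZ/= trP mulfK.
exact: SE.
Qed.

End Sph.
End Energy.
End Mat3.

(** * Divergence of a spherically symmetric tensor field *)

Section Divergence.
Context {R : realType}.

Lemma line_is_derive {V W : normedModType R} (f : V -> W) (y v : V) (d : W) :
  is_derive (0 : R) 1 (fun t => f (y + t *: v)) d -> is_derive y v f d.
Proof.
have E : (fun s : R => s^-1 *: ((f \o shift y) (s *: v) - f y)) =
  (fun s : R => s^-1 *: (((fun t => f (y + t *: v)) \o shift 0) (s *: 1) -
    f (y + 0 *: v))).
  apply/funext => s /=; rewrite scale0r !addr0 scaler1.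
  by rewrite [s *: v + y]addrC.
move=> [dd dE]; split.
  by move: dd; rewrite /derivable -E.
by move: dE; rewrite /derive -E.
Qed.

Lemma nsq_line (y v : 'cV[R]_3) (t : R) :
  nsq (y + t *: v) = nsq y + 2 * t * (\sum_i y i 0 * v i 0) + t ^+ 2 * nsq v.
Proof.
rewrite /nsq !mulr_sumr -!big_split/=; apply: eq_bigr => i _.
by rewrite !mxE; ring.
Qed.

Lemma nsqZ (r : R) (y : 'cV[R]_3) : nsq (r *: y) = r ^+ 2 * nsq y.
Proof. by rewrite /nsq mulr_sumr; apply: eq_bigr => i _; rewrite mxE exprMn. Qed.

Lemma nsq_eq0 (y : 'cV[R]_3) : (nsq y == 0) = (y == 0).
Proof.
apply/eqP/eqP => [/eqP|->]; last first.
  by rewrite /nsq big1// => i _; rewrite mxE expr0n.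
rewrite psumr_eq0 => [|i _]; last exact: sqr_ge0.
move=> /allP y0; apply/matrixP => i j; rewrite ord1 mxE; apply/eqP.
by have := y0 i; rewrite mem_index_enum sqrf_eq0 => /(_ isT).
Qed.

Lemma nsq_delta (j : 'I_3) : nsq (delta_mx j 0 : 'cV[R]_3) = 1.
Proof.
rewrite /nsq (bigD1 j)//= mxE !eqxx expr1n big1 ?addr0// => i ij.
by rewrite mxE (negbTE ij) expr0n.
Qed.

Lemma enorm_ge0 (y : 'cV[R]_3) : 0 <= enorm y.
Proof. exact: sqrtr_ge0. Qed.

Lemma polar_form (y : 'cV[R]_3) : exists2 w, nsq w = 1 & y = enorm y *: w.
Proof.
have [->|y0] := eqVneq y 0.
  exists (delta_mx ord0 0); first exact: nsq_delta.
  rewrite (_ : enorm 0 = 0) ?scale0r//.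
  by apply/eqP; rewrite -sqrf_eq0 enorm_sqr nsq_eq0.
have e0 : enorm y != 0 by rewrite -sqrf_eq0 enorm_sqr nsq_eq0.
exists ((enorm y)^-1 *: y); last by rewrite scalerA mulfV ?scale1r.
by rewrite nsqZ -enorm_sqr -exprMn mulVf// expr1n.
Qed.

Lemma enormZ (r : R) (w : 'cV[R]_3) : 0 <= r -> nsq w = 1 -> enorm (r *: w) = r.
Proof.
move=> r0 w1; have : enorm (r *: w) ^+ 2 = r ^+ 2.
  by rewrite enorm_sqr nsqZ w1 mulr1.
by move=> /eqP; rewrite eqrXn2// ?enorm_ge0// => /eqP.
Qed.

Lemma cballE (y : 'cV[R]_3) : cball 1 y <-> nsq y <= 1.
Proof.
rewrite /cball/= -enorm_sqr; have e0 := enorm_ge0 y; split => h; nra.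
Qed.

Lemma oballE (y : 'cV[R]_3) : oball 1 y <-> nsq y < 1.
Proof.
rewrite /oball/= -enorm_sqr; have e0 := enorm_ge0 y; split => h; nra.
Qed.

Lemma esphereE (y : 'cV[R]_3) : esphere 1 y <-> nsq y = 1.
Proof.
rewrite /esphere/= -enorm_sqr; have e0 := enorm_ge0 y; split => h; nra.
Qed.

Lemma nsq_line_derive (y v : 'cV[R]_3) :
  is_derive (0 : R) 1 (fun t => nsq (y + t *: v)) (2 * \sum_i y i 0 * v i 0).
Proof.
rewrite (_ : (fun t => _) = fun t : R =>
  nsq y + 2 * (\sum_i y i 0 * v i 0) * t + nsq v * t ^+ 2).
  have d := is_derive_id (0 : R) (1 : R).
  move: (2 * \sum_i y i 0 * v i 0) (nsq v) (nsq y) => a b c.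
  apply: is_derive_eq; rewrite /= !scaleRE; ring.
by apply/funext => t; rewrite nsq_line; ring.
Qed.

Definition entry (i : 'I_3) (y : 'cV[R]_3) : R := y i 0.

Lemma entry_is_linear i : linear (entry i).
Proof. by move=> a x y; rewrite /entry !mxE. Qed.
HB.instance Definition _ i :=
  GRing.isLinear.Build R 'cV[R]_3 R _ (entry i) (entry_is_linear i).

Lemma continuous_coord3 i : continuous (entry i).
Proof. by move=> y; exact: continuous_entry. Qed.

Lemma Ck_entry k (A : set 'cV[R]_3) i : Ck k A (fun y : 'cV[R]_3 => y i 0).
Proof. exact: (@Ck_linear _ _ _ k A (entry i) (@continuous_coord3 i)). Qed.

Lemma Ck_nsq k (A : set 'cV[R]_3) : open A -> Ck k A nsq.
Proof.
move=> oA; apply: Ck_sum => // i.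
by apply: (Ck_eq oA _ (CkM oA (Ck_entry k A i) (Ck_entry k A i))) => y _; rewrite expr2.
Qed.

Lemma continuous_nsq : continuous (nsq : 'cV[R]_3 -> R).
Proof.
by move=> y; exact: (@Ck_continuous _ _ _ 0 setT _ y (Ck_nsq 0 openT)).
Qed.

Lemma open_oball : open (oball 1 : set 'cV[R]_3).
Proof.
rewrite (_ : oball 1 = nsq @^-1` [set t | t < 1]).
  by apply: open_comp; [move=> z _; exact: continuous_nsq|exact: open_lt].
by apply/seteqP; split => z /=; rewrite oballE.
Qed.

(** Off the centre, T = s2 I + ((s1 - s2) / |y|^2) y y^T is differentiated along the axes. At the
centre this formula degenerates, but along the j-th axis the column j has the single entry
s1(t^2), whose derivative at t = 0 vanishes. Parametrising by r and w with r of any sign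
covers both sides of the centre. *)
Lemma div_spherical (T : 'cV[R]_3 -> 'M[R]_3) (s1 s2 d1 d2 m : R -> R) :
  (forall r w, nsq w = 1 -> r ^+ 2 < 1 ->
     T (r *: w) = s1 (r ^+ 2) *: P1 w + s2 (r ^+ 2) *: P2 w) ->
  (forall x : R, 0 <= x < 1 -> is_derive x 1 s1 (d1 x)) ->
  (forall x : R, 0 <= x < 1 -> is_derive x 1 s2 (d2 x)) ->
  (forall x : R, 0 <= x < 1 -> 2 * x * d1 x + 2 * (s1 x - s2 x) = x * m x) ->
  forall y, oball 1 y -> div_mx T y = m (nsq y) *: y.
Proof.
move=> TE ds1 ds2 ode y /oballE y1; apply/matrixP => i k; rewrite ord1 !mxE.
have [y0|yn0] := eqVneq y 0.
  rewrite y0 mxE mulr0 big1// => j _.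
  apply: derive_val; apply: line_is_derive.
  have d0 : is_derive (0 : R) 1 (fun t : R => (i == j)%:R * s1 (t ^+ 2)) 0.
    have x0 : (0 : R) ^+ 2 = 0 by rewrite expr0n.
    have := ds1 0; rewrite lexx ltr01 => /(_ isT) d; rewrite -x0 in d.
    have dq : is_derive (0 : R) 1 (fun t : R => t ^+ 2) 0.
      have d' := is_derive_id (0 : R) (1 : R).
      by apply: is_derive_eq; rewrite /= !scaleRE; ring.
    have := @is_derive1_comp R s1 (fun t : R => t ^+ 2) 0 _ _ d dq.
    rewrite mulr0 => dc; have := is_deriveZ (i == j)%:R dc.
    by move=> dz; apply: is_derive_eq dz _; rewrite scaler0.
  apply: near_eq_is_derive d0; near=> t.
  have t1 : t ^+ 2 < 1.
    have : `|t| < 1 by near: t; apply: (@nbhs0_lt R R); exact: ltr01.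
    by rewrite ltr_norml => /andP[ta tb]; nra.
  rewrite add0r TE//; last exact: nsq_delta.
  rewrite /P2 /P1 !mxE big_ord1 !mxE /= !eqxx !andbT mulr1.
  by case: (i == j); rewrite /=; ring.
set x := nsq y.
have x0 : 0 < x by rewrite lt_neqAle eq_sym nsq_eq0 yn0 nsq_ge0.
have xn0 : x != 0 by rewrite gt_eqF.
have x01 : 0 <= x < 1 by rewrite (ltW x0).
pose ga u := (s1 u - s2 u) / u.
pose dga := (d1 x - d2 x) / x - (s1 x - s2 x) / x ^+ 2.
have dgaE : is_derive x 1 ga dga.
  have h1 := ds1 _ x01; have h2 := ds2 _ x01.
  have hd := is_derive_id (x : R) (1 : R).
  have hV := @is_deriveV R _ _ _ _ xn0 hd.
  have := is_deriveM (is_deriveB h1 h2) hV.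
  move=> d; apply: is_derive_eq d _; rewrite /dga /= !fctE !scaleRE; field; exact: xn0.
have key j : 'D_(delta_mx j 0) (fun z => T z i j) y =
  2 * y j 0 * d2 x * (i == j)%:R + 2 * y j 0 * dga * (y i 0 * y j 0) +
  ga x * ((i == j)%:R * y j 0 + y i 0).
  apply: derive_val; apply: line_is_derive.
  have q := nsq_line_derive y (delta_mx j 0).
  rewrite (bigD1 j)//= big1 ?addr0 in q; last first.
    by move=> l lj; rewrite mxE (negbTE lj) mulr0.
  rewrite mxE !eqxx mulr1 in q.
  have q0 : nsq (y + 0 *: delta_mx j 0) = x by rewrite scale0r addr0.
  have e1 := ds2 _ x01; rewrite -q0 in e1.
  have e2 := dgaE; rewrite -{1}q0 in e2.
  have c1 := @is_derive1_comp R s2 (fun t => nsq (y + t *: delta_mx j 0)) 0 _ _ e1 q.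
  have c2 := @is_derive1_comp R ga (fun t => nsq (y + t *: delta_mx j 0)) 0 _ _ e2 q.
  have d0 : is_derive (0 : R) 1 (fun t : R =>
      s2 (nsq (y + t *: delta_mx j 0)) * (i == j)%:R +
      ga (nsq (y + t *: delta_mx j 0)) *
        ((y i 0 + t * (i == j)%:R) * (y j 0 + t)))
      (2 * y j 0 * d2 x * (i == j)%:R + 2 * y j 0 * dga * (y i 0 * y j 0) +
       ga x * ((i == j)%:R * y j 0 + y i 0)).
    have hd := is_derive_id (0 : R) (1 : R).
    have h1 : is_derive (0 : R) 1 (fun t : R => (y i 0 + t * (i == j)%:R) * (y j 0 + t))
      ((i == j)%:R * y j 0 + y i 0).
      move: (y i 0) (y j 0) ((i == j)%:R : R) => a b c.
      by apply: is_derive_eq; rewrite /= !scaleRE; ring.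
    have h2 := is_deriveM c2 h1.
    have h3 := is_deriveM c1 (is_derive_cst ((i == j)%:R : R) (0 : R) (1 : R)).
    have := is_deriveD h3 h2; move=> d; apply: is_derive_eq d _.
    rewrite /= scale0r !addr0 mul0r addr0 -/x !scaleRE.
    by move: (y i 0) (y j 0) ((i == j)%:R : R) (dga) (ga x) => a b c e g; ring.
  have op : nbhs y (oball 1 `&` [set z | z != 0] : set 'cV[R]_3).
    apply: filterI; first exact: open_nbhs_nbhs (conj open_oball ((oballE y).2 y1)).
    apply: open_nbhs_nbhs; split => //.
    rewrite (_ : [set z | _] = nsq @^-1` [set t | t != 0]).
      apply: open_comp; last exact: open_neq.
      by move=> z _; exact: continuous_nsq.
    by apply/seteqP; split => z /=; rewrite nsq_eq0.
  apply: near_eq_is_derive d0; near=> t.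
  have [tb tn0] : (oball 1 `&` [set z | z != 0]) (y + t *: delta_mx j 0).
    by near: t; exact: near_line.
  have := tb => /oballE; move: tn0; set z := y + _ => /= zn0 z1.
  have [w w1 zE] := polar_form z.
  have r2 : enorm z ^+ 2 = nsq z by exact: enorm_sqr.
  rewrite zE TE//; last by rewrite r2.
  rewrite -zE r2.
  have zi l : z l 0 = enorm z * w l 0 by rewrite {1}zE mxE.
  have -> : y i 0 + t * (i == j)%:R = z i 0 by rewrite !mxE eqxx andbT.
  have -> : y j 0 + t = z j 0 by rewrite !mxE !eqxx mulr1.
  have -> : ga (nsq z) = (s1 (nsq z) - s2 (nsq z)) / enorm z ^+ 2 by rewrite /ga r2.
  rewrite !zi /P2 /P1 !mxE big_ord1 !mxE.
  have en : enorm z != 0 by rewrite -sqrf_eq0 r2 nsq_eq0.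
  move: (s1 _) (s2 _) (w i 0) (w j 0) ((i == j)%:R : R) => a b c e f.
  by field.
under eq_bigr => j _ do rewrite key.
rewrite !big_split/=.
rewrite (_ : \sum_j ga x * _ = ga x * (4 * y i 0)); last first.
  have E0 : \sum_j (i == j)%:R * y j 0 = y i 0.
    rewrite (bigD1 i)//= eqxx mul1r big1 ?addr0// => j ji.
    by rewrite eq_sym (negbTE ji) mul0r.
  rewrite -mulr_sumr; congr (_ * _); rewrite big_split/= E0.
  by rewrite sumr_const card_ord -mulr_natl; ring.
rewrite (_ : \sum_j 2 * y j 0 * d2 x * _ = 2 * y i 0 * d2 x); last first.
  rewrite (bigD1 i)//= eqxx mulr1 big1 ?addr0// => j ji.
  by rewrite eq_sym (negbTE ji) mulr0.
rewrite (_ : \sum_j 2 * y j 0 * dga * _ = 2 * x * dga * y i 0); last first.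
  rewrite /x /nsq mulr_sumr !mulr_suml; apply: eq_bigr => j _.
  by ring.
have := ode _ x01; rewrite /dga /ga.
move: (y i 0) (d1 x) (d2 x) (s1 x) (s2 x) (m x) => a b c d e f E.
have -> : f = (2 * x * b + 2 * (d - e)) / x by rewrite E mulrAC mulfV ?mul1r.
by field; exact: xn0.
Unshelve. all: by end_near. Qed.

End Divergence.

(** * Radial maps of the ball *)

Section Radial.
Context {R : realType}.

(** Convexity of the sum of squares, coordinate by coordinate. *)
Lemma cball_convex (y z : 'cV[R]_3) (t : R) : cball 1 y -> cball 1 z ->
  0 <= t <= 1 -> cball 1 (y + t *: (z - y)).
Proof.
move=> /cballE y1 /cballE z1 /andP[t0 t1]; apply/cballE.
apply: (@le_trans _ _ ((1 - t) * nsq y + t * nsq z)); last by nra.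
rewrite /nsq !mulr_sumr -big_split/=; apply: ler_sum => i _; rewrite !mxE.
move: (y i 0) (z i 0) => a b.
rewrite -subr_ge0 (_ : _ - _ = t * (1 - t) * (a - b) ^+ 2); last by ring.
by rewrite mulr_ge0 ?sqr_ge0// mulr_ge0// subr_ge0.
Qed.

Lemma cball_nbhs0 : nbhs (0 : 'cV[R]_3) (cball 1).
Proof.
have o0 : oball 1 (0 : 'cV[R]_3).
  by apply/oballE; rewrite (eqP (_ : nsq 0 == 0)) ?ltr01// nsq_eq0.
apply: filterS (open_nbhs_nbhs (conj open_oball o0)) => y /oballE y1.
by apply/cballE; exact: ltW.
Qed.

Lemma cball_starlike (y : 'cV[R]_3) : cball 1 y -> starlike (cball 1) y.
Proof.
by move=> y1; apply: (starlike_convex cball_nbhs0 y1); exact: cball_convex.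
Qed.

Lemma I01_starlike (r : R) : I01 r -> starlike I01 r.
Proof.
move=> r01; apply: (@starlike_convex R R I01 (1 / 2)); [|exact: r01|].
  apply: filterS (_ : nbhs (1 / 2 : R) [set` `]0, 1[]) => [x|].
    by rewrite /I01/= in_itv/= => /andP[a b]; rewrite (ltW a) (ltW b).
  by apply: near_in_itv; rewrite in_itv/=; lra.
move=> y z t /andP[y0 y1] /andP[z0 z1] /andP[t0 t1].
by rewrite /I01/= !scaleRE; apply/andP; split; nra.
Qed.

(** Using |y|^2 rather than |y| keeps the map smooth at the centre. *)
Definition rad_map (G : R -> R) (y : 'cV[R]_3) : 'cV[R]_3 := G (nsq y) *: y.
Definition rad_fun (G : R -> R) (r : R) : R := r * G (r ^+ 2).

(** The radial principal stretch: the derivative of r G(r^2), as a function of x = r^2. *)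
Definition rstretch (G : R -> R) (x : R) : R := G x + 2 * x * 'd G x 1.

Lemma is_derive_linear {W W' : normedModType R} (L : {linear W -> W'}) (f : R -> W)
    (x : R) (d : W) :
  continuous L -> is_derive x 1 f d -> is_derive x 1 (fun t => L (f t)) (L d).
Proof.
move=> cL [/derivable1_diffP df fE].
have dL : differentiable L (f x) by exact: linear_differentiable.
have dc : differentiable (L \o f) x by exact: differentiable_comp.
split; first by apply/derivable1_diffP.
by rewrite deriveE// diff_comp// diff_lin//= -fE deriveE.
Qed.

Variables (U : set R) (G : R -> R).
Hypothesis oU : open U.
Hypothesis UI : forall x : R, 0 <= x <= 1 -> U x.
Hypothesis cG : Ck 2 U G.

Let p := rad_map G.
Let phi := rad_fun G.

Lemma rad_derive x : U x -> is_derive x 1 G ('d G x 1).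
Proof. exact: Ck_derivable cG. Qed.

Lemma rad_derive2 x : U x -> is_derive x 1 (fun x : R => 'd G x 1) ('d (fun x : R => 'd G x 1) x 1).
Proof. by move=> Ux; exact: (@Ck_derivable R 0 U (fun x : R => 'd G x 1) x (cG.2 1) Ux). Qed.

Let V : set 'cV[R]_3 := [set y | U (nsq y)].

Lemma open_rad : open V.
Proof.
rewrite (_ : V = nsq @^-1` U)//; apply: open_comp oU => z _.
exact: continuous_nsq.
Qed.

Lemma cball_rad : cball 1 `<=` V.
Proof. by move=> y /cballE y1; apply: UI; rewrite nsq_ge0. Qed.

Lemma Ck_rad_entry i : Ck 2 V (fun y : 'cV[R]_3 => G (nsq y) * y i 0).
Proof.
apply: CkM; [exact: open_rad| |exact: Ck_entry].
by apply: (Ck_comp open_rad _ (Ck_nsq 2 open_rad) cG).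
Qed.

Lemma rad_map_sum y : p y = \sum_i (G (nsq y) * y i 0) *: delta_mx i 0.
Proof.
have yE : y = \sum_i y i 0 *: delta_mx i 0.
  rewrite {1}(matrix_sum_delta y); apply: eq_bigr => i _.
  by rewrite big_ord1.
rewrite /p /rad_map; move: (G _) => g; rewrite {1}yE scaler_sumr.
by apply: eq_bigr => i _; rewrite scalerA.
Qed.

Lemma Ck_rad_map : Ck 2 V p.
Proof.
apply: (Ck_eq open_rad (fun y _ => esym (rad_map_sum y))).
by apply: (Ck_sum open_rad) => i; exact: (CkZl _ open_rad (Ck_rad_entry i)).
Qed.

Lemma diff_rad_map y v i : V y ->
  'd p y v i 0 = G (nsq y) * v i 0 + 2 * 'd G (nsq y) 1 * (\sum_k y k 0 * v k 0) * y i 0.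
Proof.
move=> Vy.
have dp : differentiable p y by exact: Ck_rad_map.1.
have dl := line_derive v dp.
have dl' : is_derive (0 : R) 1 (fun t => p (y + t *: v) i 0) ('d p y v i 0).
  exact: (is_derive_linear (@continuous_coord3 R i) dl).
have q := nsq_line_derive y v.
have q0 : nsq (y + 0 *: v) = nsq y by rewrite scale0r addr0.
have e1 := rad_derive Vy; rewrite -q0 in e1.
have c1 := @is_derive1_comp R G (fun t => nsq (y + t *: v)) 0 _ _ e1 q.
have h1 : is_derive (0 : R) 1 (fun t : R => (y + t *: v) i 0) (v i 0).
  rewrite (_ : (fun t => _) = fun t : R => y i 0 + t * v i 0).
    have hd := is_derive_id (0 : R) (1 : R).
    by move: (y i 0) (v i 0) => a b; apply: is_derive_eq; rewrite /= !scaleRE; ring.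
  by apply/funext => t; rewrite !mxE.
have n : \forall t \near (0 : R), p (y + t *: v) i 0 =
    ((fun t => G (nsq (y + t *: v))) * (fun t => (y + t *: v) i 0)) t.
  by near=> t; rewrite /p /rad_map mxE.
rewrite (is_derive_near_unique dl' (is_deriveM c1 h1) n).
rewrite /= scale0r addr0 !scaleRE; move: (G _) ('d G _ 1) (\sum_k _) => a b c; ring.
Unshelve. all: by end_near. Qed.

Lemma grad_rad y : cball 1 y ->
  grad_on (cball 1) p y = G (nsq y) *: 1%:M + (2 * 'd G (nsq y) 1) *: (y *m y^T).
Proof.
move=> y1; have Vy := cball_rad y1.
have dp : differentiable p y by exact: Ck_rad_map.1.
have [_ E] := diff_on_ext y1 (cball_starlike y1) (fun _ _ => erefl) dp.
apply/matrixP => i j; rewrite mxE E diff_rad_map// !mxE big_ord1 !mxE.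
rewrite (bigD1 j)//= mxE !eqxx mulr1 big1 ?addr0; last first.
  by move=> k kj; rewrite mxE (negbTE kj) mulr0.
by rewrite andbT; ring.
Qed.

(** At the centre [w] is arbitrary, both stretches being equal there. *)
Lemma grad_Fsph (r : R) (w : 'cV[R]_3) : nsq w = 1 -> r ^+ 2 <= 1 ->
  grad_on (cball 1) p (r *: w) = Fsph (rstretch G (r ^+ 2)) (G (r ^+ 2)) w.
Proof.
move=> w1 r1; have E : nsq (r *: w) = r ^+ 2 by rewrite nsqZ w1 mulr1.
rewrite grad_rad; last by apply/cballE; rewrite E.
rewrite E FsphE /rstretch; congr (_ + _).
rewrite linearZ/= -scalemxAl -scalemxAr !scalerA; congr (_ *: _); ring.
Qed.

Lemma rad_fun_derive r : U (r ^+ 2) -> is_derive r 1 phi (rstretch G (r ^+ 2)).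
Proof.
move=> Ur; have d := rad_derive Ur.
have hd := is_derive_id (r : R) (1 : R).
have dq : is_derive (r : R) 1 (fun t : R => t ^+ 2) (2 * r).
  by apply: is_derive_eq; rewrite /= !scaleRE; ring.
have c := @is_derive1_comp R G (fun t : R => t ^+ 2) r _ _ d dq.
have := is_deriveM hd c; move=> dM; apply: is_derive_eq dM _.
by rewrite /= /rstretch !scaleRE; ring.
Qed.

Lemma rstretch_derive r : U (r ^+ 2) ->
  is_derive r 1 (fun r => rstretch G (r ^+ 2))
    ((3 * 'd G (r ^+ 2) 1 + 2 * r ^+ 2 * 'd (fun x : R => 'd G x 1) (r ^+ 2) 1) * (2 * r)).
Proof.
move=> Ur; have d := rad_derive Ur; have d2 := rad_derive2 Ur.
have hd := is_derive_id (r ^+ 2 : R) (1 : R).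
have dq : is_derive (r : R) 1 (fun t : R => t ^+ 2) (2 * r).
  have hd' := is_derive_id (r : R) (1 : R).
  by apply: is_derive_eq; rewrite /= !scaleRE; ring.
have h2 : is_derive (r ^+ 2) 1 (fun x : R => 2 * x) 2.
  by apply: is_derive_eq; rewrite /= !scaleRE; ring.
have dd (a b : R) : is_derive (r ^+ 2) 1 G a ->
    is_derive (r ^+ 2) 1 (fun x : R => 'd G x 1) b ->
    'd G (r ^+ 2) 1 = a -> is_derive (r ^+ 2) 1 (rstretch G) (3 * a + 2 * r ^+ 2 * b).
  move=> da db aE; have := is_deriveD da (is_deriveM h2 db).
  move=> dM; apply: is_derive_eq dM _.
  by rewrite /= !scaleRE aE; move: (r ^+ 2) => c; ring.
have := dd _ _ d d2 erefl => {}dd.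
exact: (@is_derive1_comp R (rstretch G) (fun t : R => t ^+ 2) r _ _ dd dq).
Qed.

Lemma enorm_rad y : 0 <= G (nsq y) -> enorm (p y) = phi (enorm y).
Proof.
move=> G0; have [w w1 yE] := polar_form y; have e0 := enorm_ge0 y.
have nE : nsq y = enorm y ^+ 2 by rewrite enorm_sqr.
rewrite /p /rad_map {2}yE scalerA enormZ//; last by rewrite mulr_ge0.
by rewrite /phi /rad_fun mulrC nE.
Qed.

Lemma rad_mapE y : p y = phi (enorm y) *: udir y.
Proof.
rewrite /p /rad_map /udir /phi /rad_fun scalerA -enorm_sqr.
have [y0|y0] := eqVneq (enorm y) 0; last by congr (_ *: _); field.
have -> : y = 0 by apply/eqP; rewrite -nsq_eq0 -enorm_sqr y0 expr0n.
by rewrite !scaler0.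
Qed.

Lemma I01_sqr (r : R) : (I01 : set R) r -> 0 <= r ^+ 2 <= 1.
Proof. by move=> /andP[r0 r1]; apply/andP; split; nra. Qed.

Lemma I01_enorm y : cball 1 y -> (I01 : set R) (enorm y).
Proof. by move=> y1; rewrite /I01/= enorm_ge0. Qed.

Hypothesis G_gt0 : forall x : R, 0 <= x <= 1 -> 0 < G x.
Hypothesis rstretch_gt0 : forall x : R, 0 <= x <= 1 -> 0 < rstretch G x.

Lemma rad_fun_deriv_on (r : R) : I01 r -> deriv_on 1 I01 phi r = rstretch G (r ^+ 2).
Proof.
move=> r01; have d t : I01 t -> is_derive t 1 phi (rstretch G (t ^+ 2)).
  by move=> t01; exact: rad_fun_derive (UI (I01_sqr t01)).
exact: (@deriv_on1E R R I01 phi phi (fun t => rstretch G (t ^+ 2)) I01_starlike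
  (fun _ _ => erefl) d r r01).
Qed.

Lemma rad_fun_mono r s : 0 <= r -> r < s -> s <= 1 -> phi r < phi s.
Proof.
move=> r0 rs s1.
have t01 t : r <= t <= s -> 0 <= t ^+ 2 <= 1.
  by move=> /andP[rt ts]; apply/andP; split; nra.
have d t : r <= t <= s -> is_derive t 1 phi (rstretch G (t ^+ 2)).
  by move=> /t01 h; exact: rad_fun_derive (UI h).
have d' t : t \in `]r, s[ -> is_derive t 1 phi (rstretch G (t ^+ 2)).
  by rewrite in_itv/= => /andP[a b]; apply: d; rewrite (ltW a) (ltW b).
have cphi : {within `[r, s], continuous phi}.
  by apply: within_itv_continuous => t t0; exact: is_derive_continuous (d t t0).
have [c crs E] := MVT rs d' cphi.
have c0 : 0 < rstretch G (c ^+ 2).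
  by apply/rstretch_gt0/t01; move: crs; rewrite in_itv/= => /andP[a b]; rewrite (ltW a) (ltW b).
by rewrite -subr_gt0 E mulr_gt0// subr_gt0.
Qed.

Lemma Ck_rad_fun : Ck 2 [set r | U (r ^+ 2)] phi.
Proof.
have o : open [set r : R | U (r ^+ 2)].
  rewrite (_ : [set r : R | _] = (fun r : R => r ^+ 2) @^-1` U)//.
  by apply: open_comp oU => z _; exact: exprn_continuous.
apply: (CkM o (Ck_id 2 _)).
have q : Ck 2 [set r : R | U (r ^+ 2)] (fun r : R => r ^+ 2).
  by apply: (Ck_eq o _ (CkM o (Ck_id 2 _) (Ck_id 2 _))) => r _; rewrite expr2.
exact: (Ck_comp o _ q cG).
Qed.

(** The second derivative of r G(r^2) is odd in r, so it vanishes at 0. *)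
Lemma spherical_rad : spherical_C2 phi p.
Proof.
have o : open [set r : R | U (r ^+ 2)].
  rewrite (_ : [set r : R | _] = (fun r : R => r ^+ 2) @^-1` U)//.
  by apply: open_comp oU => z _; exact: exprn_continuous.
have z01 : I01 (0 : R) by rewrite /I01/= lexx ler01.
split.
- apply: (Ck_on_of_Ck o _ I01_starlike (fun _ _ => erefl) Ck_rad_fun).
  by move=> r r01; exact: UI (I01_sqr r01).
- by rewrite /phi /rad_fun mul0r.
- rewrite (@deriv_on2E R R I01 phi phi (fun r => rstretch G (r ^+ 2))
    (fun r => (3 * 'd G (r ^+ 2) 1 + 2 * r ^+ 2 * 'd (fun x : R => 'd G x 1) (r ^+ 2) 1)
              * (2 * r)) I01_starlike (fun _ _ => erefl) _ _ 0 z01).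
  + by rewrite !mulr0.
  + by move=> t t01; exact: rad_fun_derive (UI (I01_sqr t01)).
  + by move=> t t01; exact: rstretch_derive (UI (I01_sqr t01)).
- by move=> r r01; rewrite rad_fun_deriv_on//; exact: rstretch_gt0 (I01_sqr r01).
- by move=> y _; exact: rad_mapE.
Qed.

(** Injectivity reduces to that of the increasing function r G(r^2), the direction being
preserved; the determinant is the product of the stretches. *)
Lemma op_rad : op_deformation p.
Proof.
split.
- move=> y z; rewrite !inE => y1 z1 pyz.
  have G1 u : cball 1 u -> 0 < G (nsq u).
    by move=> /cballE u1; apply: G_gt0; rewrite nsq_ge0.
  have e : enorm y = enorm z.
    have := congr1 enorm pyz; rewrite !enorm_rad ?(ltW (G1 _ _))// => E.
    have [yz|yz|//] := ltgtP (enorm y) (enorm z).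
      by have := rad_fun_mono (enorm_ge0 y) yz z1; rewrite E ltxx.
    by have := rad_fun_mono (enorm_ge0 z) yz y1; rewrite E ltxx.
  have en : nsq y = nsq z by rewrite -!enorm_sqr e.
  have := pyz; rewrite /p /rad_map en => /(congr1 ( *:%R (G (nsq z))^-1)).
  by rewrite !scalerA mulVf ?scale1r// gt_eqF// G1.
- move=> y y1; have Vy := cball_rad y1.
  have dp : differentiable p y by exact: Ck_rad_map.1.
  by have [] := diff_on_ext y1 (cball_starlike y1) (fun _ _ => erefl) dp.
- move=> y y1; have [w w1 yE] := polar_form y.
  have y01 := I01_sqr (I01_enorm y1).
  rewrite yE grad_Fsph//; last by case/andP: y01.
  by apply: GLp_Fsph; rewrite ?rstretch_gt0 ?G_gt0.
Qed.

Lemma rad_onto z : enorm z <= phi 1 ->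
  exists2 y, p y = z & I01 (enorm y) /\ phi (enorm y) = enorm z.
Proof.
move=> z1.
have cphi : {within `[0 : R, 1], continuous phi}.
  apply: within_itv_continuous => t t01.
  exact: is_derive_continuous (rad_fun_derive (UI (I01_sqr t01))).
have phi0 : phi 0 = 0 by rewrite /phi /rad_fun mul0r.
have [|r r01 rE] := IVT (v := enorm z) (ler01) cphi.
  have ph := le_trans (enorm_ge0 z) z1.
  by rewrite phi0 (min_idPl ph) (max_idPr ph) enorm_ge0 z1.
have [w w1 zE] := polar_form z.
have r0 : 0 <= r by case/andP: (r01 : 0 <= r <= 1).
exists (r *: w); last by rewrite enormZ.
rewrite /p /rad_map nsqZ w1 mulr1 scalerA [RHS]zE -rE /phi /rad_fun.
by rewrite mulrC.
Qed.

Lemma rad_oball : p @` oball 1 = oball (phi 1).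
Proof.
have o1 : I01 (1 : R) by rewrite /I01/= lexx ler01.
have G1 u : oball 1 u -> 0 <= G (nsq u).
  by move=> /oballE u1; apply/ltW/G_gt0; rewrite nsq_ge0 ltW.
apply/seteqP; split => [_ [y y1 <-]|z z1].
  by rewrite /oball/= enorm_rad ?G1//; exact: rad_fun_mono (enorm_ge0 y) y1 (lexx _).
have [y yz [/andP[y0 y1] yE]] := rad_onto (ltW z1).
exists y => //; rewrite /oball/= lt_neqAle y1 andbT; apply/eqP => e1.
have : enorm z < phi 1 := z1.
by rewrite -yE e1 ltxx.
Qed.

End Radial.

(** * Stress and equilibrium in terms of the principal stretches *)

Section SphericalStress.
Context {R : realType}.

Lemma powR_pred (x p : R) : 0 < x -> x `^ (p - 1) = x `^ p / x.
Proof.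
move=> x0; rewrite powRB; last by apply/implyP => _; rewrite gt_eqF.
by rewrite (powRr1 (ltW x0)).
Qed.

Definition sig1 (h : R) (w1 : R -> R) (g z : R) : R := g `^ (h - 1) * w1 z.
Definition sig2 (h : R) (w0 w1 : R -> R) (g z : R) : R :=
  g `^ (h - 1) * (h * w0 z - (1 + z) * w1 z) / 2.

Lemma energy_stretch (h l1 l2 : R) (f : R -> R) : 0 < l1 -> 0 < l2 ->
  (l1 * l2 ^+ 2) `^ (h / 3) * f (l1 / l2) = l2 `^ h * wz0 h f (l1 / l2 - 1).
Proof.
move=> l10 l20; have u0 : 0 < l1 / l2 by rewrite divr_gt0.
rewrite /wz0 subrKC mulrA; congr (_ * _).
have -> : l1 * l2 ^+ 2 = l2 `^ 3 * (l1 / l2).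
  by rewrite (powR_mulrn 3 (ltW l20)); field; rewrite gt_eqF.
rewrite powRM ?powR_ge0 ?(ltW u0)// -powRrM; congr (_ `^ _ * _).
by field.
Qed.

(** The two directional derivatives are computed along the lines where one of the stretches
varies. *)
Lemma piola_stretch (W : 'M[R]_3 -> R) (h : R) (w0 w1 : R -> R) (l1 l2 : R)
    (w : 'cV[R]_3) :
  (forall F, GLp F -> differentiable W F) -> objective W -> isotropic W ->
  (forall l1 l2, 0 < l1 -> 0 < l2 ->
     W (Fsph l1 l2 w) = l2 `^ h * w0 (l1 / l2 - 1)) ->
  0 < l1 -> 0 < l2 -> nsq w = 1 ->
  is_derive (l1 / l2 - 1) 1 w0 (w1 (l1 / l2 - 1)) ->
  piola_kirchhoff W (Fsph l1 l2 w) =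
    sig1 h w1 l2 (l1 / l2 - 1) *: P1 w + sig2 h w0 w1 l2 (l1 / l2 - 1) *: P2 w.
Proof.
move=> dW oW iW WE l10 l20 nw dw.
have ln : l2 != 0 by rewrite gt_eqF.
have GF := GLp_Fsph l10 l20 nw.
rewrite piola_Fsph//.
set z := l1 / l2 - 1 in dw *.
have hd := is_derive_id (0 : R) (1 : R).
have small (a : R) : 0 < a -> \forall t \near (0 : R), 0 < a + t.
  move=> a0; near=> t; have : `|t| < a by near: t; exact: (@nbhs0_lt R R).
  by rewrite ltr_norml => /andP[? _]; lra.
congr (_ *: _ + _ *: _).
- have da : is_derive (0 : R) 1 (fun t : R => (l1 + t) / l2 - 1) l2^-1.
    by apply: is_derive_eq; rewrite /= !scaleRE; ring.
  have z0 : (l1 + 0) / l2 - 1 = z by rewrite addr0.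
  have dw' := dw; rewrite -{1}z0 in dw'.
  have dc := @is_derive1_comp R w0 (fun t : R => (l1 + t) / l2 - 1) 0 _ _ dw' da.
  have dz := is_deriveZ (l2 `^ h) dc.
  rewrite (is_derive_near_unique (line_derive (P1 w) (dW _ GF)) dz) => [|].
    by rewrite /sig1 powR_pred// !scaleRE; ring.
  apply: filterS (small _ l10) => t t0.
  rewrite -[RHS]/(_ * _) -WE//; congr W; rewrite /Fsph scalerDl.
  by rewrite addrAC.
- have da : is_derive (0 : R) 1 (fun t : R => l1 / (l2 + t) - 1) (- (l1 / l2 ^+ 2)).
    have l0 : l2 + 0 != 0 by rewrite addr0.
    have hl : is_derive (0 : R) 1 (fun t : R => l2 + t) 1.
      by apply: is_derive_eq; rewrite /= ?scaleRE; ring.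
    have hV := @is_deriveV R _ _ _ _ l0 hl.
    have := is_deriveB (is_deriveZ l1 hV) (is_derive_cst (1 : R) (0 : R) (1 : R)).
    move=> d; apply: is_derive_eq d _.
    by rewrite /= !scaleRE addr0; field; exact: ln.
  have z0 : l1 / (l2 + 0) - 1 = z by rewrite addr0.
  have dw' := dw; rewrite -{1}z0 in dw'.
  have dc := @is_derive1_comp R w0 (fun t : R => l1 / (l2 + t) - 1) 0 _ _ dw' da.
  have dp : is_derive (0 : R) 1 (fun t : R => (l2 + t) `^ h) (h * l2 `^ (h - 1)).
    have hl : is_derive (0 : R) 1 (fun t : R => l2 + t) 1.
      by apply: is_derive_eq; rewrite /= ?scaleRE; ring.
    have l20' : 0 < l2 + 0 by rewrite addr0.
    have := @is_derive1_comp R (fun x : R => x `^ h) (fun t : R => l2 + t) 0 _ _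
      (is_derive1_powR _ l20') hl.
    by rewrite addr0 mulr1.
  have dz := is_deriveM dp dc.
  rewrite (is_derive_near_unique (line_derive (P2 w) (dW _ GF)) dz) => [|].
    rewrite /sig2 powR_pred// [(_ \o _) _]/= addr0 -/z !scaleRE.
    have -> : 1 + z = l1 / l2 by rewrite /z subrKC.
    move: (l2 `^ h) (w0 z) (w1 z) => a b c; field; exact: ln.
  apply: filterS (small _ l20) => t t0.
  rewrite -[RHS]/(_ * _) -WE//; congr W; rewrite /Fsph scalerDl.
  by rewrite addrA.
Unshelve. all: by end_near. Qed.

Section RadialStress.
Variables (h mu : R) (w0 w1 w2 G G1 v v1 : R -> R) (x : R).
Hypothesis dw0 : is_derive (v x) 1 w0 (w1 (v x)).
Hypothesis dw1 : is_derive (v x) 1 w1 (w2 (v x)).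
Hypothesis dG : is_derive x 1 G (G1 x).
Hypothesis dv : is_derive x 1 v (v1 x).
Hypothesis G_gt0 : 0 < G x.

Definition dsig1 := (h - 1) * G x `^ (h - 1 - 1) * G1 x * w1 (v x) +
  G x `^ (h - 1) * (w2 (v x) * v1 x).
Definition dsig2 := ((h - 1) * G x `^ (h - 1 - 1) * G1 x *
    (h * w0 (v x) - (1 + v x) * w1 (v x)) +
  G x `^ (h - 1) * (h * w1 (v x) - w1 (v x) - (1 + v x) * w2 (v x)) * v1 x) / 2.

Let dA : is_derive x 1 (fun x => G x `^ (h - 1)) ((h - 1) * G x `^ (h - 1 - 1) * G1 x).
Proof.
exact: (@is_derive1_comp R (fun x : R => x `^ (h - 1)) G x _ _ (is_derive1_powR _ G_gt0) dG).
Qed.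

Lemma is_derive_sig1 : is_derive x 1 (fun x => sig1 h w1 (G x) (v x)) dsig1.
Proof.
have d1 := is_deriveM dA (@is_derive1_comp R w1 v x _ _ dw1 dv).
move: d1 => d; apply: is_derive_eq d _; rewrite /= !scaleRE /dsig1; ring.
Qed.

Lemma is_derive_sig2 : is_derive x 1 (fun x => sig2 h w0 w1 (G x) (v x)) dsig2.
Proof.
have c0 := @is_derive1_comp R w0 v x _ _ dw0 dv.
have c1 := @is_derive1_comp R w1 v x _ _ dw1 dv.
have c2 := is_deriveB (is_deriveZ h c0) (is_deriveM (is_deriveD (is_derive_cst (1 : R) x (1 : R)) dv) c1).
have d1 := is_deriveZ 2^-1 (is_deriveM dA c2).
have E : (fun x => sig2 h w0 w1 (G x) (v x)) =
  2^-1 *: ((fun x => G x `^ (h - 1)) * (h *: (w0 \o v) - (cst 1 + v) * (w1 \o v))).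
  by apply/funext => t; rewrite /sig2 mulrC.
rewrite E; move: d1 => d; apply: is_derive_eq d _; rewrite /= ?fctE /= !scaleRE /dsig2. ring.
Qed.

(** The relation 2 x G' = v G removes G', after which G^(h-1) is a common factor of the left-hand
side and G^(h-1) G^(2-h) = G. *)
Lemma radial_equation :
  2 * x * G1 x = v x * G x ->
  2 * x * v1 x * w2 (v x) + ((3 + h * v x) * w1 (v x) - h * w0 (v x)) =
    mu * x * G x `^ (2 - h) ->
  2 * x * dsig1 + 2 * (sig1 h w1 (G x) (v x) - sig2 h w0 w1 (G x) (v x)) =
    x * (mu * G x).
Proof.
move=> GE ode; have gn : G x != 0 by rewrite gt_eqF.
rewrite /dsig1 /sig1 /sig2 (powR_pred _ G_gt0).
set A := G x `^ (h - 1).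
have A0 : A != 0 by rewrite gt_eqF// powR_gt0.
have E2 : G x `^ (2 - h) = G x / A.
  rewrite (_ : 2 - h = 1 - (h - 1)); last by ring.
  rewrite powRB; last by apply/implyP => _; rewrite gn.
  by rewrite (powRr1 (ltW G_gt0)).
rewrite E2 in ode.
have E3 : G1 x * x = v x * G x / 2 by rewrite -GE; field.
have -> : x * (mu * G x) = A * (mu * x * (G x / A)) by field; exact: A0.
rewrite -ode.
have -> : 2 * x * ((h - 1) * (A / G x) * G1 x * w1 (v x) + A * (w2 (v x) * v1 x)) =
  2 * (h - 1) * (A / G x) * (G1 x * x) * w1 (v x) + 2 * x * (A * (w2 (v x) * v1 x)).
  by ring.
rewrite E3; move: gn; move: (G x) (v x) (w1 _) (w0 _) (w2 _) (v1 x) (A) => g z a b c d e gn.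
by field; exact: gn.
Qed.

End RadialStress.
End SphericalStress.

(** * Existence of the eigenstate *)

Section Eigenstate.
Context {R : realType}.

(** What remains of the elastic problem once the stress is computed: [s1] and [s2] are the radial
and tangential stresses as functions of x = |y|^2, [d1] and [d2] their derivatives. *)
Record eigenstate (W : 'M[R]_3 -> R) (h : R) (U : set R) (G : R -> R) (mu : R)
    (s1 s2 d1 d2 : R -> R) : Prop := Eigenstate {
  es_open : open U;
  es_sub : forall x : R, 0 <= x <= 1 -> U x;
  es_C2 : Ck 2 U G;
  es_gt0 : forall x : R, 0 <= x <= 1 -> 0 < G x;
  es_rstretch : forall x : R, 0 <= x <= 1 -> 0 < rstretch G x;
  es_stress : forall (r : R) (w : 'cV[R]_3), nsq w = 1 -> r ^+ 2 <= 1 ->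
    piola_kirchhoff W (Fsph (rstretch G (r ^+ 2)) (G (r ^+ 2)) w) =
      s1 (r ^+ 2) *: P1 w + s2 (r ^+ 2) *: P2 w;
  es_d1 : forall x : R, 0 <= x < 1 -> is_derive x 1 s1 (d1 x);
  es_d2 : forall x : R, 0 <= x < 1 -> is_derive x 1 s2 (d2 x);
  es_ode : forall x : R, 0 <= x < 1 ->
    2 * x * d1 x + 2 * (s1 x - s2 x) = x * (mu * G x);
  es_bc : s1 1 = 0 }.

Lemma diff_is_derive (f : R -> R) (x d : R) : is_derive x 1 f d -> 'd f x 1 = d.
Proof. by move=> [/derivable1_diffP df <-]; rewrite deriveE. Qed.

Lemma kappah_gt0 (h : R) : 0 < kappah h -> h < 0 \/ 3 < h.
Proof.
move=> k0; have [h0|h0] := ltP h 0; first by left.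
right; rewrite ltNge; apply/negP => h3; move: k0; rewrite /kappah; nra.
Qed.

(** With [C] the bound of [wz3_le], the profile exists when W0 mrad >= 20 |h|; as
W0 = f''(1) + kappa(h) and kappa(h) > 0, a condition on f''(1) suffices. The comparison of
G with 1 is the mean value theorem for G' = v G / (2 x). *)
Lemma eigenstate_exists (h M : R) : 0 < kappah h -> 0 <= M ->
  exists beta0 : R, forall (W : 'M[R]_3 -> R) (f : R -> R),
    strain_energy W -> objective W -> isotropic W ->
    (forall l1 l2 w, 0 < l1 -> 0 < l2 -> esphere 1 w ->
       W (Fsph l1 l2 w) = (l1 * l2 ^+ 2) `^ (h / 3) * f (l1 / l2)) ->
    classC M f -> beta0 <= betaf f ->
  exists (U : set R) (G : R -> R) (mu : R) (s1 s2 d1 d2 : R -> R),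
    [/\ eigenstate W h U G mu s1 s2 d1 d2, G 0 = 1,
        Num.sg mu = - Num.sg h,
        h < 0 -> forall x : R, 0 < x <= 1 -> G x < rstretch G x /\ 1 < G x &
        3 < h -> forall x : R, 0 < x <= 1 -> rstretch G x < G x /\ G x < 1].
Proof.
move=> kh M0; have C0 := wconst_ge0 h M0; have [m0 _ _ _] := mrad_spec h C0.
exists (Num.max 1 (20 * `|h| / mrad h (wconst h M))) => W f [sW _] oW iW WE cf.
rewrite ge_max => /andP[b1 bm].
have hc := kappah_gt0 kh.
have hn0 : h != 0 by case: hc => hh; [rewrite lt_eqF|rewrite gt_eqF//; lra].
have h2 : 2 - h != 0 by case: hc => hh; [rewrite gt_eqF//|rewrite lt_eqF//]; lra.
have dW F : GLp F -> differentiable W F.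
  by apply: (Ck_of_Ck_on open_GLp (fun _ => id) (sW 1)).1.
have [f1 [f2 [f3 [df0 df1 df2 f3b [f_1 f1_1 f2_1]]]]] := class_derivatives cf.
have [W0 W1 W2] := wz_at0 h f_1 f1_1 f2_1.
set w0 := wz0 h f; set w1 := wz1 h f f1; set w2 := wz2 h f f1 f2.
have dw0 := dwz0 h df0; have dw1 := dwz1 h df0 df1; have dw2 := dwz2 h df0 df1 df2.
have w3b := wz3_le kh M0 b1 df0 df1 df2 f3b f_1 f1_1 f2_1.
have Wp : 0 < betaf f + kappah h by rewrite ltr_wpDl// (le_trans ler01).
have big : 20 * `|h| <= (betaf f + kappah h) * mrad h (wconst h M).
  rewrite -ler_pdivrMr//; apply: le_trans bm _.
  by rewrite lerDl ltW.
have [U [G [G1 [v [v1 [mu [[oU UI] cG prof [G0 bc] [vs smu]]]]]]]] :=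
  radial_profile C0 hn0 h2 Wp dw0 dw1 dw2 W0 W1 W2 w3b big.
have rstretchE x : U x -> rstretch G x = (1 + v x) * G x.
  move=> Ux; have [dG _ _ [_ GE] _] := prof x Ux.
  by rewrite /rstretch (diff_is_derive dG) GE; ring.
have vb x : U x -> 0 < 1 + v x.
  by move=> Ux; have [_ _ _ [+ _] _] := prof x Ux; rewrite ltr_norml => /andP[? _]; lra.
exists U, G, mu, (fun x => sig1 h w1 (G x) (v x)), (fun x => sig2 h w0 w1 (G x) (v x)),
  (dsig1 h w1 w2 G G1 v v1), (dsig2 h w0 w1 w2 G G1 v v1).
have le1 x : 0 <= x < 1 -> U x by move=> /andP[x0 x1]; apply: UI; rewrite x0 ltW.
have Gmono x : 0 < x <= 1 -> exists2 c, 0 < c <= 1 & G x - 1 = v c * G c / (2 * c) * x.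
  move=> /andP[x0 x1].
  have tU t : 0 <= t <= x -> U t.
    by move=> /andP[t0 tx]; apply: UI; rewrite t0 (le_trans tx x1).
  have d t : t \in `]0, x[ -> is_derive t 1 G (G1 t).
    rewrite in_itv/= => /andP[t0 tx].
    have /prof[] // : U t by apply: tU; rewrite (ltW t0) (ltW tx).
  have cG' : {within `[0, x], continuous G}.
    apply: within_itv_continuous => t t0; have [dG _ _ _ _] := prof t (tU t t0).
    exact: is_derive_continuous dG.
  have [c] := MVT x0 d cG'; rewrite in_itv/= => /andP[c0 cx]; rewrite G0 subr0 => E.
  exists c; first by rewrite c0 (ltW (lt_le_trans cx x1)).
  have /prof[_ _ _ [_ <-] _] : U c by apply: tU; rewrite (ltW c0) (ltW cx).
  by rewrite E; field; rewrite gt_eqF.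
have UIoc x : 0 < x <= 1 -> U x by move=> /andP[x0 x1]; apply: UI; rewrite (ltW x0).
have sgn e : (forall c, 0 < c <= 1 -> 0 < e * v c) ->
  forall x, 0 < x <= 1 -> 0 < e * (rstretch G x - G x) /\ 0 < e * (G x - 1).
  move=> ev x x01; have Gp c : 0 < c <= 1 -> 0 < G c.
    by move=> /UIoc/prof[].
  split.
    rewrite rstretchE; last exact: UIoc.
    by rewrite mulrDl mul1r addrC addKr mulrA mulr_gt0 ?ev ?Gp.
  have [c c01 ->] := Gmono x x01; have /andP[c0 _] := c01; have /andP[x0 _] := x01.
  have c2 : 0 < (2 * c)^-1 by rewrite invr_gt0 mulr_gt0.
  by rewrite !mulrA; do 2!apply: (mulr_gt0 _) => //; rewrite mulr_gt0 ?ev ?Gp.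
split => //.
- split => //.
  + by move=> x /UI/prof[].
  + move=> x x01; have Ux := UI _ x01; rewrite rstretchE// mulr_gt0 ?vb//.
    by have [] := prof x Ux.
  + move=> r w nw r1; have r01 : 0 <= r ^+ 2 <= 1 by rewrite sqr_ge0.
    have Ux := UI _ r01; have [_ _ Gx [vx _] _] := prof _ Ux.
    have dl : 0 < rstretch G (r ^+ 2) by rewrite rstretchE// mulr_gt0 ?vb.
    have zE : rstretch G (r ^+ 2) / G (r ^+ 2) - 1 = v (r ^+ 2).
      by rewrite rstretchE// mulfK ?gt_eqF// addrC addKr.
    have WE' l1 l2 : 0 < l1 -> 0 < l2 ->
        W (Fsph l1 l2 w) = l2 `^ h * w0 (l1 / l2 - 1).
      by move=> l10 l20; rewrite WE ?energy_stretch//; exact/esphereE.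
    have dz : is_derive (rstretch G (r ^+ 2) / G (r ^+ 2) - 1) 1 w0
        (w1 (rstretch G (r ^+ 2) / G (r ^+ 2) - 1)).
      by rewrite zE; exact: dw0.
    by rewrite (piola_stretch dW oW iW WE' dl Gx nw dz) zE.
  + move=> x /le1 Ux; have [dG dv Gx [vx _] _] := prof x Ux.
    exact: (is_derive_sig1 h (dw1 _ vx) dG dv Gx).
  + move=> x /le1 Ux; have [dG dv Gx [vx _] _] := prof x Ux.
    exact: (is_derive_sig2 h (dw0 _ vx) (dw1 _ vx) dG dv Gx).
  + move=> x /le1 Ux; have [dG dv Gx [vx GE] ode] := prof x Ux.
    exact: radial_equation.
  + by rewrite /sig1 (bc : w1 (v 1) = 0) mulr0.
- move=> hh x x01; have [c|] := sgn 1 _ x x01.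
    by rewrite mul1r => /vs; rewrite ltr0_sg// opprK mul1r.
  by rewrite !mul1r !subr_gt0.
- move=> hh x x01; have [c|] := sgn (-1) _ x x01.
    by move=> /vs; rewrite gtr0_sg//; lra.
  by rewrite !mulN1r !opprB !subr_gt0.
Qed.

End Eigenstate.

(** * Scaled eigenstates and the space-time map *)

Section Motion.
Context {R : realType}.

Lemma is_derive_mulc (f : R -> R) (x k d : R) :
  is_derive x 1 f d -> is_derive x 1 (fun t => k * f t) (k * d).
Proof. by move=> df; have := is_deriveZ k df. Qed.

Section Scaled.
Variables (W : 'M[R]_3 -> R) (h : R) (U : set R) (G : R -> R) (mu : R)
  (s1 s2 d1 d2 : R -> R).
Hypothesis dW : forall F, GLp F -> differentiable W F.
Hypothesis hW : homogeneous h W.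
Hypothesis es : eigenstate W h U G mu s1 s2 d1 d2.
Variable c : R.
Hypothesis c_gt0 : 0 < c.

Let Gc x := c * G x.

Lemma scaled_rad : (fun y => c *: rad_map G y) = rad_map Gc.
Proof. by apply/funext => y; rewrite /rad_map scalerA. Qed.

Let cGc : Ck 2 U Gc.
Proof. exact: CkM (es_open es) (Ck_cst 2 _ _) (es_C2 es). Qed.

Let Gc_gt0 x : 0 <= x <= 1 -> 0 < Gc x.
Proof. by move=> x01; rewrite mulr_gt0// (es_gt0 es). Qed.

Let rstretchE x : 0 <= x <= 1 -> rstretch Gc x = c * rstretch G x.
Proof.
move=> /(es_sub es) Ux; have dG := rad_derive (es_C2 es) Ux.
have dc : is_derive x 1 Gc (c * 'd G x 1) by exact: is_derive_mulc dG.
by rewrite /rstretch (diff_is_derive dc) /Gc; ring.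
Qed.

Let rstretch_gt0 x : 0 <= x <= 1 -> 0 < rstretch Gc x.
Proof. by move=> x01; rewrite rstretchE// mulr_gt0// (es_rstretch es). Qed.

Lemma scaled_op : op_deformation (fun y => c *: rad_map G y).
Proof.
by rewrite scaled_rad; exact: op_rad (es_open es) (es_sub es) cGc Gc_gt0 rstretch_gt0.
Qed.

Lemma scaled_stress (r : R) (w : 'cV[R]_3) : nsq w = 1 -> r ^+ 2 <= 1 ->
  piola_kirchhoff W (grad_on (cball 1) (fun y => c *: rad_map G y) (r *: w)) =
    (c `^ (h - 1) * s1 (r ^+ 2)) *: P1 w + (c `^ (h - 1) * s2 (r ^+ 2)) *: P2 w.
Proof.
move=> w1 r1; have r01 : 0 <= r ^+ 2 <= 1 by rewrite sqr_ge0.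
rewrite scaled_rad (grad_Fsph (es_open es) (es_sub es) cGc)// rstretchE//.
rewrite (_ : Fsph _ _ w = c *: Fsph (rstretch G (r ^+ 2)) (G (r ^+ 2)) w); last first.
  by rewrite /Fsph [RHS]scalerDr !scalerA.
rewrite (piola_homogeneous dW hW)//; last first.
  by apply: GLp_Fsph => //; [exact: es_rstretch es _ r01|exact: es_gt0 es _ r01].
by rewrite (es_stress es)// scalerDr !scalerA.
Qed.

(** Multiplying the deformation by [c] multiplies the stress by c^(h-1). *)
Lemma scaled_div y : oball 1 y ->
  div_mx (fun z => piola_kirchhoff W
    (grad_on (cball 1) (fun y => c *: rad_map G y) z)) y =
  (mu * c `^ (h - 1)) *: rad_map G y.
Proof.
move=> y1; set k := c `^ (h - 1).
transitivity ((k * (mu * G (nsq y))) *: y); last first.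
  by rewrite /rad_map scalerA; congr (_ *: _); ring.
move: y y1; apply: (@div_spherical R _ (fun x => k * s1 x) (fun x => k * s2 x)
  (fun x => k * d1 x) (fun x => k * d2 x) (fun x => k * (mu * G x))).
- by move=> r w w1 /ltW r1; exact: scaled_stress.
- by move=> x x01; exact: is_derive_mulc (es_d1 es x01).
- by move=> x x01; exact: is_derive_mulc (es_d2 es x01).
- move=> x x01; have := es_ode es x01.
  move: (d1 x) (s1 x) (s2 x) (G x) => a b e g E.
  have -> : x * (k * (mu * g)) = k * (x * (mu * g)) by ring.
  by rewrite -E; ring.
Qed.

Lemma scaled_traction y : esphere 1 y ->
  piola_kirchhoff W (grad_on (cball 1) (fun y => c *: rad_map G y) y) *m udir y = 0.
Proof.
move=> y1; have n1 := iffLR (esphereE y) y1.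
have := @scaled_stress 1 y n1; rewrite expr1n lexx scale1r => /(_ isT) ->.
have -> : udir y = y by rewrite /udir (y1 : enorm y = 1) invr1 scale1r.
rewrite (es_bc es) mulr0 scale0r add0r -scalemxAl /P2 /P1 mulmxBl mul1mx.
by rewrite -mulmxA inner_nsq n1 mulmx1 subrr scaler0.
Qed.

Lemma scaled_oball :
  (fun y => c *: rad_map G y) @` oball 1 = oball (c * rad_fun G 1).
Proof.
rewrite scaled_rad (rad_oball (es_sub es) cGc Gc_gt0 rstretch_gt0).
by congr oball; rewrite /rad_fun /Gc; ring.
Qed.

End Scaled.

Lemma starlike_prod {V V' : normedModType R} (A : set V) (B : set V') x y :
  starlike A x -> starlike B y -> starlike (A `*` B) (x, y).
Proof.
move=> [c [e [e0 Ae]]] [c' [e' [e'0 Be]]]; exists (c, c'), (Num.min e e').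
split; first by rewrite lt_min e0.
move=> [v v'] t; rewrite prod_normE /= lt_min !gt_max => /andP[].
move=> /andP[v1 _] /andP[_ v2] t01; split => /=.
  exact: Ae.
exact: Be.
Qed.

Definition time_part (ty : R * 'cV[R]_3) : R := ty.1.
Definition space_part (i : 'I_3) (ty : R * 'cV[R]_3) : R := ty.2 i 0.

Lemma time_part_linear : linear time_part.
Proof. by []. Qed.
HB.instance Definition _ :=
  GRing.isLinear.Build R (R * 'cV[R]_3)%type R _ time_part time_part_linear.

Lemma space_part_linear i : linear (space_part i).
Proof. by move=> a x y; rewrite /space_part !mxE. Qed.
HB.instance Definition _ i :=
  GRing.isLinear.Build R (R * 'cV[R]_3)%type R _ (space_part i) (space_part_linear i).

Lemma Ck_time k O : Ck k O time_part.
Proof. by apply: Ck_linear => ty; exact: cvg_fst. Qed.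

Lemma Ck_space k O i : Ck k O (space_part i).
Proof.
apply: Ck_linear => ty.
exact: (@continuous_comp _ _ _ snd (entry i) ty (@cvg_snd _ _ _ _ _) (@continuous_coord3 R i _)).
Qed.

(** Componentwise, the space-time map is a product of functions of coordinates. *)
Lemma Ck_motion (I U : set R) (b G : R -> R) : open I -> open U -> Ck 2 I b ->
  Ck 2 U G ->
  let O := [set ty : R * 'cV[R]_3 | I ty.1 /\ U (nsq ty.2)] in
  open O /\ Ck 2 O (fun ty => b ty.1 *: rad_map G ty.2).
Proof.
move=> oI oU cb cG O.
have cn : continuous (fun ty : R * 'cV[R]_3 => nsq ty.2).
  move=> ty; exact: (@continuous_comp _ _ _ snd nsq ty (@cvg_snd _ _ _ _ _)
    (@continuous_nsq R _)).
have oO : open O.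
  apply: openI.
    by apply: open_comp oI => ty _; exact: cvg_fst.
  by apply: open_comp oU => ty _; exact: cn.
split => //.
have cs : Ck 2 O (fun ty : R * 'cV[R]_3 => nsq ty.2).
  apply: (Ck_eq oO _ (Ck_sum oO (fun i => CkM oO (Ck_space 2 O i) (Ck_space 2 O i)))).
  by move=> ty _; apply: eq_bigr => i _; rewrite expr2.
have cbt : Ck 2 O (fun ty : R * 'cV[R]_3 => b ty.1).
  by apply: (@Ck_comp _ _ _ O I time_part b oO _ (Ck_time 2 O) cb) => ty [].
have cGs : Ck 2 O (fun ty : R * 'cV[R]_3 => G (nsq ty.2)).
  by apply: (Ck_comp oO _ cs cG) => ty [].
have cp i := CkZl (delta_mx i 0 : 'cV[R]_3) oO
  (CkM oO cbt (CkM oO cGs (Ck_space 2 O i))).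
apply: (Ck_eq oO _ (Ck_sum oO cp)) => ty _.
rewrite rad_map_sum scaler_sumr; apply: eq_bigr => i _.
by rewrite scalerA.
Qed.

Lemma is_derive_scalel {V : normedModType R} (f : R -> R) (x d : R) (v : V) :
  is_derive x 1 f d -> is_derive x 1 (fun t => f t *: v) (d *: v).
Proof.
move=> [/derivable1_diffP df <-].
have hf : is_diff x f ('d f x) by exact: differentiableP.
have [dc dE] := is_diff_comp hf (is_diff_scalel (f x) v).
split; first by apply/derivable1_diffP.
by rewrite deriveE// dE /= deriveE.
Qed.

End Motion.

(** * The theorem *)

Theorem theorem10p1 (R : realType) (h M : R)
    (kappa_gt0 : 0 < kappah h) (M_ge0 : 0 <= M) :
  exists beta0 : R,
  forall (W : 'M[R]_3 -> R) (f : R -> R),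
    strain_energy W -> objective W -> isotropic W -> homogeneous h W ->
    (forall l1 l2 w, 0 < l1 -> 0 < l2 -> esphere 1 w ->
       W (Fsph l1 l2 w) = (l1 * l2 ^+ 2) `^ (h / 3) * f (l1 / l2)) ->
    classC M f ->
    beta0 <= betaf f ->
  exists (phi : R -> R) (p : 'cV[R]_3 -> 'cV[R]_3) (mu : R),
    [/\ spherical_C2 phi p /\ op_deformation p,
        Num.sg mu = - Num.sg h,
        (forall y, oball 1 y ->
           div_mx (fun z => piola_kirchhoff W (grad_on (cball 1) p z)) y
           = mu *: p y) /\
        (forall y, esphere 1 y ->
           piola_kirchhoff W (grad_on (cball 1) p y) *m udir y = 0),
        (h < 0 ->
           cball 1 `<=` p @` cball 1 /\
           forall r, 0 < r <= 1 ->
             phi r / r < deriv_on 1 I01 phi r /\ 1 < phi r / r) /\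
        (3 < h ->
           p @` cball 1 `<=` cball 1 /\
           forall r, 0 < r <= 1 ->
             deriv_on 1 I01 phi r < phi r / r /\ phi r / r < 1) &
        forall a0 b0 : R, 0 < a0 ->
          (exists (tau : \bar R) (a : R -> R),
             maximal_ivp_solution mu h a0 b0 tau a) /\
          forall (tau : \bar R) (a : R -> R),
            maximal_ivp_solution mu h a0 b0 tau a ->
            let x := fun (t : R) (y : 'cV[R]_3) => a t *: p y in
            [/\ (forall t, Itau tau t -> op_deformation (x t)) /\
                Ck_on 2 (Itau tau `*` cball 1)
                  (fun ty : R * 'cV[R]_3 => x ty.1 ty.2),
                (forall t y, Itau tau t -> oball 1 y ->
                   deriv_on 2 (Itau tau) (fun s => x s y) t
                   - div_mx (fun z =>
                       piola_kirchhoff W (grad_on (cball 1) (x t) z)) y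
                   = 0) /\
                (forall t y, Itau tau t -> esphere 1 y ->
                   piola_kirchhoff W (grad_on (cball 1) (x t) y) *m udir y
                   = 0),
                forall t, Itau tau t ->
                  x t @` oball 1 = oball (a t * phi 1),
                h < 0 ->
                  [/\ tau = +oo%E,
                      forall t, 0 < t ->
                        0 < Num.sqrt (2 * energy0 mu h a0 b0)
                            - (a t - a0) / t &
                      Num.sqrt (2 * energy0 mu h a0 b0) - a t / t
                        @[t --> +oo] --> 0] &
                3 < h ->
                  (tau < +oo)%E /\ a t @[t --> (fine tau)^'-] --> 0]].
Proof.
have [beta0 main] := eigenstate_exists kappa_gt0 M_ge0.
exists beta0 => W f sW oW iW hW WE cf bf.
have [U [G [mu [s1 [s2 [d1 [d2 [es G0 smu Gneg Gpos]]]]]]]] :=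
  main W f sW oW iW WE cf bf.
have dW F : GLp F -> differentiable W F.
  by apply: (Ck_of_Ck_on open_GLp (fun _ => id) (sW.1 1)).1.
have oU := es_open es; have UI := es_sub es; have cG := es_C2 es.
have Ggt := es_gt0 es; have dgt := es_rstretch es.
have one01 : (I01 : set R) 1 by rewrite /I01/= lexx ler01.
have id1 : (fun y => 1 *: rad_map G y) = rad_map G.
  by apply/funext => y; rewrite scale1r.
have phirE r : 0 < r <= 1 -> rad_fun G r / r = G (r ^+ 2).
  by move=> /andP[r0 _]; rewrite /rad_fun mulrAC mulfV ?mul1r// gt_eqF.
have dphiE r : 0 < r <= 1 -> deriv_on 1 I01 (rad_fun G) r = rstretch G (r ^+ 2).
  move=> /andP[r0 r1]; apply: (rad_fun_deriv_on UI cG).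
  by rewrite /I01/= (ltW r0).
have sqr01 (r : R) : 0 < r <= 1 -> 0 < r ^+ 2 <= 1.
  by move=> /andP[r0 r1]; apply/andP; split; nra.
have signs : (h < 0 /\ 0 < mu) \/ (3 < h /\ mu < 0).
  case: (kappah_gt0 kappa_gt0) => hh; [left|right]; split => //.
    by rewrite -sgr_gt0 smu ltr0_sg// opprK.
  by rewrite -sgr_lt0 smu gtr0_sg//; lra.
exists (rad_fun G), (rad_map G), mu; split.
- split; first exact: spherical_rad oU UI cG dgt.
  exact: op_rad oU UI cG Ggt dgt.
- exact: smu.
- split=> y y1.
    have := scaled_div dW hW es ltr01 y1.
    by rewrite id1 powR1 mulr1.
  have := scaled_traction dW hW es ltr01 y1.
  by rewrite id1.
- split=> hh; split.
  + move=> z /= z1; have n1 : enorm z <= rad_fun G 1.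
      have [|_ G1] := Gneg hh 1; first by rewrite ltr01 lexx.
      by rewrite /rad_fun mul1r expr1n; exact: le_trans z1 (ltW G1).
    have [y yz [/andP[_ y1] _]] := rad_onto UI cG n1.
    by exists y.
  + move=> r r01; rewrite (phirE _ r01) (dphiE _ r01); exact: Gneg (sqr01 _ r01).
  + move=> _ [y y1 <-]; have n1 : 0 <= nsq y <= 1.
      by rewrite nsq_ge0; exact/cballE.
    rewrite /cball/= (enorm_rad (ltW (Ggt _ n1))) /rad_fun enorm_sqr.
    have [y0|yn0] := eqVneq (enorm y) 0; first by rewrite y0 mul0r.
    have ny0 : 0 < nsq y <= 1.
      by case/andP: n1 => _ ->; rewrite andbT -enorm_sqr exprn_gt0// lt_neqAle eq_sym yn0 enorm_ge0.
    have [_ /ltW G1] := Gpos hh _ ny0.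
    by rewrite mulr_ile1// ?enorm_ge0// ltW// Ggt.
  + move=> r r01; rewrite (phirE _ r01) (dphiE _ r01); exact: Gpos (sqr01 _ r01).
move=> a0 b0 a0_gt0.
have [tau [b [b1 [b2 [gs mb uniq neg pos]]]]] := ivp_maximal b0 signs a0_gt0.
split; first by exists tau, b.
move=> tau' a /uniq[-> ab] x {tau'}.
have [tau0 [b_0 b1_0] db cb2 sol] := gs.
have bgt t : Itau tau t -> 0 < b t by move=> /sol[].
have xE t : Itau tau t -> x t = (fun y => b t *: rad_map G y).
  by move=> It; apply/funext => y; rewrite /x ab.
have dbU t : Itau tau t -> is_derive t 1 b (b1 t) /\ is_derive t 1 b1 (b2 t).
  by move=> It; apply: db; exact: Itau_start It.
split.
- split=> [t It|]; first by rewrite (xE t It); exact (scaled_op es (bgt t It)).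
  have [oO cO] := Ck_motion open_start oU (twosided_Ck gs) cG.
  apply: (Ck_on_of_Ck oO _ _ _ cO).
  + by move=> [t y] [/= It /cballE y1]; split => /=; [exact: Itau_start It|apply: UI; rewrite nsq_ge0].
  + move=> [t y] [/= It y1].
    by apply: starlike_prod; [exact: Itau_starlike tau0 It|exact: cball_starlike y1].
  + by move=> [t y] [/= It y1]; rewrite /x ab.
- split=> t y It y1; rewrite (xE t It); last exact (scaled_traction dW hW es (bgt t It) y1).
  rewrite (scaled_div dW hW es (bgt t It) y1).
  have -> : deriv_on 2 (Itau tau) (fun s => x s y) t = b2 t *: rad_map G y.
    apply: (deriv_on2E (g := fun s => b s *: rad_map G y)
      (g1 := fun s => b1 s *: rad_map G y) (g2 := fun s => b2 s *: rad_map G y)) It.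
    * by move=> s Is; exact: Itau_starlike tau0 Is.
    * by move=> s Is; rewrite /x ab.
    * by move=> s /dbU[ds _]; exact: is_derive_scalel.
    * by move=> s /dbU[_ ds]; exact: is_derive_scalel.
  by have [_ ->] := sol t It; rewrite subrr.
- by move=> t It; rewrite (xE t It) (ab t It); exact (scaled_oball es (bgt t It)).
- move=> hh; have [tauE lt cv] := neg hh; split => //.
    move=> t t0; rewrite ab; first exact: lt.
    by rewrite tauE; split; [exact: ltW|exact: ltry].
  apply: cvg_trans cv; apply: near_eq_cvg; near=> t.
  rewrite ab// tauE; split; last exact: ltry.
  by near: t; exact: nbhs_pinfty_ge.
- move=> hh; have [tauf cv] := pos hh; split => //.
  have tauE : (fine tau)%:E = tau.
    by rewrite fineK// ge0_fin_numE// ltW.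
  have tp : 0 < fine tau by rewrite -lte_fin tauE.
  apply: cvg_trans cv; apply: near_eq_cvg; near=> t.
  rewrite ab//; split; last by rewrite -tauE lte_fin; near: t; exact: nbhs_left_lt.
  by near: t; exact: nbhs_left_ge.
Unshelve. all: by end_near. Qed.
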